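(* Let $p:\mathcal{X}\to\mathcal{B}$ be a proper holomorphic submersion between compact complex manifolds, and let $\omega_{\mathcal{X}}$ be a relative Kähler form on $\mathcal{X}$, i.e. a real smooth $d$-closed $(1,1)$-form on $\mathcal{X}$ whose restriction to each fiber $X_z=p^{-1}(z)$, $z\in\mathcal{B}$, is positive. Suppose that $\mathcal{B}$ admits a Kähler metric with negative holomorphic bisectional curvature, and that the Hermitian metric on the relative tangent bundle $T_{\mathcal{X}/\mathcal{B}}\to\mathcal{X}$ induced by $\omega_{\mathcal{X}}$ is Griffiths negative. Then there exist Kähler metrics on $\mathcal{X}$ with negative holomorphic bisectional curvature.
   Context: The relative tangent bundle is the holomorphic vector bundle $T_{\mathcal{X}/\mathcal{B}}=\ker(p_*:T_{\mathcal{X}}\to p^*T_{\mathcal{B}})$ over $\mathcal{X}$, where $T$ denotes the holomorphic tangent bundle. Choose local holomorphic coordinates $(z^\alpha,v^i)$ on $\mathcal{X}$ with $p(z,v)=z$ (so the $v^i$ are fiber coordinates) and a local function $\phi$ with $\omega_{\mathcal{X}}=\sqrt{-1}\,\partial\bar\partial\phi$. The Hermitian metric on $T_{\mathcal{X}/\mathcal{B}}$ induced by $\omega_{\mathcal{X}}$ is $\langle \partial/\partial v^i,\partial/\partial v^j\rangle=\phi_{i\bar j}:=\partial^2\phi/\partial v^i\partial\bar v^j$. Curvature convention: for a Hermitian holomorphic vector bundle $(E,h)$ over a complex manifold $X$ with local holomorphic frame $\{e_i\}$, $h_{i\bar j}=h(e_i,e_j)$ and local holomorphic coordinates $\{x^\alpha\}$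 on $X$, the Chern curvature has components $$R_{i\bar j\alpha\bar\beta}=-\partial_\alpha\partial_{\bar\beta}h_{i\bar j}+h^{\bar l k}\,\partial_\alpha h_{i\bar l}\,\partial_{\bar\beta}h_{k\bar j}.$$ $(E,h)$ is Griffiths negative if $R_{i\bar j\alpha\bar\beta}v^i\bar v^j\xi^\alpha\bar\xi^\beta<0$ for all nonzero $v=v^ie_i\in E|_x$ and all nonzero $\xi=\xi^\alpha\partial_\alpha\in T_X|_x$, at every point $x\in X$. (For $T_{\mathcal{X}/\mathcal{B}}$ the base manifold is the total space $\mathcal{X}$, so $\xi$ ranges over all nonzero $(1,0)$ tangent vectors of $\mathcal{X}$.) For a Kähler (or Hermitian) metric $h$ on a complex manifold, with Chern curvature of $(T_X,h)$, the holomorphic bisectional curvature along nonzero $(1,0)$-vectors $\xi,\eta$ at a point is $$H(\xi,\eta)=\frac{R_{\gamma\bar\delta\alpha\bar\beta}\,\eta^\gamma\bar\eta^\delta\xi^\alpha\bar\xi^\beta}{\|\xi\|^2\|\eta\|^2};$$ it is negative if $H(\xi,\eta)<0$ for all such nonzero $\xi,\eta$. *)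

(* Defs.v *)
From HB Require Import structures.
From mathcomp Require Import all_boot all_order all_algebra.
From mathcomp Require Import all_classical all_reals all_analysis.
From mathcomp Require Import complex.

Set Implicit Arguments.
Unset Strict Implicit.
Unset Printing Implicit Defensive.

Import Order.TTheory GRing.Theory Num.Theory numFieldNormedType.Exports.

Local Open Scope classical_set_scope.
Local Open Scope sesquilinear_scope.
Local Open Scope complex_scope.
Local Open Scope ring_scope.

(* [R[i]] carries no canonical topology in the library; seen through the
   structure projection of [numClosedFieldType] it gets the one of its norm. *)
Definition cplx (R : realType) : numClosedFieldType := R[i].

Definition rquot (R : realType) (n : nat) (f : 'rV[cplx R]_n -> cplx R)
    (x v : 'rV[cplx R]_n) (t : R) : cplx R :=
  (t^-1)%:C * (f (x + (t%:C : cplx R) *: v) - f x).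

(* The directional derivatives are along real lines of the real vector space
   underlying C^n; the library's ['D_v f] over [cplx R] would be the complex
   derivative. *)
Definition rderivable (R : realType) (n : nat) (f : 'rV[cplx R]_n -> cplx R)
    (x v : 'rV[cplx R]_n) : Prop :=
  cvg (rquot f x v t @[t --> (0 : R)^']).

Definition rderive (R : realType) (n : nat) (f : 'rV[cplx R]_n -> cplx R)
    (v x : 'rV[cplx R]_n) : cplx R :=
  lim (rquot f x v t @[t --> (0 : R)^']).

Fixpoint class_C (R : realType) (n k : nat) (U : set 'rV[cplx R]_n)
    (f : 'rV[cplx R]_n -> cplx R) : Prop :=
  (forall x, U x -> {for x, continuous f}) /\
  if k is k'.+1 then
    forall v : 'rV[cplx R]_n, (forall x, U x -> rderivable f x v) /\
      class_C k' U (rderive f v)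
  else True.

Definition smooth_on (R : realType) (n : nat) (U : set 'rV[cplx R]_n)
    (f : 'rV[cplx R]_n -> cplx R) : Prop :=
  forall k, class_C k U f.

(* Wirtinger operators d/dx^a = (d/ds^a - i d/dt^a) / 2 and
   d/d(x^a)bar = (d/ds^a + i d/dt^a) / 2, where x^a = s^a + i t^a. *)
Definition del (R : realType) (n : nat) (a : 'I_n)
    (f : 'rV[cplx R]_n -> cplx R) (x : 'rV[cplx R]_n) : cplx R :=
  2^-1 * (rderive f (delta_mx 0 a) x - 'i * rderive f ('i *: delta_mx 0 a) x).

Definition delbar (R : realType) (n : nat) (a : 'I_n)
    (f : 'rV[cplx R]_n -> cplx R) (x : 'rV[cplx R]_n) : cplx R :=
  2^-1 * (rderive f (delta_mx 0 a) x + 'i * rderive f ('i *: delta_mx 0 a) x).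

(* Holomorphic in the sense of Griffiths and Harris: smooth, and a solution of
   the Cauchy-Riemann equations. Matrix-valued maps are treated entrywise. *)
Definition holomorphic_on (R : realType) (n r s : nat)
    (U : set 'rV[cplx R]_n) (F : 'rV[cplx R]_n -> 'M[cplx R]_(r, s)) : Prop :=
  forall i j, smooth_on U (fun x => F x i j) /\
    forall a x, U x -> delbar a (fun y => F y i j) x = 0.

(* Tangent vectors are row vectors: the differential of f at x is
   [u |-> u *m jacobian f x]. *)
Definition jacobian (R : realType) (n m : nat)
    (f : 'rV[cplx R]_n -> 'rV[cplx R]_m) (x : 'rV[cplx R]_n)
    : 'M[cplx R]_(n, m) :=
  \matrix_(a, j) del a (fun y => f y 0 j) x.

(* A manifold of pure dimension n, not assumed connected. The values of
   [coord i] outside [dom i], and of [param i] outside the image of [dom i],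
   are irrelevant. *)
Record complexManifold (R : realType) (n : nat) := ComplexManifold {
  cm_space :> topologicalType;
  cm_hausdorff : hausdorff_space cm_space;
  cm_second_countable : @second_countable cm_space;
  chart : Type;
  dom : chart -> set cm_space;
  coord : chart -> cm_space -> 'rV[cplx R]_n;
  param : chart -> 'rV[cplx R]_n -> cm_space;
  dom_cover : forall x, exists i, dom i x;
  dom_open : forall i, open (dom i);
  coord_open : forall i, open (coord i @` dom i);
  coordK : forall i x, dom i x -> param i (coord i x) = x;
  coord_continuous : forall i x, dom i x -> {for x, continuous (coord i)};
  param_continuous : forall i y, (coord i @` dom i) y ->
    {for y, continuous (param i)};
  transition_holomorphic : forall i j,
    holomorphic_on (coord i @` (dom i `&` dom j)) (coord j \o param i)
}.

(* The (1,1)-form sqrt(-1) * sum_(a,b) g_{a bbar} dx^a /\ d(x^b)bar, given by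
   its matrix of coefficients [g = coef i] in each chart; only the values on
   the image of the chart matter. *)
Record form11 (R : realType) (n : nat) (X : complexManifold R n) := Form11 {
  coef :> chart X -> 'rV[cplx R]_n -> 'M[cplx R]_n;
  coef_transition : forall (i j : chart X) (x : X), dom i x -> dom j x ->
    let J := jacobian (coord j \o param i) (coord i x) in
    coef i (coord i x) = J *m coef j (coord j x) *m J^t*
}.

Definition hform (R : realType) (n : nat) (g : 'M[cplx R]_n)
    (u v : 'rV[cplx R]_n) : cplx R :=
  (u *m g *m v^t*) 0 0.

Definition form_real (R : realType) (n : nat) (X : complexManifold R n)
    (w : form11 X) : Prop :=
  forall (i : chart X) (x : X), dom i x ->
    (w i (coord i x))^t* = w i (coord i x).

Definition form_smooth (R : realType) (n : nat) (X : complexManifold R n)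
    (w : form11 X) : Prop :=
  forall (i : chart X) (a b : 'I_n),
    smooth_on (coord i @` dom i) (fun y => w i y a b).

(* Vanishing of the (2,1)- and (1,2)-components of dw, i.e. of the coefficients
   of dx^c /\ dx^a /\ d(x^b)bar and of d(x^c)bar /\ dx^a /\ d(x^b)bar. *)
Definition form_closed (R : realType) (n : nat) (X : complexManifold R n)
    (w : form11 X) : Prop :=
  forall (i : chart X) (y : 'rV[cplx R]_n), (coord i @` dom i) y ->
  forall a b c : 'I_n,
    del c (fun z => w i z a b) y - del a (fun z => w i z c b) y = 0 /\
    delbar c (fun z => w i z a b) y - delbar b (fun z => w i z a c) y = 0.

Definition form_positive (R : realType) (n : nat) (X : complexManifold R n)
    (w : form11 X) : Prop :=
  forall (i : chart X) (x : X), dom i x ->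
  forall u : 'rV[cplx R]_n, u != 0 -> 0 < hform (w i (coord i x)) u u.

(* A Kaehler metric is identified with its Kaehler form. *)
Definition kahler_metric (R : realType) (n : nat) (X : complexManifold R n)
    (w : form11 X) : Prop :=
  [/\ form_real w, form_smooth w, form_closed w & form_positive w].

(* R_{i jbar a bbar} for the Gram matrix h_{i jbar} of a holomorphic frame. *)
Definition chern_curv (R : realType) (n r : nat)
    (h : 'rV[cplx R]_n -> 'M[cplx R]_r) (x : 'rV[cplx R]_n)
    (i j : 'I_r) (a b : 'I_n) : cplx R :=
  - del a (delbar b (fun y => h y i j)) x
  + \sum_(k < r) \sum_(l < r)
      invmx (h x) l k * del a (fun y => h y i l) x
                      * delbar b (fun y => h y k j) x.

Definition chern_form (R : realType) (n r : nat)
    (h : 'rV[cplx R]_n -> 'M[cplx R]_r) (x : 'rV[cplx R]_n)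
    (v : 'rV[cplx R]_r) (xi : 'rV[cplx R]_n) : cplx R :=
  \sum_(i < r) \sum_(j < r) \sum_(a < n) \sum_(b < n)
    chern_curv h x i j a b * v 0 i * (v 0 j)^* * xi 0 a * (xi 0 b)^*.

Definition bisectional (R : realType) (n : nat)
    (g : 'rV[cplx R]_n -> 'M[cplx R]_n) (x xi eta : 'rV[cplx R]_n) : cplx R :=
  chern_form g x eta xi / (hform (g x) xi xi * hform (g x) eta eta).

Definition negative_bisectional (R : realType) (n : nat)
    (X : complexManifold R n) (w : form11 X) : Prop :=
  forall (i : chart X) (x : X), dom i x ->
  forall xi eta : 'rV[cplx R]_n, xi != 0 -> eta != 0 ->
    bisectional (w i) (coord i x) xi eta < 0.

Definition local_rep (R : realType) (n m : nat) (X : complexManifold R n)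
    (B : complexManifold R m) (p : X -> B) (i : chart X) (j : chart B)
    : 'rV[cplx R]_n -> 'rV[cplx R]_m :=
  coord j \o p \o param i.

Definition proper_map (S T : topologicalType) (p : S -> T) : Prop :=
  continuous p /\ forall K : set T, compact K -> compact (p @^-1` K).

Definition holomorphic_map (R : realType) (n m : nat)
    (X : complexManifold R n) (B : complexManifold R m) (p : X -> B) : Prop :=
  continuous p /\ forall (i : chart X) (j : chart B),
    holomorphic_on (coord i @` (dom i `&` p @^-1` dom j)) (local_rep p i j).

Definition submersion (R : realType) (n m : nat)
    (X : complexManifold R n) (B : complexManifold R m) (p : X -> B) : Prop :=
  forall (i : chart X) (j : chart B) (x : X), dom i x -> dom j (p x) ->
    row_full (jacobian (local_rep p i j) (coord i x)).

(* The tangent space at x of the fiber through x is the kernel of p_* at x. *)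
Definition positive_on_fibers (R : realType) (n m : nat)
    (X : complexManifold R n) (B : complexManifold R m) (p : X -> B)
    (w : form11 X) : Prop :=
  forall (z : B) (x : X), p x = z ->
  forall (i : chart X) (j : chart B), dom i x -> dom j z ->
  forall u : 'rV[cplx R]_n, u != 0 ->
    u *m jacobian (local_rep p i j) (coord i x) = 0 ->
    0 < hform (w i (coord i x)) u u.

Definition relative_kahler_form (R : realType) (n m : nat)
    (X : complexManifold R n) (B : complexManifold R m) (p : X -> B)
    (w : form11 X) : Prop :=
  [/\ form_real w, form_smooth w, form_closed w & positive_on_fibers p w].

(* A holomorphic frame of T_{X/B} = ker p_* over U: its members are the rows
   of [E], written in the coordinates of the chart [i]. In coordinates (z, v)
   with p(z, v) = z, the d/dv^i form such a frame. *)
Definition vertical_frame (R : realType) (n m r : nat)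
    (X : complexManifold R n) (B : complexManifold R m) (p : X -> B)
    (i : chart X) (j : chart B) (U : set 'rV[cplx R]_n)
    (E : 'rV[cplx R]_n -> 'M[cplx R]_(r, n)) : Prop :=
  [/\ open U, U `<=` coord i @` (dom i `&` p @^-1` dom j),
      holomorphic_on U E &
      forall y, U y -> row_free (E y) /\
        (E y :=: kermx (jacobian (local_rep p i j) y))%MS].

(* Gram matrix <e_k, e_l> of the frame [E] for the metric induced by w; for the
   frame d/dv^i and w = sqrt(-1) d dbar phi this is phi_{i jbar}. *)
Definition frame_metric (R : realType) (n r : nat) (X : complexManifold R n)
    (w : form11 X) (i : chart X) (E : 'rV[cplx R]_n -> 'M[cplx R]_(r, n))
    (y : 'rV[cplx R]_n) : 'M[cplx R]_r :=
  E y *m w i y *m (E y)^t*.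

Definition griffiths_negative_relative_tangent (R : realType) (n m : nat)
    (X : complexManifold R n) (B : complexManifold R m) (p : X -> B)
    (w : form11 X) : Prop :=
  forall (r : nat) (i : chart X) (j : chart B) (U : set 'rV[cplx R]_n)
    (E : 'rV[cplx R]_n -> 'M[cplx R]_(r, n)),
  vertical_frame p i j U E ->
  forall y, U y ->
  forall (v : 'rV[cplx R]_r) (xi : 'rV[cplx R]_n), v != 0 -> xi != 0 ->
    chern_form (frame_metric w i E) y v xi < 0.

(* Main.v *)
(* For small e > 0 the metric omega + e^-1 p^* g has the required properties,
   where g is the given metric on B. Near a point choose a holomorphic frame of
   T_X made of a frame of T_{X/B} and of lifts of the coordinate fields of B.
   In it the metric is a 2 x 2 block matrix in which e^-1 only affects the
   horizontal block; inverting it by a Schur complement gives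

     R_e(eta, xi) = e^-1 R_g(p_* eta, p_* xi) + T_e(eta, xi),

   where T_e extends continuously to e = 0. If neither eta nor xi is vertical
   the first term is negative and dominates. If eta is vertical the first term
   is at most 0 near eta, while T_0(eta, xi) is the curvature of T_{X/B}, which
   is negative. If xi is vertical, exchange eta and xi by the symmetry of the
   curvature of a Kaehler metric. The compactness of the unit spheres and of X
   makes the choice of e uniform. *)

Require Import Defs.
From mathcomp Require Import all_boot all_order all_algebra.
From mathcomp Require Import all_classical all_reals all_analysis.
From mathcomp Require Import complex.
From mathcomp Require Import ring lra.

Set Implicit Arguments.
Unset Strict Implicit.
Unset Printing Implicit Defensive.

Import Order.TTheory GRing.Theory Num.Theory numFieldNormedType.Exports.

Local Open Scope classical_set_scope.
Local Open Scope sesquilinear_scope.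
Local Open Scope complex_scope.
Local Open Scope ring_scope.

(** The estimates are all replaced by limits. In the adapted frame the derivatives of the metric
    also carry [e^-1], so the curvature contains [e^-2] times an inverse metric. The horizontal
    block of that inverse is [e (h + e S)^-1], where [h] is the base metric and [S] the Schur
    complement of the Gram matrix of omega. The exact identity [(h + e S)^-1 = h^-1 - e (h + e S)^-1
    S h^-1] then splits off [e^-1] times the curvature of [h] and leaves a remainder without
    negative powers of [e]. Limits can thus be taken along a filter in which the point, the two
    directions and [e] move together. The curvature is handled as a matrix [curv] of Wirtinger
    derivatives along one direction; a single law, [curv_pullback], governs both changes of
    holomorphic frame and changes of coordinates. The frame itself comes from linear algebra applied
    to the differential of [p], so charts adapted to [p] do not occur. The order of the complex
    numbers compares only numbers with equal imaginary parts. A sign therefore passes from a limit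
    to nearby values only together with a proof of reality, which rests on Hermitian symmetry. *)

Local Notation jacobian := Defs.jacobian.
Local Notation coord := Defs.coord.

(** * Complex numbers as pairs of reals *)

(* [R[i]] has no canonical topology, hence a cast into [cplx R]. *)
Definition toC {R : realType} (t : R) : cplx R := t%:C.
Arguments toC : simpl never.

Section RealComplex.
Variable R : realType.
Local Notation C := (cplx R).

Lemma toCD (s t : R) : toC (s + t) = toC s + toC t.
Proof. exact: rmorphD. Qed.

Lemma toCN (s : R) : toC (- s) = - toC s.
Proof. exact: rmorphN. Qed.

Lemma toCM (s t : R) : toC (s * t) = toC s * toC t.
Proof. exact: rmorphM. Qed.

Lemma toCV (s : R) : toC s^-1 = (toC s)^-1.
Proof. exact: fmorphV. Qed.

Lemma toC0 : toC (0 : R) = 0. Proof. by []. Qed.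
Lemma toC1 : toC (1 : R) = 1. Proof. by []. Qed.

Lemma toC_eq0 (s : R) : (toC s == 0) = (s == 0).
Proof. by rewrite /toC fmorph_eq0. Qed.

Lemma ler_toC (s t : R) : (toC s <= toC t) = (s <= t).
Proof. exact: lecR. Qed.

Lemma ltr_toC (s t : R) : (toC s < toC t) = (s < t).
Proof. exact: ltcR. Qed.

Lemma normr_toC (s : R) : `|toC s| = toC `|s|.
Proof.
rewrite /toC; case: (ger0P s) => hs; first by rewrite ger0_norm ?lecR.
by rewrite ltr0_norm ?ltcR // rmorphN.
Qed.

Lemma conj_toC (s : R) : (toC s)^* = toC s.
Proof.
apply/CrealP.
rewrite realE (_ : (0 : C) = toC 0) // !ler_toC; exact: num_real.
Qed.

Lemma gt0_toC (e : C) : 0 < e -> exists2 d : R, 0 < d & e = toC d.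
Proof.
move=> e0; exists (complex.Re e); first by move: e0; rewrite ltcE => /andP[].
by rewrite /toC RRe_real // realE ltW.
Qed.


Lemma cplxE (z : C) : z = toC (complex.Re z) + 'i * toC (complex.Im z).
Proof. by rewrite -complexiE {1}[z]complexE. Qed.

Lemma cReE (z : C) : toC (complex.Re z) = 2^-1 * (z + z^*).
Proof.
rewrite {2 3}[z]cplxE rmorphD rmorphM /= conjCi !conj_toC.
by field.
Qed.

Lemma cImE (z : C) : toC (complex.Im z) = 2^-1 * - 'i * (z - z^*).
Proof.
rewrite {2 3}[z]cplxE rmorphD rmorphM /= conjCi !conj_toC.
have e : forall a b : C, 2^-1 * - 'i * (a + 'i * b - (a + - 'i * b)) =
  - ('i ^+ 2 * b) by move=> a b; field.
by rewrite e sqrCi mulN1r opprK.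
Qed.

Lemma normr_Re (z : C) : toC `|complex.Re z| <= `|z|.
Proof. exact: normc_ge_Re. Qed.

Lemma normr_Im (z : C) : toC `|complex.Im z| <= `|z|.
Proof.
rewrite -normr_toC cImE !normrM normrN normCi mulr1 ger0_norm ?invr_ge0 ?ler0n //.
rewrite ler_pdivrMl ?ltr0n // (le_trans (ler_normB _ _)) // norm_conjC.
by rewrite mulr_natl mulr2n.
Qed.

Lemma normr_le_ReIm (z : C) :
  `|z| <= toC (`|complex.Re z| + `|complex.Im z|).
Proof.
rewrite {1}[z]cplxE (le_trans (ler_normD _ _)) // normrM normCi mul1r.
by rewrite !normr_toC toCD.
Qed.

Lemma cReD (z w : C) : complex.Re (z + w) = complex.Re z + complex.Re w.
Proof. by case: z w => [a b] [c d]. Qed.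
Lemma cImD (z w : C) : complex.Im (z + w) = complex.Im z + complex.Im w.
Proof. by case: z w => [a b] [c d]. Qed.
Lemma cReN (z : C) : complex.Re (- z) = - complex.Re z.
Proof. by case: z => [a b]. Qed.
Lemma cImN (z : C) : complex.Im (- z) = - complex.Im z.
Proof. by case: z => [a b]. Qed.
Lemma cReM (s : R) (z : C) : complex.Re (toC s * z) = s * complex.Re z.
Proof. by case: z => [a b] /=; rewrite mul0r subr0. Qed.
Lemma cImM (s : R) (z : C) : complex.Im (toC s * z) = s * complex.Im z.
Proof. by case: z => [a b] /=; rewrite mul0r addr0. Qed.

Section Limits.
Context {T : Type} {F : set_system T} {FF : Filter F}.

Lemma cvg_near_eq (U : topologicalType) (f g : T -> U) (l : U) :
  f t @[t --> F] --> l -> (\forall t \near F, f t = g t) ->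
  g t @[t --> F] --> l.
Proof.
move=> fl fg; apply: cvg_trans fl; apply: near_eq_cvg.
by apply: filterS fg => t ->.
Qed.

Lemma cvg_toC (f : T -> R) (l : R) :
  f t @[t --> F] --> l -> toC (f t) @[t --> F] --> toC l.
Proof.
move=> /cvgrPdist_lt fl; apply/cvgrPdist_lt => e /gt0_toC[d d0 ->].
near=> t; rewrite -toCN -toCD normr_toC ltr_toC; near: t; exact: fl.
Unshelve. all: by end_near. Qed.

Lemma cvg_Re (f : T -> C) (l : C) :
  f t @[t --> F] --> l -> complex.Re (f t) @[t --> F] --> complex.Re l.
Proof.
move=> /cvgrPdist_lt fl; apply/cvgrPdist_lt => e e0.
near=> t; rewrite -cReN -cReD -ltr_toC (le_lt_trans (normr_Re _)) //.
by near: t; apply: fl; rewrite (_ : 0 = toC 0) // ltr_toC.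
Unshelve. all: by end_near. Qed.

Lemma cvg_Im (f : T -> C) (l : C) :
  f t @[t --> F] --> l -> complex.Im (f t) @[t --> F] --> complex.Im l.
Proof.
move=> /cvgrPdist_lt fl; apply/cvgrPdist_lt => e e0.
near=> t; rewrite -cImN -cImD -ltr_toC (le_lt_trans (normr_Im _)) //.
by near: t; apply: fl; rewrite (_ : 0 = toC 0) // ltr_toC.
Unshelve. all: by end_near. Qed.

Lemma cvg_conj (f : T -> C) (l : C) :
  f t @[t --> F] --> l -> (f t)^* @[t --> F] --> l^*.
Proof.
move=> /cvgrPdist_lt fl; apply/cvgrPdist_lt => e e0.
near=> t; rewrite -rmorphB norm_conjC; near: t; exact: fl.
Unshelve. all: by end_near. Qed.

End Limits.
End RealComplex.

(** * Directional derivatives *)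

Section RealDerivative.
Variables (R : realType) (n : nat).
Local Notation C := (cplx R).
Local Notation V := 'rV[C]_n.
Implicit Types (f g : V -> C) (x v : V).

Lemma rquotE f x v t :
  rquot f x v t = toC t^-1 * (f (x + toC t *: v) - f x).
Proof. by []. Qed.

Definition is_rder f x v (l : C) := rquot f x v t @[t --> (0 : R)^'] --> l.

Lemma is_rder_rderivable f x v l : is_rder f x v l -> rderivable f x v.
Proof. by move=> H; apply/cvg_ex; exists l. Qed.

Lemma is_rder_rderive f x v l : is_rder f x v l -> rderive f v x = l.
Proof. by move=> H; apply: cvg_lim => //; exact: norm_hausdorff. Qed.

Lemma rderivableP f x v : rderivable f x v -> is_rder f x v (rderive f v x).
Proof. by []. Qed.

Lemma cvg_line x v : x + toC t *: v @[t --> (0 : R)] --> x.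
Proof.
have /(cvgD (cvg_cst x)) : toC t *: v @[t --> (0 : R)] --> (0 : V).
  rewrite -[X in _ --> X](scale0r v); apply: cvgZr_tmp; rewrite -toC0.
  exact: cvg_toC.
by rewrite addr0; apply.
Qed.

Lemma cvg_line_dnbhs x v : x + toC t *: v @[t --> (0 : R)^'] --> x.
Proof. by apply: cvg_within_filter; exact: cvg_line. Qed.

Lemma near_rquot f g x v : (\forall y \near x, f y = g y) ->
  \forall t \near (0 : R)^', rquot f x v t = rquot g x v t.
Proof.
move=> fg; have fgx := nbhs_singleton fg.
near=> t; rewrite !rquotE -fgx; congr (_ * (_ - _)).
by near: t; exact: (@cvg_line_dnbhs x v _ fg).
Unshelve. all: by end_near. Qed.

Lemma near_is_rder f g x v l :
  (\forall y \near x, f y = g y) -> is_rder f x v l -> is_rder g x v l.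
Proof. by move=> fg; move=> H; apply: cvg_near_eq H _; exact: near_rquot. Qed.

Lemma near_rderive f g x v :
  (\forall y \near x, f y = g y) -> rderive f v x = rderive g v x.
Proof.
move=> fg; rewrite /rderive; congr (lim _).
by rewrite eqEsubset; split; apply: near_eq_cvg; apply: near_rquot;
  apply: filterS fg => y.
Qed.

(** Differentiability along one line gives continuity along that line only. This is what the product
    and quotient rules need, since they do not assume [f] continuous at [x]. *)
Lemma is_rder_cvg f x v l :
  is_rder f x v l -> f (x + toC t *: v) @[t --> (0 : R)^'] --> f x.
Proof.
move=> fl.
have : toC t * rquot f x v t + f x @[t --> (0 : R)^'] --> toC 0 * l + f x.
  have t0 : toC t @[t --> (0 : R)^'] --> toC (0 : R).
    by apply: cvg_toC; apply: cvg_within_filter; exact: cvg_id.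
  exact: cvgD (cvgM t0 fl) (cvg_cst _).
rewrite toC0 mul0r add0r; move=> H; apply: cvg_near_eq H _.
near=> t; rewrite !rquotE mulrA -toCM mulfV ?mul1r ?subrK //.
by near: t; exact: nbhs_dnbhs_neq.
Unshelve. all: by end_near. Qed.

Lemma is_rder_cst (c : C) x v : is_rder (fun=> c) x v 0.
Proof. by rewrite /is_rder /rquot subrr; under eq_fun do rewrite mulr0; exact: cvg_cst. Qed.

Lemma is_rderD f g x v l k :
  is_rder f x v l -> is_rder g x v k -> is_rder (fun y => f y + g y) x v (l + k).
Proof.
rewrite /is_rder => fl gk; apply: (cvg_near_eq (cvgD fl gk)).
by near=> t; rewrite !rquotE; ring.
Unshelve. all: by end_near. Qed.

Lemma is_rderM f g x v l k : is_rder f x v l -> is_rder g x v k ->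
  is_rder (fun y => f y * g y) x v (l * g x + f x * k).
Proof.
move=> fl gk; have fx := is_rder_cvg fl.
apply: (cvg_near_eq (cvgD (cvgM fl (cvg_cst (g x))) (cvgM fx gk))).
by near=> t; rewrite /= !rquotE; ring.
Unshelve. all: by end_near. Qed.

Lemma is_rder_conj f x v l : is_rder f x v l -> is_rder (fun y => (f y)^*) x v l^*.
Proof.
move=> fl; apply: (cvg_near_eq (cvg_conj fl)).
by near=> t; rewrite !rquotE rmorphM rmorphB /= conj_toC.
Unshelve. all: by end_near. Qed.

Lemma is_rder_sum (I : Type) (r : seq I) (P : pred I) (f : I -> V -> C) x v (l : I -> C) :
  (forall i, P i -> is_rder (f i) x v (l i)) ->
  is_rder (fun y => \sum_(i <- r | P i) f i y) x v (\sum_(i <- r | P i) l i).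
Proof.
move=> H; elim: r => [|i r IH].
  by rewrite big_nil; under eq_fun do rewrite big_nil; exact: is_rder_cst.
rewrite big_cons; under eq_fun do rewrite big_cons.
case: ifP => Pi; last exact: IH.
by apply: is_rderD; [exact: H | exact: IH].
Qed.

Lemma is_rderV f x v l : is_rder f x v l -> f x != 0 ->
  is_rder (fun y => (f y)^-1) x v (- l / (f x ^+ 2)).
Proof.
move=> fl fx0; have fx := is_rder_cvg fl.
rewrite expr2.
apply: (cvg_near_eq (cvgM (cvgN fl) (cvgV (mulf_neq0 fx0 fx0) (cvgM fx (cvg_cst (f x)))))).
near=> t; rewrite /= !rquotE.
have h : f (x + toC t *: v) != 0.
  by near: t; exact: cvgr_neq0 fx fx0.
have -> : (- [eta rquot f x v]) t = - rquot f x v t by [].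
rewrite rquotE.
have t0 : toC t != 0 by rewrite toC_eq0; near: t; exact: nbhs_dnbhs_neq.
by field; rewrite fx0 h.
Unshelve. all: by end_near. Qed.

End RealDerivative.

(** * Mean value estimates along real lines *)

Section MeanValue.
Variables (R : realType) (n : nat).
Local Notation C := (cplx R).
Local Notation V := 'rV[C]_n.
Implicit Types (f g : V -> C) (x y v e : V).

(** The sign of [s] is free while the mean value theorem on a segment wants ordered endpoints, hence
    the two cases. *)
Lemma real_mean_value (u du : R -> R) (s : R) :
  (forall t : R, `|t| <= `|s| -> is_derive t (1 : R) u (du t)) ->
  exists2 c, `|c| <= `|s| & u s - u 0 = du c * s.
Proof.
move=> H.
have cont (a b : R) : `|a| <= `|s| -> `|b| <= `|s| -> {within `[a, b], continuous u}.
  move=> ha hb; apply: continuous_in_subspaceT => t; rewrite inE /= in_itv /= => /andP[h1 h2].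
  apply/differentiable_continuous/derivable1_diffP.
  have [] // := H t _; move: ha hb; rewrite !ler_norml; lra.
have bound (a b t : R) : `|a| <= `|s| -> `|b| <= `|s| -> a <= t <= b -> `|t| <= `|s|.
  move=> ha hb; move: ha hb; rewrite !ler_norml; lra.
have z0 : `|0 : R| <= `|s| by rewrite normr0.
have [s0|/ltW s0] := lerP 0 s.
  have der t : t \in `]0, s[ -> is_derive t (1 : R) u (du t).
    rewrite in_itv /= => /andP[/ltW h1 /ltW h2]; apply: H.
    by apply: (bound 0 s) => //; rewrite h1 h2.
  have [c cs E] := MVT_segment s0 der (cont _ _ z0 (lexx _)).
  exists c; last by rewrite E subr0.
  by apply: (bound 0 s) => //; move: cs; rewrite in_itv.
have der t : t \in `]s, 0[ -> is_derive t (1 : R) u (du t).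
  rewrite in_itv /= => /andP[/ltW h1 /ltW h2]; apply: H.
  by apply: (bound s 0) => //; rewrite h1 h2.
have [c cs E] := MVT_segment s0 der (cont _ _ (lexx _) z0).
exists c; last by rewrite -[LHS]opprB E sub0r mulrN opprK.
by apply: (bound s 0) => //; move: cs; rewrite in_itv.
Qed.

Lemma is_rder_shift f y e (t : R) (l : C) : is_rder f (y + toC t *: e) e l ->
  (toC h^-1 * (f (y + toC (h + t) *: e) - f (y + toC t *: e))) @[h --> (0 : R)^'] --> l.
Proof.
move=> H; apply: cvg_near_eq H _; near=> h.
by rewrite /rquot toCD scalerDl [toC h *: e + _]addrC addrA.
Unshelve. all: by end_near. Qed.

(* The factor 2 comes from applying the mean value theorem separately to the real
   and to the imaginary part. *)
Lemma mean_value_bound f y e (D : R -> C) (L : C) (eps s : R) :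
  (forall t, `|t| <= `|s| -> is_rder f (y + toC t *: e) e (D t)) ->
  (forall t, `|t| <= `|s| -> `|D t - L| <= toC eps) ->
  `|f (y + toC s *: e) - f y - toC s * L| <= toC (2 * eps * `|s|).
Proof.
move=> fD DL.
have dRe (t : R) : `|t| <= `|s| ->
    is_derive t (1 : R) (fun t => complex.Re (f (y + toC t *: e))) (complex.Re (D t)).
  move=> /fD /is_rder_shift /cvg_Re H.
  have H' : (fun h => h^-1 *: (complex.Re (f (y + toC (h *: 1 + t) *: e)) -
       complex.Re (f (y + toC t *: e)))) @ (0 : R)^' --> complex.Re (D t).
    apply: cvg_near_eq H _; near=> h.
    by rewrite cReM cReD cReN [h *: 1]mulr1.
  by apply: DeriveDef; [apply/cvg_ex; exists (complex.Re (D t)) | exact/cvg_lim].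
have dIm (t : R) : `|t| <= `|s| ->
    is_derive t (1 : R) (fun t => complex.Im (f (y + toC t *: e))) (complex.Im (D t)).
  move=> /fD /is_rder_shift /cvg_Im H.
  have H' : (fun h => h^-1 *: (complex.Im (f (y + toC (h *: 1 + t) *: e)) -
       complex.Im (f (y + toC t *: e)))) @ (0 : R)^' --> complex.Im (D t).
    apply: cvg_near_eq H _; near=> h.
    by rewrite cImM cImD cImN [h *: 1]mulr1.
  by apply: DeriveDef; [apply/cvg_ex; exists (complex.Im (D t)) | exact/cvg_lim].
have [c cs] := real_mean_value dRe; have [d ds] := real_mean_value dIm.
rewrite toC0 scale0r addr0 => Ed Ec.
apply: le_trans (normr_le_ReIm _) _; rewrite ler_toC.
rewrite !(cReD, cImD, cReN, cImN, cReM, cImM) Ec Ed !(mulrC s) -!mulrBl !normrM -mulrDl.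
apply: ler_wpM2r; rewrite ?normr_ge0 // mulr2n mulrDl mul1r lerD //.
- by rewrite -cReN -cReD -ler_toC (le_trans (normr_Re _)) // DL.
- by rewrite -cImN -cImD -ler_toC (le_trans (normr_Im _)) // DL.
Unshelve. all: by end_near. Qed.

(** Continuity of [(y, t) |-> y + t e] at [(y0, 0)], read on a product neighbourhood: one length [d]
    serves all base points near [y0]. This matters below, where base points move. *)
Lemma near_segment y0 e (N : set V) : nbhs y0 N ->
  exists2 d : R, 0 < d &
    \forall y \near y0, forall t : R, `|t| < d -> N (y + toC t *: e).
Proof.
move=> N0.
have : z.1 + toC z.2 *: e @[z --> (y0, (0 : R))] --> y0.
  have /(cvgD cvg_fst) : toC z.2 *: e @[z --> (y0, (0 : R))] --> (0 : V).
    rewrite -[X in _ --> X](scale0r e); apply: cvgZr_tmp; rewrite -toC0.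
    by apply: cvg_toC; exact: cvg_snd.
  by rewrite addr0; apply.
move=> /(_ _ N0) [[P Q] /= [P0 Q0] PQ].
have [d /= d0 dQ] := (nbhs_ballP _ _).1 Q0.
exists d => //; apply: filterS P0 => y Py t td.
apply: (PQ (y, t)); split => //=; apply: dQ.
by rewrite /ball /= sub0r normrN.
Qed.

Lemma cvg0_of_quotient (s : R -> R) (sigma : R) :
  t^-1 * s t @[t --> (0 : R)^'] --> sigma -> s t @[t --> (0 : R)^'] --> 0.
Proof.
move=> ss.
have : t * (t^-1 * s t) @[t --> (0 : R)^'] --> 0 * sigma.
  have t0 : t @[t --> (0 : R)^'] --> (0 : R) by apply: cvg_within_filter; exact: cvg_id.
  exact: cvgM t0 ss.
rewrite mul0r => H; apply: (cvg_near_eq H); near=> t.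
by rewrite mulrA mulfV ?mul1r //; near: t; exact: nbhs_dnbhs_neq.
Unshelve. all: by end_near. Qed.

(** A chain rule in one direction where the base point [y t] and the increment [s t] both move.
    Continuity of the partial derivative at [y0] makes the mean value error small uniformly in the
    base point. *)
Lemma cvg_partial_quotient f e y0 (y : R -> V) (s : R -> R) (sigma : R) :
  (\forall y \near y0, rderivable f y e) ->
  {for y0, continuous (rderive f e)} ->
  y t @[t --> (0 : R)^'] --> y0 -> t^-1 * s t @[t --> (0 : R)^'] --> sigma ->
  toC t^-1 * (f (y t + toC (s t) *: e) - f (y t)) @[t --> (0 : R)^'] -->
    toC sigma * rderive f e y0.
Proof.
move=> fe fc yy0 ss.
have s0 : s t @[t --> (0 : R)^'] --> 0 by exact: cvg0_of_quotient ss.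
set L := rderive f e y0.
suff E : toC t^-1 * (f (y t + toC (s t) *: e) - f (y t) - toC (s t) * L)
    @[t --> (0 : R)^'] --> (0 : C).
  rewrite -[_ * L]add0r.
  apply: (cvg_near_eq (cvgD E (cvgM (cvg_toC ss) (cvg_cst L)))).
  by near=> t; rewrite /= toCM; ring.
apply/cvgrPdist_le => eps /gt0_toC[eps' eps0 ->].
pose d := eps' / (2 * (`|sigma| + 1)).
have sigma0 : 0 < `|sigma| + 1 by rewrite ltr_pwDr.
have d0 : 0 < d by rewrite divr_gt0 // mulr_gt0.
pose N := [set z | rderivable f z e /\ `|rderive f e z - L| <= toC d].
have N0 : nbhs y0 N.
  apply: filterI => //.
  have /cvgrPdist_le/(_ (toC d)) := fc; rewrite -[0 < _]/(toC 0 < _) ltr_toC => /(_ d0).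
  by apply: filterS => z; rewrite distrC.
have [r r0 rN] := near_segment e N0.
near=> t; rewrite sub0r normrN normrM normr_toC.
have bnd : `|f (y t + toC (s t) *: e) - f (y t) - toC (s t) * L| <=
    toC (2 * d * `|s t|).
  have Nt u : `|u| <= `|s t| -> N (y t + toC u *: e).
    move=> us; have str : `|s t| < r.
      by near: t; have /cvgr0_norm_lt/(_ _ r0) := s0.
    move: (u) (le_lt_trans us str).
    by near: t; exact: yy0 _ rN.
  apply: (@mean_value_bound f (y t) e (fun u => rderive f e (y t + toC u *: e))).
    by move=> u /Nt[].
  by move=> u /Nt[].
apply: (@le_trans _ _ (toC `|t^-1| * toC (2 * d * `|s t|))).
  by apply: ler_wpM2l => //; rewrite -[0 <= _]/(toC 0 <= _) ler_toC.
rewrite -toCM ler_toC mulrCA -normrM.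
apply: (@le_trans _ _ (2 * d * (`|sigma| + 1))).
  apply: ler_wpM2l; first by rewrite mulr_ge0 // ltW.
  near: t.
  have /cvgrPdist_le/(_ _ ltr01) := ss; apply: filterS => t; rewrite distrC.
  move=> h; rewrite -[X in `|X|](subrK sigma) addrC (le_trans (ler_normD _ _)) ?lerD2l //.
rewrite [X in X <= _](_ : _ = eps') // /d; field.
exact: lt0r_neq0.
Unshelve. all: by end_near. Qed.

End MeanValue.

Lemma cvg_mxP (T : Type) (F : set_system T) (FF : Filter F) (K : topologicalType)
    (m n : nat) (f : T -> 'M[K]_(m, n)) (A : 'M[K]_(m, n)) :
  f t @[t --> F] --> A <-> forall i j, f t i j @[t --> F] --> A i j.
Proof.
split=> [fA i j W WA|H W [P PA PW]].
  have := fA [set M : 'M[K]_(m, n) | W (M i j)].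
  apply; exists (fun i' j' => if (i' == i) && (j' == j) then W else setT).
    move=> i' j'; case: ifP => [/andP[/eqP -> /eqP ->]//|_]; exact: filterT.
  by move=> M /(_ i j) /=; rewrite !eqxx.
have : \forall t \near F, forall i j, P i j (f t i j).
  apply: filter_forall => i; apply: filter_forall => j.
  by have := H i j _ (PA i j).
by apply: filterS => t Pt; apply: PW.
Qed.

(** * The chain rule in Wirtinger form *)

Section Calculus.
Variable R : realType.
Local Notation C := (cplx R).

Section Quotients.
Variable n : nat.
Local Notation V := 'rV[C]_n.
Implicit Types (f g : V -> C) (x y v e : V).

(** The directions are those of the underlying real vector space. Real linearity of the derivative
    in [v] is not put into the definition; it is a consequence, [rderive_wirtinger]. *)
Definition C1_at f x : Prop :=
  (\forall y \near x, forall v, rderivable f y v) /\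
  forall v, {for x, continuous (rderive f v)}.

Lemma class_C1_at (U : set V) f x : open U -> class_C 1 U f -> U x -> C1_at f x.
Proof.
move=> oU [_ Cf] Ux; split.
  by apply: filterS (open_nbhs_nbhs (conj oU Ux)) => y Uy v; exact: (Cf v).1 _ Uy.
by move=> v; have [_ [+ _]] := Cf v; apply.
Qed.

(** The increments are made one after the other: the rest of the sum starts from the point reached
    after the first increment. The induction therefore needs a moving base point [y]. *)
Lemma cvg_quotient_sum f y0 (I : Type) (r : seq I) (e : I -> V) (s : I -> R -> R)
    (sigma : I -> R) (y : R -> V) :
  C1_at f y0 ->
  (forall i, t^-1 * s i t @[t --> (0 : R)^'] --> sigma i) ->
  y t @[t --> (0 : R)^'] --> y0 ->
  toC t^-1 * (f (y t + \sum_(i <- r) toC (s i t) *: e i) - f (y t))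
    @[t --> (0 : R)^'] --> \sum_(i <- r) toC (sigma i) * rderive f (e i) y0.
Proof.
move=> [fd fc] ss; elim: r y => [|i r IH] y yy0.
  rewrite big_nil; apply: cvg_near_eq (cvg_cst 0) _.
  by near=> t; rewrite big_nil addr0 subrr mulr0.
have yi : y t + toC (s i t) *: e i @[t --> (0 : R)^'] --> y0.
  have s0 : toC (s i t) *: e i @[t --> (0 : R)^'] --> toC 0 *: e i.
    by apply: cvgZr_tmp; apply: cvg_toC; exact: cvg0_of_quotient (ss i).
  by have := cvgD yy0 s0; rewrite toC0 scale0r addr0; apply.
have di : \forall y \near y0, rderivable f y (e i) by apply: filterS fd => z; apply.
have H1 := cvg_partial_quotient di (fc (e i)) yy0 (ss i).
rewrite big_cons; apply: (cvg_near_eq (cvgD H1 (IH _ yi))).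
near=> t => /=.
by rewrite big_cons addrA; ring.
Unshelve. all: by end_near. Qed.

End Quotients.

Lemma toC_ReIm_wirtinger (z a b : C) :
  toC (complex.Re z) * a + toC (complex.Im z) * b =
  z * (2^-1 * (a - 'i * b)) + z^* * (2^-1 * (a + 'i * b)).
Proof. by rewrite cReE cImE; field. Qed.

Lemma row_ReIm (m : nat) (w : 'rV[C]_m) :
  w = \sum_(p : 'I_m * bool)
    toC (if p.2 then complex.Re (w 0 p.1) else complex.Im (w 0 p.1)) *:
      (if p.2 then delta_mx 0 p.1 else 'i *: delta_mx 0 p.1).
Proof.
rewrite {1}[w]row_sum_delta.
rewrite -(pair_bigA _ (fun j b => toC (if b then complex.Re (w 0 j) else complex.Im (w 0 j)) *:
      (if b then delta_mx 0 j else 'i *: delta_mx 0 j))) /=.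
apply: eq_bigr => j _; rewrite big_bool /= scalerA -scalerDl; congr (_ *: _).
by rewrite {1}[w 0 j]cplxE [_ * 'i]mulrC.
Qed.

(** The increment of [phi] is split along the real basis [delta_mx 0 j], ['i *: delta_mx 0 j], with
    a boolean to choose between real and imaginary part. [cvg_quotient_sum] adds up the partial
    derivatives of [f], and each pair recombines into [del j] and [delbar j]. *)
Lemma is_rder_comp (n m : nat) (phi : 'rV[C]_n -> 'rV[C]_m) (f : 'rV[C]_m -> C)
    (x v : 'rV[C]_n) (l : 'I_m -> C) :
  C1_at f (phi x) -> (forall j, is_rder (fun y => phi y 0 j) x v (l j)) ->
  is_rder (f \o phi) x v
    (\sum_j (l j * del j f (phi x) + (l j)^* * delbar j f (phi x))).
Proof.
move=> fC phil.
pose w t := phi (x + toC t *: v) - phi x.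
pose s (p : 'I_m * bool) t :=
  if p.2 then complex.Re (w t 0 p.1) else complex.Im (w t 0 p.1).
pose sigma (p : 'I_m * bool) := if p.2 then complex.Re (l p.1) else complex.Im (l p.1).
pose e (p : 'I_m * bool) : 'rV[C]_m :=
  if p.2 then delta_mx 0 p.1 else 'i *: delta_mx 0 p.1.
have wE t j : w t 0 j = phi (x + toC t *: v) 0 j - phi x 0 j by rewrite !mxE.
have ss p : t^-1 * s p t @[t --> (0 : R)^'] --> sigma p.
  case: p => j [] /=; rewrite /s /sigma /=.
    apply: (cvg_near_eq (cvg_Re (phil j))); near=> t.
    by rewrite rquotE cReM wE.
  apply: (cvg_near_eq (cvg_Im (phil j))); near=> t.
  by rewrite rquotE cImM wE.
have E : \sum_p toC (sigma p) * rderive f (e p) (phi x) =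
    \sum_j (l j * del j f (phi x) + (l j)^* * delbar j f (phi x)).
  rewrite -(pair_bigA _ (fun j b => toC (sigma (j, b)) * rderive f (e (j, b)) (phi x))) /=.
  by apply: eq_bigr => j _; rewrite big_bool /=; exact: toC_ReIm_wirtinger.
rewrite -E; have H := cvg_quotient_sum (r := index_enum _) (e := e) fC ss (cvg_cst (phi x)).
apply: (cvg_near_eq (H _)); near=> t; rewrite rquotE /=.
congr (_ * (f _ - _)).
have -> : phi (x + toC t *: v) = phi x + w t by rewrite /w addrCA subrr addr0.
by rewrite [w t]row_ReIm.
Unshelve. all: by end_near. Qed.

Lemma is_rder_coord (n : nat) (j : 'I_n) (x v : 'rV[C]_n) :
  is_rder (fun y => y 0 j) x v (v 0 j).
Proof.
apply: (cvg_near_eq (cvg_cst (v 0 j))); near=> t.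
rewrite rquotE !mxE [x 0 j + _]addrC addrK mulrA -toCM mulVf ?mul1r //.
by near: t; exact: nbhs_dnbhs_neq.
Unshelve. all: by end_near. Qed.

(** The chain rule for the identity map; it contains the real linearity of the differential. *)
Lemma rderive_wirtinger (n : nat) (f : 'rV[C]_n -> C) (x v : 'rV[C]_n) :
  C1_at f x ->
  rderive f v x = \sum_j (v 0 j * del j f x + (v 0 j)^* * delbar j f x).
Proof.
move=> fC; apply: is_rder_rderive.
have := @is_rder_comp _ _ id f x v (fun j => v 0 j) fC.
by apply => j; exact: is_rder_coord.
Qed.

(** * Symmetry of second derivatives *)

Section Schwarz.
Variable n : nat.
Local Notation V := 'rV[C]_n.
Implicit Types (f : V -> C) (x v w : V).

Lemma is_rder_translate f a x v l :
  is_rder f (x + a) v l -> is_rder (fun y => f (y + a)) x v l.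
Proof.
move=> H; apply: (cvg_near_eq H); near=> t.
by rewrite !rquotE addrAC.
Unshelve. all: by end_near. Qed.

Lemma is_rderN f x v l : is_rder f x v l -> is_rder (fun y => - f y) x v (- l).
Proof.
have -> : (fun y => - f y) = (fun y => -1 * f y).
  by apply/funext => y; rewrite mulN1r.
move=> fl; have := is_rderM (is_rder_cst (-1) x v) fl.
by rewrite mul0r add0r mulN1r.
Qed.

Definition second_difference f x v w (t : R) : C :=
  f (x + toC t *: w + toC t *: v) - f (x + toC t *: v)
    - (f (x + toC t *: w) - f x).

Lemma second_differenceC f x v w t :
  second_difference f x v w t = second_difference f x w v t.
Proof. by rewrite /second_difference [x + _ + toC t *: v]addrAC; ring. Qed.

(* Apply [mean_value_bound] along [v] to the increment of [f] along [w], whose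
   derivative is in turn estimated by [mean_value_bound] along [w]. *)
Lemma cvg_second_difference f x v w (U : set V) :
  open U -> class_C 2 U f -> U x ->
  toC (t^-1 ^+ 2) * second_difference f x v w t @[t --> (0 : R)^'] -->
    rderive (rderive f v) w x.
Proof.
move=> oU [_ fC] Ux; set L := rderive _ _ _.
have [fv [_ /(_ w)[fvw [fvwc _]]]] := fC v.
apply/cvgrPdist_le => eps /gt0_toC[eps' eps0 ->].
(* Each of the two uses of [mean_value_bound] contributes a factor 2. *)
pose d := eps' / 4; have d0 : 0 < d by rewrite divr_gt0.
pose N := [set z | U z /\ `|rderive (rderive f v) w z - L| <= toC d].
have N0 : nbhs x N.
  apply: filterI; first exact: open_nbhs_nbhs.
  have /cvgrPdist_le/(_ (toC d)) := fvwc _ Ux.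
  rewrite -[0 < _]/(toC 0 < _) ltr_toC => /(_ d0).
  by apply: filterS => z; rewrite distrC.
(* Segments along [w] starting from segments along [v]: all points [x + u v + u' w] with [u] and
   [u'] small lie in [N]. *)
have [r r0 rN] := near_segment w N0.
have [r' r'0 /nbhs_singleton rN'] := near_segment v rN.
near=> t.
have tN u u' : `|u| <= `|t| -> `|u'| <= `|t| -> N (x + toC u *: v + toC u' *: w).
  move=> ut ut'; apply: rN'; last first.
    by apply: le_lt_trans ut' _; near: t; exact: dnbhs0_lt.
  by apply: le_lt_trans ut _; near: t; exact: dnbhs0_lt.
have t0 : t != 0 by near: t; exact: nbhs_dnbhs_neq.
have tN0 u : `|u| <= `|t| -> N (x + toC u *: v).
  by move=> ut; have := tN u 0 ut; rewrite toC0 scale0r addr0 normr0; apply.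
pose F y := f (y + toC t *: w) - f y.
pose D u := rderive f v (x + toC u *: v + toC t *: w) - rderive f v (x + toC u *: v).
have FD u : `|u| <= `|t| -> is_rder F (x + toC u *: v) v (D u).
  move=> ut; apply: is_rderD.
    by apply: is_rder_translate; apply: rderivableP; apply: fv; have [] := tN _ _ ut (lexx _).
  by apply: is_rderN; apply: rderivableP; apply: fv; have [] := tN0 _ ut.
have DL u : `|u| <= `|t| -> `|D u - toC t * L| <= toC (2 * d * `|t|).
  move=> ut; apply: (@mean_value_bound _ _ _ _ w
    (fun u' => rderive (rderive f v) w (x + toC u *: v + toC u' *: w))).
    by move=> u' ut'; apply: rderivableP; apply: fvw; have [] := tN _ _ ut ut'.
  by move=> u' ut'; have [] := tN _ _ ut ut'.
have := mean_value_bound FD DL; rewrite /F.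
set S := (X in `|X| <= _ -> _).
have -> : S = second_difference f x v w t - toC (t ^+ 2) * L.
  by rewrite /S /second_difference [x + _ + toC t *: v]addrAC expr2 toCM; ring.
move=> bnd; rewrite distrC.
have -> : toC (t^-1 ^+ 2) * second_difference f x v w t - L =
   toC (t^-1 ^+ 2) * (second_difference f x v w t - toC (t ^+ 2) * L).
  have h : toC (t^-1 ^+ 2) * toC (t ^+ 2) = 1.
    by rewrite -toCM -exprMn mulVf // expr1n.
  by rewrite -[L in LHS]mul1r -h; ring.
rewrite normrM normr_toC.
apply: (@le_trans _ _ (toC `|t^-1 ^+ 2| * toC (2 * (2 * d * `|t|) * `|t|))).
  by apply: ler_wpM2l => //; rewrite -[0 <= _]/(toC 0 <= _) ler_toC.
rewrite -toCM ler_toC normrX normfV [X in X <= _](_ : _ = eps') // /d.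
by field; rewrite normr_eq0.
Unshelve. all: by end_near. Qed.

(** Both iterated derivatives are limits of the same second difference, which is symmetric in [v]
    and [w]. *)
Lemma rderiveC f x v w (U : set V) : open U -> class_C 2 U f -> U x ->
  rderive (rderive f v) w x = rderive (rderive f w) v x.
Proof.
move=> oU fC Ux.
have H1 := @cvg_second_difference f x v w U oU fC Ux.
have H2 := @cvg_second_difference f x w v U oU fC Ux.
apply: (cvg_unique _ H1); first exact: norm_hausdorff.
by apply: (cvg_near_eq H2); near=> t; rewrite second_differenceC.
Unshelve. all: by end_near. Qed.

End Schwarz.
End Calculus.

(** * Functions of class C^k *)

Section Smooth.
Variable R : realType.
Local Notation C := (cplx R).

Section Closure.
Variable n : nat.
Local Notation V := 'rV[C]_n.
Implicit Types (f g : V -> C) (x y v e : V) (U W : set V).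

Lemma class_C_cont k U f x : class_C k U f -> U x -> f y @[y --> x] --> f x.
Proof. by case: k => [|k] [fc _] Ux; exact: fc. Qed.

Lemma class_C_le k U f : class_C k.+1 U f -> class_C k U f.
Proof.
elim: k f => [|k IH] f [fc fd]; first by split; [exact: fc|].
split; first exact: fc.
by move=> v; have [fv fvC] := fd v; split; [exact: fv|exact: IH fvC].
Qed.

Lemma class_C_leq k k' U f : (k' <= k)%N -> class_C k U f -> class_C k' U f.
Proof.
elim: k => [|k IH]; first by rewrite leqn0 => /eqP ->.
by rewrite leq_eqVlt => /predU1P[-> //|/IH h] /class_C_le.
Qed.

Lemma class_C_rder k U f x v : class_C k.+1 U f -> U x ->
  is_rder f x v (rderive f v x).
Proof. by move=> [_ /(_ v)[fv _]] Ux; apply: rderivableP; exact: fv. Qed.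

Arguments class_C_rder [k U f x] v.

Lemma class_C_sub k U W f : U `<=` W -> class_C k W f -> class_C k U f.
Proof.
move=> UW; elim: k f => [|k IH] f [fc fd].
  by split; [move=> x /UW; exact: fc|].
split; first by move=> x /UW; exact: fc.
by move=> v; have [fv fvC] := fd v; split; [move=> x /UW; exact: fv|exact: IH fvC].
Qed.

Lemma open_near U x : open U -> U x -> \forall y \near x, U y.
Proof. by move=> oU Ux; exact: open_nbhs_nbhs. Qed.

Lemma class_C_ext k U f g : open U -> (forall x, U x -> f x = g x) ->
  class_C k U f -> class_C k U g.
Proof.
move=> oU; elim: k f g => [|k IH] f g fg [fc fd].
  split; last by [].
  move=> x Ux; rewrite /prop_for /continuous_at -fg //.
  by apply: cvg_near_eq (fc x Ux) _; apply: filterS fg (open_near oU Ux).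
have fgx x : U x -> \forall y \near x, f y = g y.
  by move=> Ux; apply: filterS fg (open_near oU Ux).
split.
  move=> x Ux; rewrite /prop_for /continuous_at -fg //.
  by apply: cvg_near_eq (fc x Ux) _; exact: fgx.
move=> v; have [fv fvC] := fd v; split.
  move=> x Ux; apply: is_rder_rderivable.
  by apply: near_is_rder (fgx x Ux) _; apply: rderivableP; exact: fv.
by apply: IH fvC => x Ux; apply: near_rderive; exact: fgx.
Qed.

(** Smoothness may be checked with different local expressions near different points. The metric on
    the total space needs this, as its expression depends on a chart of the base. *)
Lemma class_C_local k U f :
  (forall x, U x -> exists W, [/\ open W, W x & class_C k W f]) -> class_C k U f.
Proof.
elim: k f => [|k IH] f H.
  split; last by [].
  by move=> x /H[W [_ Wx /class_C_cont]]; apply.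
split; first by move=> x /H[W [_ Wx /class_C_cont]]; apply.
move=> v; split; first by move=> x /H[W [_ Wx [_ /(_ v)[+ _]]]]; apply.
by apply: IH => x /H[W [oW Wx [_ /(_ v)[_ fW]]]]; exists W.
Qed.

Lemma class_C_cst k U (c : C) : open U -> class_C k U (fun=> c).
Proof.
move=> oU; elim: k c => [|k IH] c.
  by split; [move=> x _; exact: cst_continuous|].
split; first by move=> x _; exact: cst_continuous.
move=> v; split; first by move=> x _; apply: is_rder_rderivable; exact: is_rder_cst.
apply: (class_C_ext oU _ (IH 0)) => x _.
by apply/esym/is_rder_rderive; exact: is_rder_cst.
Qed.

Lemma class_CD k U f g : open U -> class_C k U f -> class_C k U g ->
  class_C k U (fun y => f y + g y).
Proof.
move=> oU; elim: k f g => [|k IH] f g Cf Cg.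
  split; last by [].
  move=> x Ux; exact: cvgD (class_C_cont Cf Ux) (class_C_cont Cg Ux).
have D v x Ux := is_rderD (class_C_rder v Cf Ux) (class_C_rder v Cg Ux).
split; first by move=> x Ux; exact: cvgD (class_C_cont Cf Ux) (class_C_cont Cg Ux).
move=> v; split; first by move=> x Ux; apply: is_rder_rderivable; exact: D.
apply: (class_C_ext oU _ (IH _ _ (Cf.2 v).2 (Cg.2 v).2)) => x Ux.
by apply/esym/is_rder_rderive; exact: D.
Qed.

Lemma class_CM k U f g : open U -> class_C k U f -> class_C k U g ->
  class_C k U (fun y => f y * g y).
Proof.
move=> oU; elim: k f g => [|k IH] f g Cf Cg.
  split; last by [].
  move=> x Ux; exact: cvgM (class_C_cont Cf Ux) (class_C_cont Cg Ux).
have D v x Ux := is_rderM (class_C_rder v Cf Ux) (class_C_rder v Cg Ux).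
split; first by move=> x Ux; exact: cvgM (class_C_cont Cf Ux) (class_C_cont Cg Ux).
move=> v; split; first by move=> x Ux; apply: is_rder_rderivable; exact: D.
apply: (class_C_ext oU _ (class_CD oU (IH _ _ (Cf.2 v).2 (class_C_le Cg))
  (IH _ _ (class_C_le Cf) (Cg.2 v).2))) => x Ux.
by apply/esym/is_rder_rderive; exact: D.
Qed.

Lemma class_C_conj k U f : open U -> class_C k U f -> class_C k U (fun y => (f y)^*).
Proof.
move=> oU; elim: k f => [|k IH] f Cf.
  split; last by [].
  move=> x Ux; exact: cvg_conj (class_C_cont Cf Ux).
have D v x Ux := is_rder_conj (class_C_rder v Cf Ux).
split; first by move=> x Ux; exact: cvg_conj (class_C_cont Cf Ux).
move=> v; split; first by move=> x Ux; apply: is_rder_rderivable; exact: D.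
apply: (class_C_ext oU _ (IH _ (Cf.2 v).2)) => x Ux.
by apply/esym/is_rder_rderive; exact: D.
Qed.

Lemma class_CN k U f : open U -> class_C k U f -> class_C k U (fun y => - f y).
Proof.
move=> oU Cf; apply: (class_C_ext oU _ (class_CM oU (class_C_cst k (-1) oU) Cf)) => x _.
by rewrite mulN1r.
Qed.

(** The derivative of [1 / f] is [- f'] times the inverse of [f * f], so the induction hypothesis is
    applied to [f * f] and not to [f]. *)
Lemma class_CV k U f : open U -> (forall x, U x -> f x != 0) ->
  class_C k U f -> class_C k U (fun y => (f y)^-1).
Proof.
move=> oU f0; elim: k f f0 => [|k IH] f f0 Cf.
  split; last by [].
  by move=> x Ux; apply: cvgV (class_C_cont Cf Ux); exact: f0.
have D v x Ux := is_rderV (class_C_rder v Cf Ux) (f0 x Ux).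
split; first by move=> x Ux; apply: cvgV (class_C_cont Cf Ux); exact: f0.
move=> v; split; first by move=> x Ux; apply: is_rder_rderivable; exact: D.
have Cff : class_C k U (fun y => f y * f y) by exact: class_CM oU (class_C_le Cf) (class_C_le Cf).
have ff0 x : U x -> f x * f x != 0 by move=> Ux; rewrite mulf_neq0 ?f0.
apply: (class_C_ext oU _ (class_CM oU (class_CN oU (Cf.2 v).2) (IH _ ff0 Cff))) => x Ux.
by apply/esym/is_rder_rderive; rewrite -expr2; exact: D.
Qed.

Lemma class_C_sum k U (I : Type) (r : seq I) (P : pred I) (f : I -> V -> C) :
  open U -> (forall i, P i -> class_C k U (f i)) ->
  class_C k U (fun y => \sum_(i <- r | P i) f i y).
Proof.
move=> oU H; elim: r => [|i r IH].
  by under eq_fun do rewrite big_nil; exact: class_C_cst.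
under eq_fun do rewrite big_cons.
case: (P i) (@H i) => Hi; last exact: IH.
exact: class_CD oU (Hi isT) IH.
Qed.

Lemma class_C_prod k U (I : Type) (r : seq I) (P : pred I) (f : I -> V -> C) :
  open U -> (forall i, P i -> class_C k U (f i)) ->
  class_C k U (fun y => \prod_(i <- r | P i) f i y).
Proof.
move=> oU H; elim: r => [|i r IH].
  by under eq_fun do rewrite big_nil; exact: class_C_cst.
under eq_fun do rewrite big_cons.
case: (P i) (@H i) => Hi; last exact: IH.
exact: class_CM oU (Hi isT) IH.
Qed.

Lemma class_C_coord k U (j : 'I_n) : open U -> class_C k U (fun y => y 0 j).
Proof.
move=> oU; case: k => [|k].
  by split; [move=> x _; exact: coord_continuous|].
split; first by move=> x _; exact: coord_continuous.
move=> v; split; first by move=> x _; apply: is_rder_rderivable; exact: is_rder_coord.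
apply: (class_C_ext oU _ (class_C_cst k (v 0 j) oU)) => x _.
by apply/esym/is_rder_rderive; exact: is_rder_coord.
Qed.

Lemma class_C_del k U f a : open U -> class_C k.+1 U f -> class_C k U (del a f).
Proof.
move=> oU [_ Cf]; apply: (class_CM oU (class_C_cst _ _ oU)).
apply: (class_CD oU (Cf _).2).
exact: (class_CN oU (class_CM oU (class_C_cst _ _ oU) (Cf _).2)).
Qed.

Lemma class_C_delbar k U f a : open U -> class_C k.+1 U f -> class_C k U (delbar a f).
Proof.
move=> oU [_ Cf]; apply: (class_CM oU (class_C_cst _ _ oU)).
apply: (class_CD oU (Cf _).2).
exact: (class_CM oU (class_C_cst _ _ oU) (Cf _).2).
Qed.

End Closure.

Arguments class_C_rder [n k U f x] v.

(** The derivative of the composite is a sum of products of derivatives of [phi] with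
    [del j f \o phi] and [delbar j f \o phi]. The induction on [k] keeps [f] general so that it
    applies to these. *)
Lemma class_C_comp (n m k : nat) (U : set 'rV[C]_n) (W : set 'rV[C]_m)
    (phi : 'rV[C]_n -> 'rV[C]_m) (f : 'rV[C]_m -> C) :
  open U -> open W -> (forall j, class_C k U (fun y => phi y 0 j)) ->
  (forall x, U x -> W (phi x)) -> class_C k W f -> class_C k U (f \o phi).
Proof.
move=> oU oW; elim: k f => [|k IH] f Cphi UW Cf.
  split; last by [].
  move=> x Ux; apply: cvg_comp (class_C_cont Cf (UW _ Ux)).
  by apply/(cvg_mxP (nbhs_filter x)) => i j; rewrite ord1; exact: (class_C_cont (Cphi j) Ux).
have D v x (Ux : U x) := is_rder_comp
  (class_C1_at oW (class_C_leq (ltn0Sn k) Cf) (UW _ Ux))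
  (fun j => class_C_rder v (Cphi j) Ux).
split.
  move=> x Ux; apply: cvg_comp (class_C_cont Cf (UW _ Ux)).
  by apply/(cvg_mxP (nbhs_filter x)) => i j; rewrite ord1; exact: (class_C_cont (Cphi j) Ux).
move=> v; split; first by move=> x Ux; apply: is_rder_rderivable; exact: D.
have Cphi' j : class_C k U (fun y => phi y 0 j) by exact: class_C_le.
have Cphiv j : class_C k U (rderive (fun y => phi y 0 j) v) by exact: ((Cphi j).2 v).2.
pose G j y := rderive (fun y => phi y 0 j) v y * (del j f \o phi) y
    + (rderive (fun y => phi y 0 j) v y)^* * (delbar j f \o phi) y.
have CG j : true -> class_C k U (G j).
  move=> _; apply: (class_CD oU).
    exact: (class_CM oU (Cphiv j) (IH _ Cphi' UW (class_C_del _ oW Cf))).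
  exact: (class_CM oU (class_C_conj oU (Cphiv j)) (IH _ Cphi' UW (class_C_delbar _ oW Cf))).
have H := class_C_sum (index_enum _) oU CG.
by apply: (class_C_ext oU _ H) => x Ux; apply/esym/is_rder_rderive; exact: D.
Qed.
End Smooth.

(** * Wirtinger derivatives *)

Section Wirtinger.
Variable R : realType.
Local Notation C := (cplx R).

(* [s = -'i] gives the derivative along the (1,0)-vector [xi], [s = 'i] the
   derivative along its conjugate. *)
Definition wirt (n : nat) (s : C) (xi : 'rV[C]_n) (f : 'rV[C]_n -> C) (x : 'rV[C]_n) : C :=
  2^-1 * (rderive f xi x + s * rderive f ('i *: xi) x).

Definition mwirt (n p q : nat) (s : C) (xi : 'rV[C]_n) (H : 'rV[C]_n -> 'M[C]_(p, q))
    (x : 'rV[C]_n) : 'M[C]_(p, q) :=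
  \matrix_(i, j) wirt s xi (fun y => H y i j) x.

Lemma mwirtE (n p q : nat) (s : C) (xi : 'rV[C]_n) (H : 'rV[C]_n -> 'M[C]_(p, q)) x i j :
  mwirt s xi H x i j = wirt s xi (fun y => H y i j) x.
Proof. by rewrite mxE. Qed.

Definition msmooth (n p q : nat) (U : set 'rV[C]_n) (H : 'rV[C]_n -> 'M[C]_(p, q)) : Prop :=
  forall i j, smooth_on U (fun y => H y i j).

Section Scalar.
Variable n : nat.
Local Notation V := 'rV[C]_n.
Implicit Types (f g : V -> C) (x y v xi : V) (U : set V) (s : C).

Lemma smooth_C1 U f x : open U -> smooth_on U f -> U x -> C1_at f x.
Proof. by move=> oU fs; exact: class_C1_at oU (fs 1%N). Qed.

Lemma smooth_rder U f x v : smooth_on U f -> U x -> is_rder f x v (rderive f v x).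
Proof. by move=> fs; exact: class_C_rder (fs 1%N). Qed.

Lemma smooth_rderive U f v : smooth_on U f -> smooth_on U (rderive f v).
Proof. by move=> fs k; have [_ /(_ v)[_]] := fs k.+1. Qed.

Lemma smooth_wirt U f s xi : open U -> smooth_on U f -> smooth_on U (wirt s xi f).
Proof.
move=> oU fs k; apply: (class_CM oU (class_C_cst _ _ oU)).
apply: (class_CD oU (smooth_rderive _ fs k)).
exact: (class_CM oU (class_C_cst _ _ oU) (smooth_rderive _ fs k)).
Qed.

Lemma delE f a : del a f = wirt (-'i) (delta_mx 0 a) f.
Proof. by apply/funext => x; rewrite /wirt mulNr. Qed.

Lemma delbarE f a : delbar a f = wirt 'i (delta_mx 0 a) f.
Proof. by []. Qed.

Lemma near_wirt f g s xi x : (\forall y \near x, f y = g y) ->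
  wirt s xi f x = wirt s xi g x.
Proof. by move=> fg; rewrite /wirt !(near_rderive _ fg). Qed.

Lemma wirt_cst (c : C) s xi x : wirt s xi (fun=> c) x = 0.
Proof. by rewrite /wirt !(is_rder_rderive (is_rder_cst c x _)); ring. Qed.

Lemma wirtD f g s xi x : (forall v, rderivable f x v) -> (forall v, rderivable g x v) ->
  wirt s xi (fun y => f y + g y) x = wirt s xi f x + wirt s xi g x.
Proof.
move=> df dg; rewrite /wirt.
rewrite !(is_rder_rderive (is_rderD (rderivableP (df _)) (rderivableP (dg _)))); ring.
Qed.

Lemma wirtM f g s xi x : (forall v, rderivable f x v) -> (forall v, rderivable g x v) ->
  wirt s xi (fun y => f y * g y) x = wirt s xi f x * g x + f x * wirt s xi g x.
Proof.
move=> df dg; rewrite /wirt.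
rewrite !(is_rder_rderive (is_rderM (rderivableP (df _)) (rderivableP (dg _)))); ring.
Qed.

Lemma wirt_sum (I : Type) (r : seq I) (P : pred I) (f : I -> V -> C) s xi x :
  (forall i v, P i -> rderivable (f i) x v) ->
  wirt s xi (fun y => \sum_(i <- r | P i) f i y) x = \sum_(i <- r | P i) wirt s xi (f i) x.
Proof.
move=> df; rewrite /wirt.
have E v : rderive (fun y => \sum_(i <- r | P i) f i y) v x =
    \sum_(i <- r | P i) rderive (f i) v x.
  by apply: is_rder_rderive; apply: is_rder_sum => i Pi; exact: rderivableP (df i v Pi).
by rewrite !E mulr_sumr -big_split mulr_sumr.
Qed.

Lemma wirt_conj f s xi x : (forall v, rderivable f x v) ->
  wirt s xi (fun y => (f y)^*) x = (wirt s^* xi f x)^*.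
Proof.
move=> df; rewrite /wirt !(is_rder_rderive (is_rder_conj (rderivableP (df _)))).
by rewrite rmorphM rmorphD rmorphM fmorphV /= conjCK conjC_nat.
Qed.

(** With [s] and [s'] free, all pairs of (1,0)- and (0,1)-derivatives are covered at once; the
    bilinear expansion leaves four instances of [rderiveC]. *)
Lemma wirtC f s s' xi xi' x U : open U -> smooth_on U f -> U x ->
  wirt s xi (wirt s' xi' f) x = wirt s' xi' (wirt s xi f) x.
Proof.
move=> oU fs Ux.
have E t t' z z' : wirt t z (wirt t' z' f) x = 2^-1 * 2^-1 *
    (rderive (rderive f z') z x + t' * rderive (rderive f ('i *: z')) z x
     + t * (rderive (rderive f z') ('i *: z) x
             + t' * rderive (rderive f ('i *: z')) ('i *: z) x)).
  have d v v' : is_rder (rderive f v) x v' (rderive (rderive f v) v' x).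
    exact: smooth_rder (smooth_rderive v fs) Ux.
  have e w : rderive (wirt t' z' f) w x =
      2^-1 * (rderive (rderive f z') w x + t' * rderive (rderive f ('i *: z')) w x).
    have H := is_rderM (is_rder_cst 2^-1 x w)
      (is_rderD (d z' w) (is_rderM (is_rder_cst t' x w) (d ('i *: z') w))).
    have -> : rderive (wirt t' z' f) w x = _ := is_rder_rderive H.
    by rewrite !mul0r !add0r.
  rewrite {1}/wirt !e.
  move: (rderive (rderive f z') z x) (rderive (rderive f ('i *: z')) z x)
    (rderive (rderive f z') ('i *: z) x) (rderive (rderive f ('i *: z')) ('i *: z) x).
  by move=> a1 a2 a3 a4; ring.
apply: (etrans (E _ _ _ _)); apply: (etrans _ (esym (E _ _ _ _))).
have alg (a1 a2 a3 a4 b1 b2 b3 b4 : C) : a1 = b1 -> a2 = b3 -> a3 = b2 -> a4 = b4 ->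
  2^-1 * 2^-1 * (a1 + s' * a2 + s * (a3 + s' * a4)) =
  2^-1 * 2^-1 * (b1 + s * b2 + s' * (b3 + s * b4)) by move=> -> -> -> ->; ring.
by apply: alg; exact: rderiveC oU (fs 2%N) Ux.
Qed.

(** The terms in [delbar a f] come with the factor [1 + 'i ^+ 2] and drop out, which leaves an
    expression complex linear in [xi]. For [wirt 'i] the terms in [del a f] drop out in the same
    way. *)
Lemma wirt_delE f xi x : C1_at f x ->
  wirt (-'i) xi f x = \sum_a xi 0 a * del a f x.
Proof.
move=> fC; rewrite /wirt !rderive_wirtinger // mulr_sumr -big_split mulr_sumr /=.
apply: eq_bigr => a _; rewrite !mxE rmorphM /= conjCi.
move: (xi 0 a) (xi 0 a)^* (del _ _ _) (delbar _ _ _) => z z' u w.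
have -> : 2^-1 * (z * u + z' * w + - 'i * ('i * z * u + - 'i * z' * w)) =
  2^-1 * (z * u * (1 - 'i ^+ 2) + z' * w * (1 + 'i ^+ 2)) by ring.
by rewrite sqrCi; field.
Qed.

Lemma wirt_delbarE f xi x : C1_at f x ->
  wirt 'i xi f x = \sum_a (xi 0 a)^* * delbar a f x.
Proof.
move=> fC; rewrite /wirt !rderive_wirtinger // mulr_sumr -big_split mulr_sumr /=.
apply: eq_bigr => a _; rewrite !mxE rmorphM /= conjCi.
move: (xi 0 a) (xi 0 a)^* (del _ _ _) (delbar _ _ _) => z z' u w.
have -> : 2^-1 * (z * u + z' * w + 'i * ('i * z * u + - 'i * z' * w)) =
  2^-1 * (z * u * (1 + 'i ^+ 2) + z' * w * (1 - 'i ^+ 2)) by ring.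
by rewrite sqrCi; field.
Qed.

End Scalar.

(** * Composition with holomorphic maps *)

Section Composition.
Variables n m : nat.
Implicit Types (phi : 'rV[C]_n -> 'rV[C]_m) (f : 'rV[C]_m -> C).

Lemma rderive_holomorphic U phi x v j : open U -> holomorphic_on U phi -> U x ->
  rderive (fun y => phi y 0 j) v x = (v *m jacobian phi x) 0 j.
Proof.
move=> oU hol Ux; have [sm cr] := hol 0 j.
rewrite rderive_wirtinger; last exact: smooth_C1 oU sm Ux.
rewrite mxE; apply: eq_bigr => a _.
by rewrite cr // mulr0 addr0 [jacobian _ _ _ _]mxE.
Qed.

Lemma rderive_comp U phi f x v : open U -> holomorphic_on U phi -> U x ->
  C1_at f (phi x) -> rderive (f \o phi) v x = rderive f (v *m jacobian phi x) (phi x).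
Proof.
move=> oU hol Ux fC; rewrite [RHS]rderive_wirtinger //.
apply: is_rder_rderive; apply: is_rder_comp => // j.
rewrite -(rderive_holomorphic _ _ oU hol Ux).
by apply: smooth_rder Ux; exact: (hol 0 j).1.
Qed.

(** The differential of a holomorphic map is complex linear and sends ['i *: xi] to ['i] times the
    image of [xi]. Types are preserved, so [s] is the same on both sides. *)
Lemma wirt_comp U phi f s x xi : open U -> holomorphic_on U phi -> U x ->
  C1_at f (phi x) -> wirt s xi (f \o phi) x = wirt s (xi *m jacobian phi x) f (phi x).
Proof.
move=> oU hol Ux fC.
by rewrite /wirt !(rderive_comp _ oU hol Ux fC) scalemxAl.
Qed.

Lemma smooth_comp U W phi f : open U -> open W ->
  (forall j, smooth_on U (fun y => phi y 0 j)) ->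
  (forall x, U x -> W (phi x)) -> smooth_on W f -> smooth_on U (f \o phi).
Proof.
move=> oU oW phis UW fs k; apply: (class_C_comp oU oW _ UW (fs k)) => j.
exact: phis.
Qed.

End Composition.
End Wirtinger.

(** * Wirtinger derivatives of matrix-valued maps *)

Section MatrixWirtinger.
Variable R : realType.
Local Notation C := (cplx R).

Section Basic.
Variable n : nat.
Local Notation V := 'rV[C]_n.
Implicit Types (x y xi : V) (U : set V) (s : C).

Lemma smooth_rderivable U (f : V -> C) x : smooth_on U f -> U x ->
  forall v, rderivable f x v.
Proof. by move=> fs Ux v; exact: (is_rder_rderivable (smooth_rder (v := v) fs Ux)). Qed.

Lemma wirtZ (c : C) (f : V -> C) s xi x : (forall v, rderivable f x v) ->
  wirt s xi (fun y => c * f y) x = c * wirt s xi f x.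
Proof.
move=> df; have dc v : rderivable (fun=> c) x v.
  exact: is_rder_rderivable (is_rder_cst c x v).
by apply: (etrans (wirtM _ _ dc df)); rewrite wirt_cst mul0r add0r.
Qed.

Lemma smooth_ext U (f g : V -> C) : open U -> (forall x, U x -> f x = g x) ->
  smooth_on U f -> smooth_on U g.
Proof. by move=> oU fg fs k; exact: class_C_ext oU fg (fs k). Qed.

Lemma smooth_sum U (I : Type) (r : seq I) (P : pred I) (f : I -> V -> C) :
  open U -> (forall i, P i -> smooth_on U (f i)) ->
  smooth_on U (fun y => \sum_(i <- r | P i) f i y).
Proof. by move=> oU fs k; apply: (class_C_sum r oU) => i Pi; exact: fs. Qed.

Lemma smoothM U (f g : V -> C) : open U -> smooth_on U f -> smooth_on U g ->
  smooth_on U (fun y => f y * g y).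
Proof. by move=> oU fs gs k; exact: class_CM oU (fs k) (gs k). Qed.

Lemma smoothD U (f g : V -> C) : open U -> smooth_on U f -> smooth_on U g ->
  smooth_on U (fun y => f y + g y).
Proof. by move=> oU fs gs k; exact: class_CD oU (fs k) (gs k). Qed.

Lemma smooth_cst U (c : C) : open U -> smooth_on U (fun=> c).
Proof. by move=> oU k; exact: class_C_cst. Qed.

Lemma smooth_conj U (f : V -> C) : open U -> smooth_on U f -> smooth_on U (fun y => (f y)^*).
Proof. by move=> oU fs k; exact: class_C_conj oU (fs k). Qed.

Lemma open_wirt_ext U (f g : V -> C) s xi x : open U -> (forall y, U y -> f y = g y) ->
  U x -> wirt s xi f x = wirt s xi g x.
Proof. by move=> oU fg Ux; apply: near_wirt; apply: filterS fg (open_near oU Ux). Qed.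

Section Rectangular.
Variables p q : nat.
Implicit Types (A B H : V -> 'M[C]_(p, q)).

Lemma msmooth_ext U A B : open U -> (forall x, U x -> A x = B x) ->
  msmooth U A -> msmooth U B.
Proof. by move=> oU AB As i j; apply: (smooth_ext oU _ (As i j)) => x Ux; rewrite AB. Qed.

Lemma msmoothD U A B : open U -> msmooth U A -> msmooth U B ->
  msmooth U (fun y => A y + B y).
Proof.
move=> oU As Bs i j; apply: (smooth_ext oU _ (smoothD oU (As i j) (Bs i j))) => x Ux.
by rewrite mxE.
Qed.

Lemma msmooth_cst U (A : 'M[C]_(p, q)) : open U -> msmooth U (fun=> A).
Proof. by move=> oU i j; exact: smooth_cst. Qed.

Lemma msmooth_mwirt U s xi H : open U -> msmooth U H -> msmooth U (mwirt s xi H).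
Proof.
move=> oU Hs i j; apply: (smooth_ext oU _ (smooth_wirt s xi oU (Hs i j))) => x Ux.
by rewrite mxE.
Qed.

Lemma mwirt_ext U s xi A B x : open U -> (forall y, U y -> A y = B y) -> U x ->
  mwirt s xi A x = mwirt s xi B x.
Proof.
move=> oU AB Ux; apply/matrixP => i j; rewrite !mxE.
by apply: (open_wirt_ext _ _ oU _ Ux) => y Uy; rewrite AB.
Qed.

Lemma mwirt_cst (A : 'M[C]_(p, q)) s xi x : mwirt s xi (fun=> A) x = 0.
Proof. by apply/matrixP => i j; rewrite !mxE wirt_cst. Qed.

Lemma mwirtD U s xi A B x : msmooth U A -> msmooth U B -> U x ->
  mwirt s xi (fun y => A y + B y) x = mwirt s xi A x + mwirt s xi B x.
Proof.
move=> As Bs Ux; apply/matrixP => i j; rewrite !mxE.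
have -> : (fun y => (A y + B y) i j) = (fun y => A y i j + B y i j).
  by apply/funext => y; rewrite mxE.
exact: wirtD (smooth_rderivable (As i j) Ux) (smooth_rderivable (Bs i j) Ux).
Qed.

Lemma mwirtC U s s' xi xi' H x : open U -> msmooth U H -> U x ->
  mwirt s xi (mwirt s' xi' H) x = mwirt s' xi' (mwirt s xi H) x.
Proof.
move=> oU Hs Ux; apply/matrixP => i j; rewrite [LHS]mxE [RHS]mxE.
have E t z : (fun y => mwirt t z H y i j) = wirt t z (fun y => H y i j).
  by apply/funext => y; rewrite mxE.
apply: (etrans (congr1 (fun g => wirt s xi g x) (E s' xi'))).
apply: (etrans _ (esym (congr1 (fun g => wirt s' xi' g x) (E s xi)))).
exact: wirtC oU (Hs i j) Ux.
Qed.

Lemma msmooth_conjT U H : open U -> msmooth U H -> msmooth U (fun y => (H y)^t*).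
Proof.
move=> oU Hs i j; apply: (smooth_ext oU _ (smooth_conj oU (Hs j i))) => x Ux.
by rewrite !mxE.
Qed.

Lemma mwirt_conjT U s xi H x : msmooth U H -> U x ->
  mwirt s xi (fun y => (H y)^t*) x = (mwirt s^* xi H x)^t*.
Proof.
move=> Hs Ux; apply/matrixP => i j; rewrite !mxE.
have -> : (fun y => (H y)^t* i j) = (fun y => (H y j i)^*).
  by apply/funext => y; rewrite !mxE.
exact: wirt_conj (smooth_rderivable (Hs j i) Ux).
Qed.

Lemma holomorphic_msmooth U H : holomorphic_on U H -> msmooth U H.
Proof. by move=> Hh i j; exact: (Hh i j).1. Qed.

Lemma mwirt_holomorphic U xi H x : open U -> holomorphic_on U H -> U x ->
  mwirt 'i xi H x = 0.
Proof.
move=> oU Hh Ux; apply/matrixP => i j; rewrite !mxE.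
rewrite wirt_delbarE; last exact: smooth_C1 oU (Hh i j).1 Ux.
by rewrite big1 // => a _; rewrite (Hh i j).2 // mulr0.
Qed.

Lemma mwirt_mwirt_holomorphic U s xi xi' H x : open U -> holomorphic_on U H -> U x ->
  mwirt 'i xi (mwirt s xi' H) x = 0.
Proof.
move=> oU Hh Ux; rewrite (mwirtC _ _ _ _ oU (holomorphic_msmooth Hh) Ux).
rewrite -(mwirt_cst 0 s xi' x); apply: (mwirt_ext _ _ oU _ Ux) => y Uy.
exact: mwirt_holomorphic oU Hh Uy.
Qed.

End Rectangular.

Lemma msmoothM (p q r : nat) U (A : V -> 'M[C]_(p, q)) (B : V -> 'M[C]_(q, r)) :
  open U -> msmooth U A -> msmooth U B -> msmooth U (fun y => A y *m B y).
Proof.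
move=> oU As Bs i j.
have S k : true -> smooth_on U (fun y => A y i k * B y k j).
  by move=> _; exact: smoothM oU (As i k) (Bs k j).
apply: (smooth_ext oU _ (smooth_sum (index_enum _) oU S)) => x Ux.
by rewrite mxE.
Qed.

Lemma mwirtM (p q r : nat) U s xi (A : V -> 'M[C]_(p, q)) (B : V -> 'M[C]_(q, r)) x :
  msmooth U A -> msmooth U B -> U x ->
  mwirt s xi (fun y => A y *m B y) x = mwirt s xi A x *m B x + A x *m mwirt s xi B x.
Proof.
move=> As Bs Ux; apply/matrixP => i j; rewrite !mxE -big_split /=.
have -> : (fun y => (A y *m B y) i j) = (fun y => \sum_k A y i k * B y k j).
  by apply/funext => y; rewrite mxE.
have dA k := smooth_rderivable (As i k) Ux; have dB k := smooth_rderivable (Bs k j) Ux.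
rewrite wirt_sum; last first.
  move=> k v _; apply: is_rder_rderivable.
  exact: is_rderM (rderivableP (dA k v)) (rderivableP (dB k v)).
by apply: eq_bigr => k _; rewrite (wirtM _ _ (dA k) (dB k)) !mxE.
Qed.

End Basic.

Section Composition.
Variables n m : nat.
Implicit Types (phi : 'rV[C]_n -> 'rV[C]_m) (f : 'rV[C]_m -> C).

(** The entry is a derivative of a holomorphic function along the constant direction [xi], hence
    holomorphic, and (1,0)-derivatives kill its conjugate. *)
Lemma wirt_delbar_comp U phi f x xi b : open U -> holomorphic_on U phi -> U x ->
  wirt (-'i) xi (fun y => ((xi *m jacobian phi y) 0 b)^*) x = 0.
Proof.
move=> oU hol Ux; have [sm cr] := hol 0 b.
have E y : U y -> (xi *m jacobian phi y) 0 b = wirt (-'i) xi (fun y => phi y 0 b) y.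
  move=> Uy; rewrite wirt_delE; last exact: smooth_C1 oU sm Uy.
  by rewrite mxE; apply: eq_bigr => a _; rewrite mxE.
rewrite (open_wirt_ext (g := fun y => (wirt (-'i) xi (fun y => phi y 0 b) y)^*)
  _ _ oU _ Ux); last first.
  by move=> y Uy; rewrite E.
rewrite wirt_conj; last exact: smooth_rderivable (smooth_wirt _ _ oU sm) Ux.
rewrite rmorphN /= conjCi opprK (wirtC _ _ _ _ oU sm Ux).
rewrite (open_wirt_ext (g := fun=> 0) _ _ oU _ Ux) ?wirt_cst ?conjC0 // => y Uy.
rewrite wirt_delbarE; last exact: smooth_C1 oU sm Uy.
by rewrite big1 // => a _; rewrite cr // mulr0.
Qed.

(** On the left the image direction [xi *m jacobian phi y] moves with [y]; on the right it is frozen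
    at [x]. The difference is a (1,0)-derivative of the conjugate of that direction, which vanishes
    by [wirt_delbar_comp]. *)
Lemma wirt_wirt_comp U W phi f x xi : open U -> open W -> holomorphic_on U phi ->
  (forall y, U y -> W (phi y)) -> smooth_on W f -> U x ->
  wirt (-'i) xi (wirt 'i xi (f \o phi)) x =
  wirt (-'i) (xi *m jacobian phi x) (wirt 'i (xi *m jacobian phi x) f) (phi x).
Proof.
move=> oU oW hol UW fs Ux; set c := xi *m jacobian phi x.
have phis j : smooth_on U (fun y => phi y 0 j) by exact: (hol 0 j).1.
have delbars b : smooth_on W (delbar b f) by rewrite delbarE; exact: smooth_wirt.
have delbarphi b : smooth_on U (delbar b f \o phi).
  exact: smooth_comp oU oW phis UW (delbars b).
have cs b : smooth_on U (fun y => ((xi *m jacobian phi y) 0 b)^*).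
  apply: smooth_conj => //; apply: (smooth_ext oU _ (smooth_rderive xi (phis b))) => y Uy.
  exact: rderive_holomorphic oU hol Uy.
rewrite (open_wirt_ext (g := fun y => \sum_b
  ((xi *m jacobian phi y) 0 b)^* * (delbar b f \o phi) y) _ _ oU _ Ux); last first.
  move=> y Uy; rewrite (wirt_comp _ _ oU hol Uy); last exact: smooth_C1 oW fs (UW _ Uy).
  by rewrite wirt_delbarE; last exact: smooth_C1 oW fs (UW _ Uy).
rewrite [RHS](open_wirt_ext (g := fun z => \sum_b (c 0 b)^* * delbar b f z)
  _ _ oW _ (UW _ Ux)); last first.
  by move=> z Wz; rewrite wirt_delbarE; last exact: smooth_C1 oW fs Wz.
rewrite wirt_sum; last first.
  by move=> b v _; exact: smooth_rderivable (smoothM oU (cs b) (delbarphi b)) Ux v.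
rewrite wirt_sum; last first.
  move=> b v _; apply: smooth_rderivable (smoothM oW _ (delbars b)) (UW _ Ux) v.
  exact: smooth_cst.
apply: eq_bigr => b _.
rewrite (wirtM _ _ (smooth_rderivable (cs b) Ux) (smooth_rderivable (delbarphi b) Ux)).
rewrite (wirt_delbar_comp f _ _ oU hol Ux) mul0r add0r.
apply: (etrans _ (esym (wirtZ _ _ _ (smooth_rderivable (delbars b) (UW _ Ux))))).
apply: (congr1 (fun z => (c 0 b)^* * z)).
by apply: (wirt_comp _ _ oU hol Ux); exact: smooth_C1 oW (delbars b) (UW _ Ux).
Qed.

Variables p q : nat.
Variable h : 'rV[C]_m -> 'M[C]_(p, q).

Lemma msmooth_comp U W phi : open U -> open W ->
  (forall j, smooth_on U (fun y => phi y 0 j)) ->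
  (forall x, U x -> W (phi x)) -> msmooth W h -> msmooth U (h \o phi).
Proof. by move=> oU oW phis UW hs i j; exact: smooth_comp oU oW phis UW (hs i j). Qed.

Lemma mwirt_comp U W phi s x xi : open U -> open W -> holomorphic_on U phi ->
  (forall y, U y -> W (phi y)) -> msmooth W h -> U x ->
  mwirt s xi (h \o phi) x = mwirt s (xi *m jacobian phi x) h (phi x).
Proof.
move=> oU oW hol UW hs Ux; apply/matrixP => i j; rewrite [LHS]mxE [RHS]mxE.
by apply: (wirt_comp _ _ oU hol Ux); exact: smooth_C1 oW (hs i j) (UW _ Ux).
Qed.

Lemma mwirt_mwirt_comp U W phi x xi : open U -> open W -> holomorphic_on U phi ->
  (forall y, U y -> W (phi y)) -> msmooth W h -> U x ->
  mwirt (-'i) xi (mwirt 'i xi (h \o phi)) x =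
  mwirt (-'i) (xi *m jacobian phi x) (mwirt 'i (xi *m jacobian phi x) h) (phi x).
Proof.
move=> oU oW hol UW hs Ux; apply/matrixP => i j; rewrite [LHS]mxE [RHS]mxE.
have E k (g : 'rV[C]_k -> 'M[C]_(p, q)) t z :
    (fun y => mwirt t z g y i j) = wirt t z (fun y => g y i j).
  by apply/funext => y; rewrite mxE.
apply: (etrans (congr1 (fun g => wirt (-'i) xi g x) (E _ _ _ _))).
apply: (etrans _ (esym (congr1 (fun g => wirt (-'i) _ g (phi x)) (E _ _ _ _)))).
exact: wirt_wirt_comp oU oW hol UW (hs i j) Ux.
Qed.

End Composition.
End MatrixWirtinger.

(** * Curvature *)

(* Unification otherwise unfolds these limits when it compares two derivatives. *)
Opaque wirt mwirt rderive rderivable.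

Section Adjoint.
Variable C : numClosedFieldType.

Lemma adjM (m n p : nat) (A : 'M[C]_(m, n)) (B : 'M[C]_(n, p)) :
  (A *m B)^t* = B^t* *m A^t*.
Proof. by rewrite trmx_mul map_mxM. Qed.

Lemma adjD (m n : nat) (A B : 'M[C]_(m, n)) : (A + B)^t* = A^t* + B^t*.
Proof. by apply/matrixP => i j; rewrite !mxE rmorphD. Qed.

Lemma adjN (m n : nat) (A : 'M[C]_(m, n)) : (- A)^t* = - A^t*.
Proof. by apply/matrixP => i j; rewrite !mxE rmorphN. Qed.

Lemma adjK (m n : nat) (A : 'M[C]_(m, n)) : A^t*^t* = A.
Proof. by apply/matrixP => i j; rewrite !mxE conjCK. Qed.

Lemma adj0 (m n : nat) : (0 : 'M[C]_(m, n))^t* = 0.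
Proof. by apply/matrixP => i j; rewrite !mxE conjC0. Qed.

Lemma adj1 (n : nat) : (1%:M : 'M[C]_n)^t* = 1%:M.
Proof. by rewrite trmx1 map_mx1. Qed.

Lemma adjZ (m n : nat) (a : C) (A : 'M[C]_(m, n)) : (a *: A)^t* = a^* *: A^t*.
Proof. by apply/matrixP => i j; rewrite !mxE rmorphM. Qed.

Lemma adj_inv (n : nat) (A : 'M[C]_n) : (invmx A)^t* = invmx (A^t*).
Proof. by rewrite trmx_inv map_invmx. Qed.

Lemma invmx_eq (n : nat) (A B : 'M[C]_n) : A *m B = 1%:M -> invmx A = B.
Proof.
move=> AB; have [Au _] := mulmx1_unit AB.
by rewrite -[LHS]mulmx1 -AB mulKmx.
Qed.

End Adjoint.

Section Curvature.
Variable R : realType.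
Local Notation C := (cplx R).

Lemma hform_adj (n : nat) (M : 'M[C]_n) (u v : 'rV[C]_n) :
  (hform M u v)^* = hform (M^t*) v u.
Proof.
rewrite /hform; have -> : forall A : 'M[C]_1, (A 0 0)^* = A^t* 0 0.
  by move=> A; rewrite !mxE.
by rewrite !adjM adjK mulmxA.
Qed.

Lemma hform_congr (n p : nat) (M : 'M[C]_n) (F : 'M[C]_(p, n)) (u v : 'rV[C]_p) :
  hform (F *m M *m F^t*) u v = hform M (u *m F) (v *m F).
Proof. by rewrite /hform adjM !mulmxA. Qed.

Lemma hformD (n : nat) (M N : 'M[C]_n) (u v : 'rV[C]_n) :
  hform (M + N) u v = hform M u v + hform N u v.
Proof. by rewrite /hform mulmxDr mulmxDl mxE. Qed.

Lemma hformZ (n : nat) (a : C) (M : 'M[C]_n) (u v : 'rV[C]_n) :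
  hform (a *: M) u v = a * hform M u v.
Proof. by rewrite /hform -scalemxAr -scalemxAl mxE. Qed.

Lemma hform_scale (n : nat) (a : C) (M : 'M[C]_n) (u v : 'rV[C]_n) :
  hform M (a *: u) (a *: v) = `|a| ^+ 2 * hform M u v.
Proof. by rewrite /hform adjZ -!scalemxAl -!scalemxAr !mxE mulrA normCK. Qed.

Lemma hformE (n : nat) (M : 'M[C]_n) (u v : 'rV[C]_n) :
  hform M u v = \sum_i \sum_j M i j * u 0 i * (v 0 j)^*.
Proof.
rewrite /hform mxE exchange_big /=; apply: eq_bigr => j _.
rewrite !mxE mulr_suml; apply: eq_bigr => i _.
by rewrite [u 0 i * _]mulrC.
Qed.

(* The sesquilinear form [v, w |-> R(v, w, xi, xi)]. *)
Definition curv (n r : nat) (h : 'rV[C]_n -> 'M[C]_r) (x xi : 'rV[C]_n) : 'M[C]_r :=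
  - mwirt (-'i) xi (mwirt 'i xi h) x +
  mwirt (-'i) xi h x *m invmx (h x) *m mwirt 'i xi h x.

Lemma mwirt_mwirtE (n p q : nat) (U : set 'rV[C]_n) (h : 'rV[C]_n -> 'M[C]_(p, q)) x xi i j :
  open U -> msmooth U h -> U x ->
  mwirt (-'i) xi (mwirt 'i xi h) x i j =
  \sum_a \sum_b del a (delbar b (fun y => h y i j)) x * xi 0 a * (xi 0 b)^*.
Proof.
move=> oU hs Ux.
have hbs b : smooth_on U (delbar b (fun y => h y i j)).
  by rewrite delbarE; exact: smooth_wirt oU (hs i j).
rewrite mwirtE.
pose g b y := (xi 0 b)^* * delbar b (fun y => h y i j) y.
have gs b : smooth_on U (g b) by exact: smoothM oU (smooth_cst _ oU) (hbs b).
have E y : U y -> mwirt 'i xi h y i j = \sum_b g b y.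
  by move=> Uy; rewrite mwirtE wirt_delbarE //; exact: smooth_C1 oU (hs i j) Uy.
apply: (etrans (open_wirt_ext _ _ oU E Ux)).
rewrite wirt_sum; last by move=> b v _; exact: smooth_rderivable (gs b) Ux v.
rewrite exchange_big; apply: eq_bigr => b _ /=.
apply: (etrans (wirtZ _ _ _ (smooth_rderivable (hbs b) Ux))).
rewrite wirt_delE; last exact: smooth_C1 oU (hbs b) Ux.
rewrite mulr_sumr; apply: eq_bigr => a _.
by rewrite mulrC [xi 0 a * _]mulrC.
Qed.

Lemma curvE (n r : nat) (U : set 'rV[C]_n) (h : 'rV[C]_n -> 'M[C]_r) x xi i j :
  open U -> msmooth U h -> U x ->
  curv h x xi i j = \sum_a \sum_b chern_curv h x i j a b * xi 0 a * (xi 0 b)^*.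
Proof.
move=> oU hs Ux.
have hC i' j' : C1_at (fun y => h y i' j') x by exact: smooth_C1 oU (hs i' j') Ux.
pose A := \sum_a \sum_b del a (delbar b (fun y => h y i j)) x * xi 0 a * (xi 0 b)^*.
pose B := \sum_a \sum_b (\sum_k \sum_l invmx (h x) l k * del a (fun y => h y i l) x
                      * delbar b (fun y => h y k j) x) * xi 0 a * (xi 0 b)^*.
have -> : \sum_a \sum_b chern_curv h x i j a b * xi 0 a * (xi 0 b)^* = - A + B.
  rewrite /A /B -sumrN -big_split; apply: eq_bigr => a _ /=.
  rewrite -sumrN -big_split; apply: eq_bigr => b _ /=.
  by rewrite /chern_curv !mulrDl !mulNr.
have EA : mwirt (-'i) xi (mwirt 'i xi h) x i j = A by exact: mwirt_mwirtE oU hs Ux.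
have EB : (mwirt (-'i) xi h x *m invmx (h x) *m mwirt 'i xi h x) i j = B.
  rewrite /B mxE.
  under [RHS]eq_bigr => a _ do under eq_bigr => b _ do rewrite -mulrA mulr_suml.
  under [RHS]eq_bigr => a _ do rewrite exchange_big /=.
  rewrite exchange_big; apply: eq_bigr => k _ /=.
  rewrite mxE mwirtE.
  under [RHS]eq_bigr => a _ do under eq_bigr => b _ do rewrite mulr_suml.
  under [RHS]eq_bigr => a _ do rewrite exchange_big /=.
  rewrite exchange_big mulr_suml; apply: eq_bigr => l _ /=.
  rewrite !mwirtE (wirt_delE _ (hC _ _)) (wirt_delbarE _ (hC _ _)) !mulr_suml.
  apply: eq_bigr => a _; rewrite mulr_sumr; apply: eq_bigr => b _.
  move: (xi 0 a) (invmx (h x) l k) ((xi 0 b)^*) => z1 z2 z3.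
  set d1 := del _ _ _; set d2 := delbar _ _ _.
  by move: d1 d2 => d1 d2; ring.
have entry (M N : 'M[C]_r) : (- M + N) i j = - M i j + N i j by rewrite !mxE.
by rewrite /curv entry EA EB.
Qed.

(** Turns the fourfold sum of the definition into a product of matrices for fixed [xi], the form in
    which block inversion and changes of frame can be computed. Smoothness serves to expand
    derivatives along [xi] in coordinate derivatives. *)
Lemma chern_formE (n r : nat) (U : set 'rV[C]_n) (h : 'rV[C]_n -> 'M[C]_r) x v xi :
  open U -> msmooth U h -> U x -> chern_form h x v xi = hform (curv h x xi) v v.
Proof.
move=> oU hs Ux; rewrite hformE /chern_form; apply: eq_bigr => i _; apply: eq_bigr => j _.
rewrite (curvE _ _ _ oU hs Ux) -mulrA mulr_suml; apply: eq_bigr => a _.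
rewrite mulr_suml; apply: eq_bigr => b _; rewrite mulrA.
by move: (chern_curv _ _ _ _ _ _) => z; ring.
Qed.

Lemma curv_ext (n r : nat) (U : set 'rV[C]_n) (g h : 'rV[C]_n -> 'M[C]_r) x xi :
  open U -> (forall y, U y -> g y = h y) -> U x -> curv g x xi = curv h x xi.
Proof.
move=> oU gh Ux; have D s := mwirt_ext s xi oU gh Ux.
rewrite /curv (gh x Ux) (D (-'i)) (D 'i); apply: (congr1 (fun M => - M + _)).
by apply: (mwirt_ext _ _ oU _ Ux) => y Uy; exact: mwirt_ext oU gh Uy.
Qed.

(** Here [DF] is the (1,0)-derivative of a holomorphic [F], and [d1], [d2], [d12] are the (1,0)-,
    (0,1)- and mixed derivatives of the Gram matrix [g]. The left side is the curvature of the
    congruent metric after the product rule; every term containing [DF] cancels. *)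
Lemma curv_congr_algebra (p r : nat) (F : 'M[C]_(p, r)) (F' : 'M[C]_(r, p))
    (g : 'M[C]_r) (DF : 'M[C]_(p, r)) (d1 d2 d12 : 'M[C]_r) :
  F *m F' = 1%:M -> F' *m F = 1%:M -> g \in unitmx ->
  - (DF *m (d2 *m F^t* + g *m DF^t*) + F *m (d12 *m F^t* + d1 *m DF^t*)) +
    (DF *m g + F *m d1) *m F^t* *m invmx (F *m g *m F^t*)
      *m (F *m (d2 *m F^t* + g *m DF^t*)) =
  F *m (- d12 + d1 *m invmx g *m d2) *m F^t*.
Proof.
move=> FF' F'F gu.
have FT : F^t* *m F'^t* = 1%:M by rewrite -adjM F'F adj1.
have -> : invmx (F *m g *m F^t*) = F'^t* *m invmx g *m F'.
  apply: invmx_eq; rewrite -!mulmxA (mulmxA (F^t*)) FT mul1mx.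
  by rewrite (mulmxA g) mulmxV // mul1mx.
set FS := F^t* in FT *; set DS := DF^t*.
have -> : (DF *m g + F *m d1) *m FS *m (F'^t* *m invmx g *m F') =
    (DF + F *m d1 *m invmx g) *m F'.
  rewrite -!mulmxA (mulmxA FS) FT mul1mx !mulmxA; congr (_ *m _).
  by rewrite mulmxDl mulmxK.
rewrite -(mulmxA _ F') (mulmxA F') F'F mul1mx.
rewrite mulmxDl -!(mulmxA F) -(mulmxA d1) (mulmxDr (invmx g)) (mulKmx gu).
have cancel4 (V : zmodType) (a c d e : V) : - (a + (c + d)) + (a + (e + d)) = - c + e.
  by rewrite opprD addrACA addNr add0r opprD addrACA addNr addr0.
rewrite !(mulmxDr F) !(mulmxDr d1) (mulmxDr F).
set a := DF *m _; set d := F *m (d1 *m DS); set e := F *m (d1 *m _).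
apply: (etrans (cancel4 _ _ _ _ _)).
by rewrite mulmxDl mulmxDr mulNmx mulmxN /e !mulmxA.
Qed.

(** Serves twice: with [phi] the identity it is the law for a change of holomorphic frame, with [F]
    the Jacobian of [phi] the law for a change of coordinates. The sizes [p] and [r] agree as
    numbers, but for the adapted frame they are written [r + m] and [n], so they are kept apart. *)
Lemma curv_pullback (n m p r : nat) (U : set 'rV[C]_n) (W : set 'rV[C]_m)
    (phi : 'rV[C]_n -> 'rV[C]_m) (h : 'rV[C]_m -> 'M[C]_r)
    (F : 'rV[C]_n -> 'M[C]_(p, r)) (F' : 'M[C]_(r, p)) x xi :
  open U -> open W -> holomorphic_on U phi -> (forall y, U y -> W (phi y)) ->
  holomorphic_on U F -> msmooth W h -> U x ->
  F x *m F' = 1%:M -> F' *m F x = 1%:M -> h (phi x) \in unitmx ->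
  curv (fun y => F y *m h (phi y) *m (F y)^t*) x xi =
  F x *m curv h (phi x) (xi *m jacobian phi x) *m (F x)^t*.
Proof.
move=> oU oW hol UW Fhol hs Ux FF' F'F hu; set c := xi *m jacobian phi x.
pose G := h \o phi.
have Gs : msmooth U G by apply: (msmooth_comp oU oW _ UW hs) => j; exact: (hol 0 j).1.
have Fs := holomorphic_msmooth Fhol; have FTs := msmooth_conjT oU Fs.
have ci : ('i : C)^* = - 'i by exact: conjCi.
have cNi : (- 'i : C)^* = 'i by rewrite rmorphN /= conjCi opprK.
pose DF := mwirt (-'i) xi F.
have DFs : msmooth U DF by exact: msmooth_mwirt.
have D1 y : U y -> mwirt (-'i) xi (fun y => F y *m G y *m (F y)^t*) y =
    (DF y *m G y + F y *m mwirt (-'i) xi G y) *m (F y)^t*.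
  move=> Uy; rewrite (mwirtM _ _ (msmoothM oU Fs Gs) FTs Uy) (mwirtM _ _ Fs Gs Uy).
  rewrite (mwirt_conjT _ _ Fs Uy) cNi (mwirt_holomorphic _ oU Fhol Uy).
  by rewrite adj0 mulmx0 addr0.
have D2 y : U y -> mwirt 'i xi (fun y => F y *m G y *m (F y)^t*) y =
    F y *m (mwirt 'i xi G y *m (F y)^t* + G y *m (DF y)^t*).
  move=> Uy; rewrite (mwirtM _ _ (msmoothM oU Fs Gs) FTs Uy) (mwirtM _ _ Fs Gs Uy).
  rewrite (mwirt_conjT _ _ Fs Uy) ci (mwirt_holomorphic _ oU Fhol Uy).
  by rewrite mul0mx add0r mulmxDr !mulmxA.
have D2Gs : msmooth U (mwirt 'i xi G) by exact: msmooth_mwirt.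
have DFTs : msmooth U (fun y => (DF y)^t*) by exact: msmooth_conjT.
have As := msmoothM oU D2Gs FTs; have Bs := msmoothM oU Gs DFTs.
have D12 : mwirt (-'i) xi (mwirt 'i xi (fun y => F y *m G y *m (F y)^t*)) x =
    DF x *m (mwirt 'i xi G x *m (F x)^t* + G x *m (DF x)^t*) +
    F x *m (mwirt (-'i) xi (mwirt 'i xi G) x *m (F x)^t* +
            mwirt (-'i) xi G x *m (DF x)^t*).
  rewrite (mwirt_ext _ _ oU D2 Ux) (mwirtM _ _ Fs (msmoothD oU As Bs) Ux).
  rewrite (mwirtD _ _ As Bs Ux) (mwirtM _ _ D2Gs FTs Ux) (mwirtM _ _ Gs DFTs Ux).
  rewrite (mwirt_conjT _ _ Fs Ux) (mwirt_conjT _ _ DFs Ux) cNi.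
  rewrite (mwirt_holomorphic _ oU Fhol Ux) (mwirt_mwirt_holomorphic _ _ _ oU Fhol Ux).
  by rewrite !adj0 2!mulmx0 !addr0.
have E1 s : mwirt s xi G x = mwirt s c h (phi x).
  exact: mwirt_comp oU oW hol UW hs Ux.
have E2 : mwirt (-'i) xi (mwirt 'i xi G) x = mwirt (-'i) c (mwirt 'i c h) (phi x).
  exact: mwirt_mwirt_comp oU oW hol UW hs Ux.
have curv_eq (a a' b b' d d' M : 'M[C]_r) : a = a' -> b = b' -> d = d' ->
  - a + b *m invmx M *m d = - a' + b' *m invmx M *m d' by move=> -> -> ->.
have curv_eqp (a a' b b' d d' M : 'M[C]_p) : a = a' -> b = b' -> d = d' ->
  - a + b *m invmx M *m d = - a' + b' *m invmx M *m d' by move=> -> -> ->.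
have EG : curv G x xi = curv h (phi x) c by exact: curv_eq E2 (E1 _) (E1 _).
apply: (etrans _ (congr1 (fun M => F x *m M *m (F x)^t*) EG)).
apply: (etrans _ (curv_congr_algebra (DF x) (mwirt (-'i) xi G x) (mwirt 'i xi G x)
  (mwirt (-'i) xi (mwirt 'i xi G) x) FF' F'F hu)).
exact: curv_eqp D12 (D1 x Ux) (D2 x Ux).
Qed.
End Curvature.

(** * Hermitian and Kaehler symmetries of the curvature *)

Section LocalKahler.
Variable R : realType.
Local Notation C := (cplx R).

Lemma conj_i : ('i : C)^* = - 'i. Proof. exact: conjCi. Qed.
Lemma conj_Ni : (- 'i : C)^* = 'i.
Proof. by rewrite rmorphN /= conjCi opprK. Qed.

(** Conjugation exchanges the two Wirtinger derivatives, and these commute. The reality of the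
    curvature form, without which it cannot be compared with 0, follows. *)
Lemma curv_herm (n r : nat) (U : set 'rV[C]_n) (h : 'rV[C]_n -> 'M[C]_r) x xi :
  open U -> msmooth U h -> (forall y, U y -> (h y)^t* = h y) -> U x ->
  (curv h x xi)^t* = curv h x xi.
Proof.
move=> oU hs hh Ux.
have D s y : U y -> (mwirt s xi h y)^t* = mwirt s^* xi h y.
  move=> Uy; have E := mwirt_conjT s^* xi hs Uy; rewrite conjCK in E.
  by apply: (etrans (esym E)); exact: mwirt_ext oU hh Uy.
have Di y : U y -> (mwirt 'i xi h y)^t* = mwirt (-'i) xi h y.
  by move=> Uy; rewrite D // conj_i.
have DNi y : U y -> (mwirt (-'i) xi h y)^t* = mwirt 'i xi h y.
  by move=> Uy; rewrite D // conj_Ni.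
have hs' : msmooth U (mwirt 'i xi h) by exact: msmooth_mwirt.
have D12 : (mwirt (-'i) xi (mwirt 'i xi h) x)^t* = mwirt (-'i) xi (mwirt 'i xi h) x.
  have E := mwirt_conjT 'i xi hs' Ux; rewrite conj_i in E.
  apply: (etrans (esym E)); apply: (etrans (mwirt_ext 'i xi oU Di Ux)).
  exact: mwirtC oU hs Ux.
rewrite /curv adjD adjN !adjM D12 (Di _ Ux) (DNi _ Ux) adj_inv (hh _ Ux).
by rewrite mulmxA.
Qed.

Lemma chern_form_real (n r : nat) (U : set 'rV[C]_n) (h : 'rV[C]_n -> 'M[C]_r) x v xi :
  open U -> msmooth U h -> (forall y, U y -> (h y)^t* = h y) -> U x ->
  chern_form h x v xi \is Num.real.
Proof.
move=> oU hs hh Ux; apply/CrealP.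
by rewrite (chern_formE _ _ oU hs Ux) hform_adj (curv_herm _ oU hs hh Ux).
Qed.

Definition closed_at (n : nat) (g : 'rV[C]_n -> 'M[C]_n) (y : 'rV[C]_n) : Prop :=
  forall a b c : 'I_n,
    del c (fun z => g z a b) y = del a (fun z => g z c b) y /\
    delbar c (fun z => g z a b) y = delbar b (fun z => g z a c) y.

(** In the second order term, closedness exchanges [j] and [b] under the inner derivative; the two
    derivatives are then commuted, closedness exchanges [i] and [a], and they are commuted back. In
    the first order term closedness acts on each factor. *)
Lemma chern_curv_sym (n : nat) (U : set 'rV[C]_n) (g : 'rV[C]_n -> 'M[C]_n) x i j a b :
  open U -> msmooth U g -> (forall y, U y -> closed_at g y) -> U x ->
  chern_curv g x i j a b = chern_curv g x a b i j.
Proof.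
move=> oU gs cl Ux.
have alg (u u' w w' : C) : u = u' -> w = w' -> - u + w = - u' + w' by move=> -> ->.
apply: alg.
  have E1 y : U y -> delbar b (fun z => g z i j) y = delbar j (fun z => g z i b) y.
    by move=> Uy; exact: (cl y Uy i j b).2.
  have E2 y : U y -> del a (fun z => g z i b) y = del i (fun z => g z a b) y.
    by move=> Uy; exact: (cl y Uy i b a).1.
  rewrite !delE !delbarE.
  apply: (etrans (open_wirt_ext _ _ oU E1 Ux)).
  apply: (etrans (wirtC _ _ _ _ oU (gs i b) Ux)).
  apply: (etrans _ (wirtC _ _ _ _ oU (gs a b) Ux)).
  rewrite !delE in E2; exact: open_wirt_ext oU E2 Ux.
apply: eq_bigr => k _; apply: eq_bigr => l _.
by rewrite (cl x Ux i l a).1 (cl x Ux k j b).2.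
Qed.

Lemma chern_form_sym (n : nat) (U : set 'rV[C]_n) (g : 'rV[C]_n -> 'M[C]_n) x xi eta :
  open U -> msmooth U g -> (forall y, U y -> closed_at g y) -> U x ->
  chern_form g x eta xi = chern_form g x xi eta.
Proof.
move=> oU gs cl Ux; rewrite /chern_form.
under eq_bigr => i _ do rewrite exchange_big /=.
rewrite exchange_big /=; apply: eq_bigr => a _.
under eq_bigr => i _ do rewrite exchange_big /=.
rewrite exchange_big /=; apply: eq_bigr => b _.
apply: eq_bigr => i _; apply: eq_bigr => j _.
rewrite (chern_curv_sym i j a b oU gs cl Ux).
by move: (chern_curv _ _ _ _ _ _) => z; ring.
Qed.

Lemma jacobian_ext (n m : nat) (U : set 'rV[C]_n) (f g : 'rV[C]_n -> 'rV[C]_m) x :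
  open U -> (forall y, U y -> f y = g y) -> U x -> jacobian f x = jacobian g x.
Proof.
move=> oU fg Ux; apply/matrixP => a k; rewrite !mxE !delE.
by apply: (open_wirt_ext _ _ oU _ Ux) => y Uy; rewrite fg.
Qed.

Lemma jacobian_comp (n m q : nat) (U : set 'rV[C]_n) (W : set 'rV[C]_m)
    (phi : 'rV[C]_n -> 'rV[C]_m) (psi : 'rV[C]_m -> 'rV[C]_q) x :
  open U -> open W -> holomorphic_on U phi -> holomorphic_on W psi ->
  (forall y, U y -> W (phi y)) -> U x ->
  jacobian (psi \o phi) x = jacobian phi x *m jacobian psi (phi x).
Proof.
move=> oU oW hphi hpsi UW Ux; apply/matrixP => a k.
have psiC : C1_at (fun z => psi z 0 k) (phi x).
  exact: smooth_C1 oW (hpsi 0 k).1 (UW _ Ux).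
have E := wirt_comp (-'i) (delta_mx 0 a) oU hphi Ux psiC.
rewrite [LHS]mxE delE; apply: (etrans E); rewrite wirt_delE // mxE -rowE.
by apply: eq_bigr => b _; rewrite mxE [X in _ = _ * X]mxE.
Qed.

Lemma holomorphic_jacobian (n m : nat) (U : set 'rV[C]_n) (phi : 'rV[C]_n -> 'rV[C]_m) :
  open U -> holomorphic_on U phi -> holomorphic_on U (jacobian phi).
Proof.
move=> oU hol a k; have [sm cr] := hol 0 k.
have E : (fun y => jacobian phi y a k) = wirt (-'i) (delta_mx 0 a) (fun y => phi y 0 k).
  by apply/funext => y; rewrite mxE delE.
rewrite E; split; first exact: smooth_wirt.
move=> b x Ux; rewrite delbarE; apply: (etrans (wirtC _ _ _ _ oU sm Ux)).
have Z y : U y -> wirt 'i (delta_mx 0 b) (fun y => phi y 0 k) y = 0.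
  by move=> Uy; rewrite -delbarE cr.
by apply: (etrans (open_wirt_ext _ _ oU Z Ux)); exact: wirt_cst.
Qed.

Lemma del_mwirt (n p q : nat) (H : 'rV[C]_n -> 'M[C]_(p, q)) x a i j :
  del a (fun y => H y i j) x = mwirt (-'i) (delta_mx 0 a) H x i j.
Proof. by rewrite mwirtE delE. Qed.

(** For a Hermitian matrix the (1,2)-component of the differential is the conjugate of the
    (2,1)-component, so half of the conditions suffices. *)
Lemma closed_at_herm (n : nat) (U : set 'rV[C]_n) (g : 'rV[C]_n -> 'M[C]_n) x :
  open U -> msmooth U g -> (forall y, U y -> (g y)^t* = g y) -> U x ->
  (forall a b c, del c (fun z => g z a b) x = del a (fun z => g z c b) x) ->
  closed_at g x.
Proof.
move=> oU gs gh Ux H a b c; split; first exact: H.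
have E c' a' b' : delbar c' (fun z => g z a' b') x = (del c' (fun z => g z b' a') x)^*.
  rewrite delbarE delE -conj_i -wirt_conj; last exact: smooth_rderivable (gs b' a') Ux.
  by apply: (open_wirt_ext _ _ oU _ Ux) => y Uy; rewrite -{1}(gh y Uy) !mxE.
by rewrite !E H.
Qed.

(** The conjugate Jacobian has no (1,0)-derivative. The terms that differentiate the other Jacobian
    are symmetric in [a] and [c] because they are second derivatives of [phi]; those that
    differentiate [h] are symmetric because [h] is closed. *)
Lemma closed_at_pullback (n m : nat) (U : set 'rV[C]_n) (W : set 'rV[C]_m)
    (phi : 'rV[C]_n -> 'rV[C]_m) (h : 'rV[C]_m -> 'M[C]_m) x a b c :
  open U -> open W -> holomorphic_on U phi -> (forall y, U y -> W (phi y)) ->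
  msmooth W h -> (forall z, W z -> closed_at h z) -> U x ->
  let g y := jacobian phi y *m h (phi y) *m (jacobian phi y)^t* in
  del c (fun z => g z a b) x = del a (fun z => g z c b) x.
Proof.
move=> oU oW hol UW hs cl Ux g.
have Jh := holomorphic_jacobian oU hol; have Js := holomorphic_msmooth Jh.
have JTs := msmooth_conjT oU Js.
have Gs : msmooth U (h \o phi).
  by apply: (msmooth_comp oU oW _ UW hs) => j; exact: (hol 0 j).1.
pose J := jacobian phi; pose G := h \o phi.
have D e : mwirt (-'i) e g x = (mwirt (-'i) e J x *m G x + J x *m mwirt (-'i) e G x) *m (J x)^t*.
  apply: (etrans (mwirtM _ _ (msmoothM oU Js Gs) JTs Ux)).
  rewrite (mwirt_conjT _ _ Js Ux) conj_Ni (mwirt_holomorphic _ oU Jh Ux) adj0 mulmx0 addr0.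
  by rewrite (mwirtM _ _ Js Gs Ux).
have DJ a' c' s : mwirt (-'i) (delta_mx 0 c') J x a' s = mwirt (-'i) (delta_mx 0 a') J x c' s.
  apply: (etrans (mwirtE _ _ _ _ _ _)); apply: (etrans _ (esym (mwirtE _ _ _ _ _ _))).
  have E d : (fun y => J y d s) = wirt (-'i) (delta_mx 0 d) (fun y => phi y 0 s).
    by apply/funext => y; rewrite mxE delE.
  apply: (etrans (congr1 (fun f => wirt _ _ f x) (E a'))).
  apply: (etrans _ (esym (congr1 (fun f => wirt _ _ f x) (E c')))).
  exact: wirtC oU (hol 0 s).1 Ux.
have DG e s t : mwirt (-'i) e G x s t = \sum_q (e *m J x) 0 q * del q (fun z => h z s t) (phi x).
  have -> : mwirt (-'i) e G x = _ := mwirt_comp _ _ oU oW hol UW hs Ux.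
  by rewrite mwirtE wirt_delE //; exact: smooth_C1 oW (hs s t) (UW _ Ux).
have rowJ d q : ((delta_mx 0 d : 'rV[C]_n) *m J x) 0 q = J x d q by rewrite -rowE mxE.
pose A d := mwirt (-'i) (delta_mx 0 d) J x *m G x + J x *m mwirt (-'i) (delta_mx 0 d) G x.
have E d a' : del d (fun z => g z a' b) x = (A d *m (J x)^t*) a' b.
  apply: (etrans (del_mwirt g _ _ _ _)).
  exact: (congr1 (fun M : 'M[C]_n => M a' b) (D _)).
have entry d a' t : A d a' t =
    \sum_s mwirt (-'i) (delta_mx 0 d) J x a' s * G x s t +
    \sum_s J x a' s * mwirt (-'i) (delta_mx 0 d) G x s t.
  by rewrite mxE [X in X + _]mxE [X in _ + X]mxE.
have S t : A c a t = A a c t.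
  apply: (etrans (entry _ _ _)); apply: (etrans _ (esym (entry _ _ _))).
  apply: f_equal2.
    by apply: eq_bigr => s _; apply: (congr1 (fun z => z * _)); exact: DJ.
  have F d e s : J x d s * mwirt (-'i) (delta_mx 0 e) G x s t =
      \sum_q J x d s * (J x e q * del q (fun z => h z s t) (phi x)).
    rewrite -mulr_sumr; apply: (congr1 (fun z => _ * z)); apply: (etrans (DG _ _ _)).
    by apply: eq_bigr => q _; rewrite rowJ.
  apply: (etrans (eq_bigr _ (fun s _ => F a c s))).
  apply: (etrans _ (esym (eq_bigr _ (fun s _ => F c a s)))).
  rewrite [RHS]exchange_big /=; apply: eq_bigr => s _; apply: eq_bigr => q _.
  apply: (etrans _ (mulrCA _ _ _)); apply: (congr1 (fun z => _ * (_ * z))).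
  exact: (cl _ (UW _ Ux) s t q).1.
apply: (etrans (E _ _)); apply: (etrans _ (esym (E _ _))).
have mulE (M : 'M[C]_(n, m)) (N : 'M[C]_(m, n)) i j :
  (M *m N) i j = \sum_t M i t * N t j by rewrite mxE.
apply: (etrans (mulE _ _ _ _)); apply: (etrans _ (esym (mulE _ _ _ _))).
by apply: eq_bigr => t _; apply: (congr1 (fun z => z * _)); exact: S.
Qed.

End LocalKahler.

(** * The curvature in a frame adapted to the fibration *)

Section BlockAlgebra.
Variable K : fieldType.
Variables r m : nat.

(* Gaussian elimination of the first block; [S] is its Schur complement. *)
Lemma block_inverse_form (N : nat) (Phi : 'M[K]_r) (Psi : 'M[K]_(r, m)) (Psi2 : 'M[K]_(m, r))
    (Th S : 'M[K]_m) (L1 : 'M[K]_(N, r)) (Lx : 'M[K]_(N, m))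
    (K1 : 'M[K]_(r, N)) (Kx : 'M[K]_(m, N)) :
  Phi \in unitmx -> S \in unitmx -> S = Th - Psi2 *m invmx Phi *m Psi ->
  block_mx Phi Psi Psi2 Th \in unitmx ->
  row_mx L1 Lx *m invmx (block_mx Phi Psi Psi2 Th) *m col_mx K1 Kx =
  L1 *m invmx Phi *m K1 + (Lx - L1 *m invmx Phi *m Psi) *m invmx S
     *m (Kx - Psi2 *m invmx Phi *m K1).
Proof.
move=> Phiu Su ES Gu; set Y := (Lx - _) *m invmx S.
(* [Z] solves the linear system [Z *m block = row_mx L1 Lx], so the inverse of the block matrix is
   never written out. *)
pose Z := row_mx (L1 *m invmx Phi - Y *m Psi2 *m invmx Phi) Y.
have ZG : Z *m block_mx Phi Psi Psi2 Th = row_mx L1 Lx.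
  rewrite mul_row_block mulmxBl !mulmxKV // subrK; congr (row_mx _ _).
  have -> : Th = S + Psi2 *m invmx Phi *m Psi by rewrite ES subrK.
  rewrite mulmxDr [Y *m S]mulmxKV // mulmxBl !mulmxA.
  by rewrite [Lx - _ + _]addrC addrA subrK addrC subrK.
rewrite -ZG mulmxK // mul_row_col mulmxBl mulmxBr !mulmxA.
by rewrite -addrA [- _ + _]addrC.
Qed.

(** The resolvent identity. It is exact, and its factor [e] will absorb the remaining [e^-1] of the
    curvature. *)
Lemma invmx_perturb (h Th' M : 'M[K]_m) (e : K) : h \in unitmx ->
  M *m (h + e *: Th') = 1%:M -> M = invmx h - e *: (M *m Th' *m invmx h).
Proof.
move=> hu; rewrite mulmxDr -scalemxAr => /(congr1 (fun A => A *m invmx h)).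
by rewrite mulmxDl mul1mx mulmxK // -scalemxAl => /eqP; rewrite eq_sym -subr_eq => /eqP.
Qed.

Lemma addr_rearrange (V : zmodType) (A Y X1 X2 X3 X4 X5 X6 : V) :
  - (A + Y) + (X1 + (X2 + X3 + X4 + (X6 - X5))) =
  - Y + X6 + (- A + X1 + X2 + X3 + X4 - X5).
Proof. by rewrite opprD !addrA [LHS](ACl (2*7*1*3*4*5*6*8)%AC). Qed.

(* What is left of the curvature of the block metric after the term of order
   [e^-1]; unlike the metric, it makes sense at [e = 0]. *)
Definition curv_remainder (Phi : 'M[K]_r) (Psi : 'M[K]_(r, m)) (Psi2 : 'M[K]_(m, r))
    (Th h : 'M[K]_m) (H1 H2 H12 : 'M[K]_(r + m)) (h1 h2 : 'M[K]_m) (e : K) : 'M[K]_(r + m) :=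
  let Th' := Th - Psi2 *m invmx Phi *m Psi in
  let M := invmx (h + e *: Th') in
  let c := rsubmx H1 - lsubmx H1 *m invmx Phi *m Psi in
  let c' := dsubmx H2 - Psi2 *m invmx Phi *m usubmx H2 in
  let B1 := col_mx 0 h1 in let B2 := row_mx 0 h2 in
  - H12 + lsubmx H1 *m invmx Phi *m usubmx H2 + e *: (c *m M *m c')
  + c *m M *m B2 + B1 *m M *m c' - B1 *m M *m Th' *m invmx h *m B2.

(** [H1], [H2], [H12] and [h1], [h2], [h12] stand for the (1,0)-, (0,1)- and mixed derivatives of
    the two parts of the metric. The factors [e^-1] of the derivatives meet the factor [e] of the
    inverse Schur complement, so that only the product of the two horizontal derivatives stays
    singular. *)
Lemma curv_block_algebra (Phi : 'M[K]_r) (Psi : 'M[K]_(r, m)) (Psi2 : 'M[K]_(m, r))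
    (Th h : 'M[K]_m) (H1 H2 H12 : 'M[K]_(r + m)) (h1 h2 h12 : 'M[K]_m) (e : K) :
  Phi \in unitmx -> h \in unitmx -> e != 0 ->
  h + e *: (Th - Psi2 *m invmx Phi *m Psi) \in unitmx ->
  let blk (A : 'M[K]_m) := e^-1 *: block_mx 0 0 0 A : 'M[K]_(r + m) in
  let G := block_mx Phi Psi Psi2 Th + blk h in
  G \in unitmx ->
  - (H12 + blk h12) + (H1 + blk h1) *m invmx G *m (H2 + blk h2) =
  blk (- h12 + h1 *m invmx h *m h2)
  + curv_remainder Phi Psi Psi2 Th h H1 H2 H12 h1 h2 e.
Proof.
move=> Phiu hu e0 Su blk G Gu; rewrite /curv_remainder.
set Th' := Th - _ in Su *; set S := h + _ in Su *; set M := invmx S.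
set c := rsubmx H1 - _; set c' := dsubmx H2 - _.
set B1 := col_mx 0 h1; set B2 := row_mx 0 h2.
have blkE A : blk A = block_mx 0 0 0 (e^-1 *: A) by rewrite /blk scale_block_mx !scaler0.
have EG : G = block_mx Phi Psi Psi2 (Th + e^-1 *: h).
  by rewrite /G blkE add_block_mx !addr0.
have E1 : H1 + blk h1 = row_mx (lsubmx H1) (rsubmx H1 + e^-1 *: B1).
  rewrite -{1}[H1]hsubmxK blkE block_mxEh add_row_mx scale_col_mx scaler0.
  by rewrite col_mx0 addr0.
have E2 : H2 + blk h2 = col_mx (usubmx H2) (dsubmx H2 + e^-1 *: B2).
  rewrite -{1}[H2]vsubmxK blkE block_mxEv add_col_mx scale_row_mx scaler0.
  by rewrite row_mx0 addr0.
have ES : e^-1 *: S = (Th + e^-1 *: h) - Psi2 *m invmx Phi *m Psi.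
  by rewrite /S scalerDr scalerA mulVf // scale1r addrC /Th' addrAC.
have kSu : e^-1 *: S \in unitmx by rewrite unitmxZ ?unitfE ?invr_eq0.
have iS : invmx (e^-1 *: S) = e *: M by rewrite invmxZ // invrK.
rewrite EG in Gu *; rewrite E1 E2 (block_inverse_form _ _ _ _ Phiu kSu ES Gu) iS.
have -> : rsubmx H1 + e^-1 *: B1 - lsubmx H1 *m invmx Phi *m Psi = c + e^-1 *: B1.
  by rewrite addrAC.
have -> : dsubmx H2 + e^-1 *: B2 - Psi2 *m invmx Phi *m usubmx H2 = c' + e^-1 *: B2.
  by rewrite addrAC.
(* Applied to the singular term [e^-1 *: (B1 *m M *m B2)], this gives the quadratic part of the
   curvature of [h] plus a term without [e^-1]. *)
have ME : M = invmx h - e *: (M *m Th' *m invmx h).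
  by apply: invmx_perturb; rewrite // mulVmx.
have expand (A1 B1' : 'M[K]_(r + m, m)) (A2 B2' : 'M[K]_(m, r + m)) (N : 'M[K]_m) :
    (A1 + e^-1 *: B1') *m (e *: N) *m (A2 + e^-1 *: B2') =
    e *: (A1 *m N *m A2) + A1 *m N *m B2' + B1' *m N *m A2 + e^-1 *: (B1' *m N *m B2').
  rewrite mulmxDl !mulmxDr !mulmxDl -!scalemxAl -!scalemxAr -!scalemxAl !scalerA.
  by rewrite mulVf // mulr1 !scale1r addrACA addrA.
rewrite expand.
have -> : e^-1 *: (B1 *m M *m B2) =
    e^-1 *: (B1 *m invmx h *m B2) - B1 *m M *m Th' *m invmx h *m B2.
  rewrite {1}ME mulmxBr mulmxBl -scalemxAr -scalemxAl scalerBr scalerA mulVf // scale1r.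
  by rewrite !mulmxA.
have -> : B1 *m invmx h *m B2 = block_mx 0 0 0 (h1 *m invmx h *m h2).
  by rewrite mul_col_mx mul_col_row !(mulmx0, mul0mx).
have -> : blk (- h12 + h1 *m invmx h *m h2) =
   - blk h12 + e^-1 *: block_mx 0 0 0 (h1 *m invmx h *m h2).
  by rewrite /blk -scalerN -scalerDr opp_block_mx add_block_mx !oppr0 !addr0.
set X1 := lsubmx H1 *m _ *m _; set X2 := e *: _; set X3 := c *m M *m _.
set X4 := B1 *m M *m c'; set X5 := B1 *m M *m _ *m _ *m _; set X6 := e^-1 *: _.
exact: addr_rearrange.
Qed.

(** Vectors without horizontal part annihilate [B1] and [B2], and the one other term involving [M]
    carries the factor [e]. What survives is the curvature formula for the upper left block
    alone. *)
Lemma curv_remainder0 (Phi : 'M[K]_r) (Psi : 'M[K]_(r, m)) (Psi2 : 'M[K]_(m, r))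
    (Th h : 'M[K]_m) (H1 H2 H12 : 'M[K]_(r + m)) (h1 h2 : 'M[K]_m)
    (v : 'rV[K]_r) (w : 'cV[K]_r) :
  row_mx v 0 *m curv_remainder Phi Psi Psi2 Th h H1 H2 H12 h1 h2 0 *m col_mx w 0 =
  v *m (- ulsubmx H12 + ulsubmx H1 *m invmx Phi *m ulsubmx H2) *m w.
Proof.
rewrite /curv_remainder; set B1 := col_mx 0 h1; set B2 := row_mx 0 h2.
have vB1 : row_mx v 0 *m B1 = 0 by rewrite mul_row_col mulmx0 mul0mx addr0.
have B2w : B2 *m col_mx w 0 = 0 by rewrite mul_row_col mulmx0 mul0mx addr0.
have vL (N : nat) (A : 'M[K]_(r + m, N)) : row_mx v 0 *m A = v *m usubmx A.
  by rewrite -{1}[A]vsubmxK mul_row_col mul0mx addr0.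
have Kw (N : nat) (A : 'M[K]_(N, r + m)) : A *m col_mx w 0 = lsubmx A *m w.
  by rewrite -{1}[A]hsubmxK mul_row_col mulmx0 addr0.
set c := rsubmx H1 - _; set c' := dsubmx H2 - _; set M := invmx (h + _).
set T' := Th - _; move: c c' M T' => c c' M T'.
pose q (A : 'M[K]_(r + m)) := row_mx v 0 *m A *m col_mx w 0.
have qD A A' : q (A + A') = q A + q A' by rewrite /q mulmxDr mulmxDl.
have qN A : q (- A) = - q A by rewrite /q mulmxN mulNmx.
have q2 A : q (A *m B2) = 0 by rewrite /q -!mulmxA B2w !mulmx0.
have q1 A : q (B1 *m A) = 0 by rewrite /q !mulmxA vB1 !mul0mx.
have qE A : q A = v *m ulsubmx A *m w.
  by rewrite /q vL Kw /ulsubmx -mulmx_lsub.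
rewrite scale0r addr0 -/(q _) qD qN q2 oppr0 addr0 qD -(mulmxA B1) q1 addr0.
rewrite qD q2 addr0 qD qN !qE.
have -> : ulsubmx (lsubmx H1 *m invmx Phi *m usubmx H2) =
    ulsubmx H1 *m invmx Phi *m ulsubmx H2.
  rewrite /ulsubmx -!mul_usub_mx -!mulmx_lsub; congr (_ *m _ *m _).
  by apply/matrixP => i j; rewrite !mxE.
by rewrite mulmxDr mulmxDl mulmxN mulNmx.
Qed.


End BlockAlgebra.

(** * Limits of matrices and of their derivatives *)

Section Limits.
Variable R : realType.
Local Notation C := (cplx R).
Context {T : Type} {F : set_system T} {FF : Filter F}.

Lemma cvg_bigsum (I : Type) (r : seq I) (P : pred I) (f : I -> T -> C) (l : I -> C) :
  (forall i, f i t @[t --> F] --> l i) ->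
  \sum_(i <- r | P i) f i t @[t --> F] --> \sum_(i <- r | P i) l i.
Proof.
move=> H; elim: r => [|i r IH].
  rewrite big_nil; under eq_fun do rewrite big_nil; exact: cvg_cst.
rewrite big_cons; under eq_fun do rewrite big_cons.
by case: (P i); [exact: cvgD (H i) IH|exact: IH].
Qed.

Lemma cvg_bigprod (I : Type) (r : seq I) (P : pred I) (f : I -> T -> C) (l : I -> C) :
  (forall i, f i t @[t --> F] --> l i) ->
  \prod_(i <- r | P i) f i t @[t --> F] --> \prod_(i <- r | P i) l i.
Proof.
move=> H; elim: r => [|i r IH].
  rewrite big_nil; under eq_fun do rewrite big_nil; exact: cvg_cst.
rewrite big_cons; under eq_fun do rewrite big_cons.
by case: (P i); [exact: cvgM (H i) IH|exact: IH].
Qed.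

(** By [cvg_mxP] this is convergence in the topology of matrices; stated entrywise, the matrix
    operations reduce to limits of sums and products of scalars. *)
Definition mxcvg (p q : nat) (A : T -> 'M[C]_(p, q)) (A0 : 'M[C]_(p, q)) : Prop :=
  forall i j, A t i j @[t --> F] --> A0 i j.

Lemma mxcvg_near_eq (p q : nat) (A B : T -> 'M[C]_(p, q)) A0 :
  mxcvg A A0 -> (\forall t \near F, A t = B t) -> mxcvg B A0.
Proof.
move=> HA AB i j; apply: (cvg_near_eq (HA i j)).
by apply: filterS AB => t ->.
Qed.

Lemma mxcvg_cst (p q : nat) (A0 : 'M[C]_(p, q)) : mxcvg (fun=> A0) A0.
Proof. by move=> i j; exact: cvg_cst. Qed.

Lemma mxcvgD (p q : nat) (A B : T -> 'M[C]_(p, q)) A0 B0 :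
  mxcvg A A0 -> mxcvg B B0 -> mxcvg (fun t => A t + B t) (A0 + B0).
Proof.
move=> HA HB i j; rewrite mxE; under eq_fun do rewrite mxE.
exact: cvgD (HA i j) (HB i j).
Qed.

Lemma mxcvgN (p q : nat) (A : T -> 'M[C]_(p, q)) A0 :
  mxcvg A A0 -> mxcvg (fun t => - A t) (- A0).
Proof.
move=> HA i j; rewrite mxE; under eq_fun do rewrite mxE.
exact: cvgN (HA i j).
Qed.

Lemma mxcvgB (p q : nat) (A B : T -> 'M[C]_(p, q)) A0 B0 :
  mxcvg A A0 -> mxcvg B B0 -> mxcvg (fun t => A t - B t) (A0 - B0).
Proof. by move=> HA HB; exact: mxcvgD HA (mxcvgN HB). Qed.

Lemma mxcvgZ (p q : nat) (a : T -> C) (A : T -> 'M[C]_(p, q)) (a0 : C) A0 :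
  a t @[t --> F] --> a0 -> mxcvg A A0 -> mxcvg (fun t => a t *: A t) (a0 *: A0).
Proof.
move=> Ha HA i j; rewrite mxE; under eq_fun do rewrite mxE.
exact: cvgM Ha (HA i j).
Qed.

Lemma mxcvgM (p q s : nat) (A : T -> 'M[C]_(p, q)) (B : T -> 'M[C]_(q, s)) A0 B0 :
  mxcvg A A0 -> mxcvg B B0 -> mxcvg (fun t => A t *m B t) (A0 *m B0).
Proof.
move=> HA HB i j; rewrite mxE; under eq_fun do rewrite mxE.
by apply: cvg_bigsum => k; exact: cvgM (HA i k) (HB k j).
Qed.

Lemma mxcvg_adj (p q : nat) (A : T -> 'M[C]_(p, q)) A0 :
  mxcvg A A0 -> mxcvg (fun t => (A t)^t*) (A0^t*).
Proof.
move=> HA i j; rewrite !mxE; under eq_fun do rewrite !mxE.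
exact: cvg_conj (HA j i).
Qed.

Lemma mxcvg_sub (p q p' q' : nat) (f : 'I_p' -> 'I_p) (g : 'I_q' -> 'I_q)
    (A : T -> 'M[C]_(p, q)) (A0 : 'M[C]_(p, q)) :
  mxcvg A A0 -> mxcvg (fun t => mxsub f g (A t)) (mxsub f g A0).
Proof.
move=> HA i j; rewrite mxE; under eq_fun do rewrite mxE.
exact: HA.
Qed.

Lemma mxcvg_lsub (p q1 q2 : nat) (A : T -> 'M[C]_(p, q1 + q2)) A0 :
  mxcvg A A0 -> mxcvg (fun t => lsubmx (A t)) (lsubmx A0).
Proof. by rewrite lsubmxEsub; exact: mxcvg_sub. Qed.

Lemma mxcvg_rsub (p q1 q2 : nat) (A : T -> 'M[C]_(p, q1 + q2)) A0 :
  mxcvg A A0 -> mxcvg (fun t => rsubmx (A t)) (rsubmx A0).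
Proof. by rewrite rsubmxEsub; exact: mxcvg_sub. Qed.

Lemma mxcvg_usub (p q1 q2 : nat) (A : T -> 'M[C]_(q1 + q2, p)) A0 :
  mxcvg A A0 -> mxcvg (fun t => usubmx (A t)) (usubmx A0).
Proof. by rewrite usubmxEsub; exact: mxcvg_sub. Qed.

Lemma mxcvg_dsub (p q1 q2 : nat) (A : T -> 'M[C]_(q1 + q2, p)) A0 :
  mxcvg A A0 -> mxcvg (fun t => dsubmx (A t)) (dsubmx A0).
Proof. by rewrite dsubmxEsub; exact: mxcvg_sub. Qed.

Lemma mxcvg_row (p q1 q2 : nat) (A : T -> 'M[C]_(p, q1)) (B : T -> 'M[C]_(p, q2)) A0 B0 :
  mxcvg A A0 -> mxcvg B B0 -> mxcvg (fun t => row_mx (A t) (B t)) (row_mx A0 B0).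
Proof.
move=> HA HB i j; case: (split_ordP j) => k ->.
  by rewrite row_mxEl; under eq_fun do rewrite row_mxEl; exact: HA.
by rewrite row_mxEr; under eq_fun do rewrite row_mxEr; exact: HB.
Qed.

Lemma mxcvg_col (p q1 q2 : nat) (A : T -> 'M[C]_(q1, p)) (B : T -> 'M[C]_(q2, p)) A0 B0 :
  mxcvg A A0 -> mxcvg B B0 -> mxcvg (fun t => col_mx (A t) (B t)) (col_mx A0 B0).
Proof.
move=> HA HB i j; case: (split_ordP i) => k ->.
  by rewrite col_mxEu; under eq_fun do rewrite col_mxEu; exact: HA.
by rewrite col_mxEd; under eq_fun do rewrite col_mxEd; exact: HB.
Qed.

Lemma cvg_det (n : nat) (A : T -> 'M[C]_n) A0 :
  mxcvg A A0 -> \det (A t) @[t --> F] --> \det A0.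
Proof.
move=> HA; apply: cvg_bigsum => s; apply: cvgM; first exact: cvg_cst.
by apply: cvg_bigprod => i; exact: HA.
Qed.

Lemma near_unitmx (n : nat) (A : T -> 'M[C]_n) A0 :
  mxcvg A A0 -> A0 \in unitmx -> \forall t \near F, A t \in unitmx.
Proof.
move=> HA; rewrite unitmxE unitfE => nz.
have H : \forall t \near F, \det (A t) != 0 by exact: cvgr_neq0 (cvg_det HA) nz.
by apply: filterS H => t; rewrite unitmxE unitfE.
Qed.

(** Cramer's formula: the entries of the inverse are polynomials in those of [A], divided by a
    determinant that stays away from 0. *)
Lemma mxcvg_inv (n : nat) (A : T -> 'M[C]_n) A0 :
  mxcvg A A0 -> A0 \in unitmx -> mxcvg (fun t => invmx (A t)) (invmx A0).
Proof.
move=> HA Au; have Au' := near_unitmx HA Au.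
apply: (@mxcvg_near_eq _ _ (fun t => (\det (A t))^-1 *: \adj (A t))); last first.
  by apply: filterS Au' => t At; rewrite /invmx At.
rewrite /invmx Au; apply: mxcvgZ.
  by apply: cvgV (cvg_det HA); rewrite unitmxE unitfE in Au.
move=> i j; rewrite mxE; under eq_fun do rewrite mxE.
apply: cvgM; first exact: cvg_cst.
by apply: cvg_det => k l; rewrite !mxE; under eq_fun do rewrite !mxE; exact: HA.
Qed.

Lemma cvg_smooth (n : nat) (U : set 'rV[C]_n) (f : 'rV[C]_n -> C) (y : T -> 'rV[C]_n) x0 :
  smooth_on U f -> U x0 -> mxcvg y x0 -> f (y t) @[t --> F] --> f x0.
Proof.
move=> fs Ux yx; have {yx}/(cvg_mxP FF) yx := yx.
exact: (cvg_comp _ _ yx (class_C_cont (fs 0%N) Ux)).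
Qed.

Lemma near_open (n : nat) (U : set 'rV[C]_n) (y : T -> 'rV[C]_n) x0 :
  open U -> U x0 -> mxcvg y x0 -> \forall t \near F, U (y t).
Proof.
move=> oU Ux yx; have {yx}/(cvg_mxP FF) yx := yx.
by apply: yx; exact: open_near.
Qed.

Section Derivatives.
Variables (n p q : nat) (U : set 'rV[C]_n) (H : 'rV[C]_n -> 'M[C]_(p, q)).
Variables (y xi : T -> 'rV[C]_n) (x0 xi0 : 'rV[C]_n).
Hypotheses (oU : open U) (Hs : msmooth U H) (Ux : U x0).
Hypotheses (yx : mxcvg y x0) (xixi : mxcvg xi xi0).

Lemma mxcvg_smooth : mxcvg (fun t => H (y t)) (H x0).
Proof. by move=> i j; exact: cvg_smooth (Hs i j) Ux yx. Qed.

(** The point and the direction both move. Expanding in coordinate derivatives, which are smooth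
    functions of the point, decouples them. *)
Lemma mxcvg_mwirt_del :
  mxcvg (fun t => mwirt (-'i) (xi t) H (y t)) (mwirt (-'i) xi0 H x0).
Proof.
move=> i j.
have E z z' : U z -> mwirt (-'i) z' H z i j = \sum_a z' 0 a * del a (fun y => H y i j) z.
  by move=> Uz; rewrite mwirtE wirt_delE //; exact: smooth_C1 oU (Hs i j) Uz.
rewrite (E _ _ Ux).
apply: (@cvg_near_eq _ _ _ _ (fun t => \sum_a xi t 0 a * del a (fun y => H y i j) (y t))).
  apply: cvg_bigsum => a; apply: cvgM; first exact: xixi.
  by apply: cvg_smooth Ux yx; rewrite delE; exact: smooth_wirt oU (Hs i j).
by apply: filterS (near_open oU Ux yx) => t Uy; rewrite E.
Qed.

Lemma mxcvg_mwirt_delbar :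
  mxcvg (fun t => mwirt 'i (xi t) H (y t)) (mwirt 'i xi0 H x0).
Proof.
move=> i j.
have E z z' : U z -> mwirt 'i z' H z i j = \sum_a (z' 0 a)^* * delbar a (fun y => H y i j) z.
  by move=> Uz; rewrite mwirtE wirt_delbarE //; exact: smooth_C1 oU (Hs i j) Uz.
rewrite (E _ _ Ux).
apply: (@cvg_near_eq _ _ _ _ (fun t => \sum_a (xi t 0 a)^* * delbar a (fun y => H y i j) (y t))).
  apply: cvg_bigsum => a.
  have fs : smooth_on U (delbar a (fun y => H y i j)).
    by rewrite delbarE; exact: smooth_wirt oU (Hs i j).
  exact: (cvgM (cvg_conj (@xixi 0 a)) (cvg_smooth fs Ux yx)).
by apply: filterS (near_open oU Ux yx) => t Uy; rewrite E.
Qed.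

Lemma mxcvg_mwirt_mwirt :
  mxcvg (fun t => mwirt (-'i) (xi t) (mwirt 'i (xi t) H) (y t))
    (mwirt (-'i) xi0 (mwirt 'i xi0 H) x0).
Proof.
move=> i j.
pose D a b := del a (delbar b (fun y => H y i j)).
have Ds a b : smooth_on U (D a b).
  by rewrite /D delE; apply: (smooth_wirt _ _ oU); rewrite delbarE; exact: smooth_wirt oU (Hs i j).
have [l E0] : exists l, l = \sum_a \sum_b D a b x0 * xi0 0 a * (xi0 0 b)^* by eexists.
have H0 : \sum_a \sum_b D a b (y t) * xi t 0 a * (xi t 0 b)^* @[t --> F] --> l.
  rewrite E0; apply: cvg_bigsum => a; apply: cvg_bigsum => b.
  exact: (cvgM (cvgM (cvg_smooth (Ds a b) Ux yx) (@xixi 0 a)) (cvg_conj (@xixi 0 b))).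
have El : l = mwirt (-'i) xi0 (mwirt 'i xi0 H) x0 i j.
  by rewrite E0; apply: esym; exact: mwirt_mwirtE oU Hs Ux.
rewrite El in H0; apply: (cvg_near_eq H0).
apply: filterS (near_open oU Ux yx) => t Uy.
by apply: esym; exact: mwirt_mwirtE oU Hs Uy.
Qed.

End Derivatives.

Lemma cvg_hform (n : nat) (M : T -> 'M[C]_n) M0 (u v : T -> 'rV[C]_n) u0 v0 :
  mxcvg M M0 -> mxcvg u u0 -> mxcvg v v0 ->
  hform (M t) (u t) (v t) @[t --> F] --> hform M0 u0 v0.
Proof. by move=> HM Hu Hv; exact: (mxcvgM (mxcvgM Hu HM) (mxcvg_adj Hv)). Qed.

End Limits.

(** * Frames and spheres *)

Section Frame.
Variable R : realType.
Local Notation C := (cplx R).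

Lemma posdef_unit (n : nat) (M : 'M[C]_n) :
  (forall u : 'rV_n, u != 0 -> 0 < hform M u u) -> M \in unitmx.
Proof.
move=> H; rewrite -row_free_unit -kermx_eq0; apply/negP => /negP K0.
have u0 : nz_row (kermx M) != 0 by rewrite nz_row_eq0.
have := H _ u0; rewrite /hform.
have /sub_kermxP -> := nz_row_sub (kermx M).
by rewrite mul0mx mxE ltxx.
Qed.

Section Holomorphic.
Variable n : nat.
Implicit Types (U : set 'rV[C]_n).

Lemma holomorphicP (p q : nat) U (F : 'rV[C]_n -> 'M[C]_(p, q)) :
  msmooth U F -> (forall x xi, U x -> mwirt 'i xi F x = 0) -> holomorphic_on U F.
Proof.
move=> Fs F0 i j; split; first exact: Fs.
by move=> a x Ux; rewrite delbarE -mwirtE F0 // mxE.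
Qed.

Lemma holomorphic_sub (p q : nat) U W (F : 'rV[C]_n -> 'M[C]_(p, q)) :
  U `<=` W -> holomorphic_on W F -> holomorphic_on U F.
Proof.
move=> UW Fh i j; split; first by move=> k; exact: class_C_sub UW ((Fh i j).1 k).
by move=> a x Ux; exact: (Fh i j).2 _ _ (UW _ Ux).
Qed.

Lemma holomorphic_cst (p q : nat) U (A : 'M[C]_(p, q)) : open U -> holomorphic_on U (fun=> A).
Proof.
move=> oU; apply: holomorphicP; first exact: msmooth_cst.
by move=> x xi _; exact: mwirt_cst.
Qed.

Lemma holomorphicD (p q : nat) U (F G : 'rV[C]_n -> 'M[C]_(p, q)) :
  open U -> holomorphic_on U F -> holomorphic_on U G -> holomorphic_on U (fun y => F y + G y).
Proof.
move=> oU Fh Gh; have Fs := holomorphic_msmooth Fh; have Gs := holomorphic_msmooth Gh.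
apply: holomorphicP; first exact: msmoothD.
move=> x xi Ux; apply: (etrans (mwirtD 'i xi Fs Gs Ux)).
by rewrite (mwirt_holomorphic xi oU Fh Ux) (mwirt_holomorphic xi oU Gh Ux) addr0.
Qed.

Lemma holomorphicM (p q r : nat) U (F : 'rV[C]_n -> 'M[C]_(p, q)) (G : 'rV[C]_n -> 'M[C]_(q, r)) :
  open U -> holomorphic_on U F -> holomorphic_on U G -> holomorphic_on U (fun y => F y *m G y).
Proof.
move=> oU Fh Gh; have Fs := holomorphic_msmooth Fh; have Gs := holomorphic_msmooth Gh.
apply: holomorphicP; first exact: msmoothM.
move=> x xi Ux; apply: (etrans (mwirtM 'i xi Fs Gs Ux)).
by rewrite (mwirt_holomorphic xi oU Fh Ux) (mwirt_holomorphic xi oU Gh Ux) mul0mx mulmx0 addr0.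
Qed.

Lemma holomorphic_col (p q r : nat) U (F : 'rV[C]_n -> 'M[C]_(p, r))
    (G : 'rV[C]_n -> 'M[C]_(q, r)) :
  holomorphic_on U F -> holomorphic_on U G -> holomorphic_on U (fun y => col_mx (F y) (G y)).
Proof.
move=> Fh Gh i j; case: (split_ordP i) => k ->.
  have -> : (fun y => col_mx (F y) (G y) (lshift q k) j) = (fun y => F y k j).
    by apply/funext => y; rewrite col_mxEu.
  exact: Fh.
have -> : (fun y => col_mx (F y) (G y) (rshift p k) j) = (fun y => G y k j).
  by apply/funext => y; rewrite col_mxEd.
exact: Gh.
Qed.

Lemma smooth_det (r : nat) U (A : 'rV[C]_n -> 'M[C]_r) : open U -> msmooth U A ->
  smooth_on U (fun y => \det (A y)).
Proof.
move=> oU As k; apply: (class_C_sum _ oU) => s _.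
apply: (class_CM oU (class_C_cst _ _ oU)).
by apply: (class_C_prod _ oU) => i _; exact: As.
Qed.

Lemma msmooth_inv (r : nat) U (A : 'rV[C]_n -> 'M[C]_r) : open U ->
  (forall y, U y -> A y \in unitmx) -> msmooth U A -> msmooth U (fun y => invmx (A y)).
Proof.
move=> oU Au As i j.
have ds : smooth_on U (fun y => (\det (A y))^-1).
  move=> k; apply: (class_CV oU _ (smooth_det oU As k)) => y /Au.
  by rewrite unitmxE unitfE.
have cs : smooth_on U (fun y => (-1) ^+ (j + i) * \det (row' j (col' i (A y)))).
  apply: (smoothM oU (smooth_cst _ oU)); apply: (smooth_det oU) => k l.
  by apply: (smooth_ext oU _ (As (lift j k) (lift i l))) => y _; rewrite !mxE.
apply: (smooth_ext oU _ (smoothM oU ds cs)) => y Uy.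
by rewrite /invmx (Au _ Uy) !mxE.
Qed.

(** Differentiate [A y *m invmx (A y) = 1%:M] along a (0,1)-direction. *)
Lemma holomorphic_inv (r : nat) U (A : 'rV[C]_n -> 'M[C]_r) : open U ->
  (forall y, U y -> A y \in unitmx) -> holomorphic_on U A ->
  holomorphic_on U (fun y => invmx (A y)).
Proof.
move=> oU Au Ah; have As := holomorphic_msmooth Ah; have Is := msmooth_inv oU Au As.
apply: holomorphicP => // x xi Ux.
have AI y : U y -> A y *m invmx (A y) = 1%:M by move=> /Au; exact: mulmxV.
have := mwirt_ext 'i xi oU AI Ux.
rewrite (mwirtM 'i xi As Is Ux) mwirt_cst (mwirt_holomorphic xi oU Ah Ux) mul0mx add0r.
by move=> /(congr1 (mulmx (invmx (A x)))); rewrite mulKmx ?Au // mulmx0.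
Qed.

End Holomorphic.

(* [E] is a frame of the kernel of the differential of phi, and the rows of [Q]
   lift the coordinate fields of the target. *)
Lemma local_frame (n m : nat) (U : set 'rV[C]_n) (phi : 'rV[C]_n -> 'rV[C]_m) (x0 : 'rV[C]_n) :
  open U -> holomorphic_on U phi -> U x0 -> row_full (jacobian phi x0) ->
  exists (r : nat) (U1 : set 'rV[C]_n) (E : 'rV[C]_n -> 'M[C]_(r, n))
    (Q : 'rV[C]_n -> 'M[C]_(m, n)) (P1 : 'M[C]_(n, r)),
  [/\ open U1, U1 `<=` U /\ U1 x0, holomorphic_on U1 E, holomorphic_on U1 Q &
      forall y, U1 y ->
      [/\ E y *m jacobian phi y = 0, Q y *m jacobian phi y = 1%:M,
          E y *m P1 = 1%:M, Q y *m P1 = 0 &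
          P1 *m E y + jacobian phi y *m Q y = 1%:M]].
Proof.
move=> oU hol Ux0 full; set J := jacobian phi; set J0 := J x0.
(* Constant data at [x0]: the rows of [P] are a basis of the kernel of [J0] and those of [Q0] lift
   the coordinate fields. The matrix [1 - J0 Q0] projects onto the kernel along the rows of [Q0],
   and [P1] gives the coordinates of that projection in the basis [P]. *)
pose P := row_base (kermx J0); pose Q0 := pinvmx J0; pose P1 := (1%:M - J0 *m Q0) *m pinvmx P.
have QJ0 : Q0 *m J0 = 1%:M by exact: mulVpmx.
have PJ0 : P *m J0 = 0 by apply/sub_kermxP; rewrite eq_row_base.
have P1P : P1 *m P = 1%:M - J0 *m Q0.
  apply: mulmxKpV; rewrite eq_row_base; apply/sub_kermxP.
  by rewrite mulmxBl mul1mx -mulmxA QJ0 mulmx1 subrr.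
have Pfree : row_free P by exact: row_base_free.
have PP1 : P *m P1 = 1%:M.
  apply: (row_free_inj Pfree); rewrite mul1mx -mulmxA P1P mulmxBr mulmx1 mulmxA PJ0.
  by rewrite mul0mx subr0.
have QP1 : Q0 *m P1 = 0.
  apply: (row_free_inj Pfree); rewrite mul0mx -mulmxA P1P mulmxBr mulmx1 mulmxA QJ0.
  by rewrite mul1mx subrr.
have Jh : holomorphic_on U J by exact: holomorphic_jacobian.
pose A y := Q0 *m J y.
have Ah : holomorphic_on U A by exact: holomorphicM oU (holomorphic_cst _ oU) Jh.
(* The constant rows of [Q0] stay transverse to the kernel as long as [Q0 *m J y] is invertible;
   multiplying by the inverse makes them exact lifts at [y]. *)
pose U1 := U `&` [set y | A y \in unitmx].
have oU1 : open U1.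
  rewrite openE => y [Uy Ay]; apply: filterI; first exact: open_near.
  apply: (@near_unitmx R _ (nbhs y) _ m A (A y) _ Ay) => i j.
  by apply: (@cvg_smooth R _ (nbhs y) _ n U _ id y (holomorphic_msmooth Ah i j) Uy) => k l;
    exact: coord_continuous.
have U1U : U1 `<=` U by move=> y [].
have Ah1 := holomorphic_sub U1U Ah; have Jh1 := holomorphic_sub U1U Jh.
have iAh : holomorphic_on U1 (fun y => invmx (A y)).
  by apply: holomorphic_inv => // y [].
pose Q y := invmx (A y) *m Q0.
have Qh : holomorphic_on U1 Q by exact: holomorphicM oU1 iAh (holomorphic_cst _ oU1).
(* The constant basis [P] projected to the kernel of [J y] along the rows of [Q y]. As
   [Q y *m P1 = 0], the constant [P1] keeps giving the coordinates in [E y]. *)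
pose E y := P + (- P) *m (J y *m Q y).
have Eh : holomorphic_on U1 E.
  apply: (holomorphicD oU1 (holomorphic_cst _ oU1)).
  exact: holomorphicM oU1 (holomorphic_cst _ oU1) (holomorphicM oU1 Jh1 Qh).
exists (\rank (kermx J0)), U1, E, Q, P1; split; [exact: oU1| |exact: Eh|exact: Qh|].
  by split; [exact: U1U|split; [exact: Ux0|rewrite /= /A QJ0 unitmx1]].
move=> y [Uy Ay].
have QJ : Q y *m J y = 1%:M by rewrite /Q -mulmxA mulVmx.
have QyP1 : Q y *m P1 = 0 by rewrite /Q -mulmxA QP1 mulmx0.
have JQJ : J y *m Q y *m J y = J y by rewrite -mulmxA QJ mulmx1.
have JQP1 : J y *m Q y *m P1 = 0 by rewrite -mulmxA QyP1 mulmx0.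
split; [|exact: QJ| |exact: QyP1|].
- by rewrite /E mulmxDl !mulNmx -(mulmxA P) JQJ subrr.
- by rewrite /E mulmxDl !mulNmx -(mulmxA P) JQP1 mulmx0 oppr0 addr0.
have Q0JQ : Q0 *m (J y *m Q y) = Q0 by rewrite mulmxA /Q mulKVmx.
have -> : P1 *m E y = P1 *m P - (P1 *m P) *m (J y *m Q y).
  by rewrite /E mulmxDr mulNmx mulmxN (mulmxA P1 P).
by rewrite P1P mulmxBl mul1mx -(mulmxA J0) Q0JQ opprB addrA subrK subrK.
Qed.

(** * Compact sets of directions *)

Lemma compact_square : compact [set z : C | `|complex.Re z| <= 1 /\ `|complex.Im z| <= 1].
Proof.
pose f (p : R * R) : C := toC p.1 + 'i * toC p.2.
have -> : [set z : C | `|complex.Re z| <= 1 /\ `|complex.Im z| <= 1] =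
    f @` (`[-1, 1] `*` `[-1, 1])%classic.
  apply/seteqP; split=> z /=.
    move=> [h1 h2]; exists (complex.Re z, complex.Im z); last by rewrite /f -cplxE.
    by split=> /=; rewrite in_itv /= -ler_norml.
  move=> [[a b]] /= [/= ]; rewrite !in_itv /= -!ler_norml => ha hb <-.
  have -> : f (a, b) = Complex a b.
    by rewrite /f [RHS]complexE /= complexiE.
  by [].
apply: continuous_compact.
  apply: continuous_subspaceT => p; apply: cvgD; first by apply: cvg_toC; exact: cvg_fst.
  by apply: cvgM; [exact: cvg_cst|apply: cvg_toC; exact: cvg_snd].
by apply: compact_setX; exact: segment_compact.
Qed.

Lemma compact_circle : compact [set z : C | `|z| = 1].
Proof.
apply: (subclosed_compact _ compact_square).
  have -> : [set z : C | `|z| = 1] = Num.norm @^-1` [set (1 : C)] by [].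
  apply: preimage_closed; last first.
    by apply: accessible_closed_set1; apply: hausdorff_accessible; exact: norm_hausdorff.
  by move=> z _; exact: norm_continuous.
move=> z /= z1; split; rewrite -ler_toC toC1 -z1; [exact: normr_Re|exact: normr_Im].
Qed.

(* These products of compact subsets of the plane meet every complex line. *)
Definition sphere_piece (n : nat) (i : 'I_n) : set 'rV[C]_n :=
  [set v | forall j, if j == i then `|v 0 j| = 1
           else `|complex.Re (v 0 j)| <= 1 /\ `|complex.Im (v 0 j)| <= 1].

Lemma compact_sphere_piece (n : nat) (i : 'I_n) : compact (sphere_piece i).
Proof.
pose A (j : 'I_n) : set C := if j == i then [set z : C | `|z| = 1] else
  [set z : C | `|complex.Re z| <= 1 /\ `|complex.Im z| <= 1].
have -> : sphere_piece i = [set v | forall j, A j (v 0 j)].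
  by apply/seteqP; split=> v /= H j; have := H j; rewrite /A; case: ifP.
apply: rV_compact => j; rewrite /A; case: ifP => _; [exact: compact_circle|exact: compact_square].
Qed.

Lemma sphere_piece_neq0 (n : nat) (i : 'I_n) v : sphere_piece i v -> v != 0.
Proof.
move=> /(_ i); rewrite eqxx => h; apply/eqP => v0.
by move: h; rewrite v0 mxE normr0 => /eqP; rewrite eq_sym oner_eq0.
Qed.

(** Divide by the modulus of a coordinate of largest modulus; its index selects the piece. *)
Lemma sphere_piece_scale (n : nat) (v : 'rV[C]_n) : v != 0 ->
  exists i, exists2 c : C, c != 0 & sphere_piece i (c *: v).
Proof.
move=> v0.
have nv0 : mx_norm v != 0 by apply: contra_neq v0 => /mx_norm_eq0.
have [[i0 i] /= vi] := mx_norm_neq0 nv0; rewrite ord1 in vi.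
have vji j : `|v 0 j| <= `|v 0 i|.
  rewrite -vi mx_normE -[leLHS]nngE num_le.
  by apply: (le_bigmax _ (fun i => `|v i.1 i.2|%:nng) (0, j)).
have vi0 : v 0 i != 0 by rewrite -normr_eq0 -vi.
exists i, `|v 0 i|^-1; first by rewrite invr_eq0 normr_eq0.
move=> j; have norm1 : `|(`|v 0 i|^-1 *: v) 0 j| <= 1.
  by rewrite mxE normrM normfV normr_id ler_pdivrMl ?normr_gt0 // mulr1.
case: eqP => [->|_]; first by rewrite mxE normrM normfV normr_id mulVf // normr_eq0.
by split; rewrite -ler_toC (le_trans _ norm1) ?normr_Re ?normr_Im.
Qed.
End Frame.

(** * Signs, scaling and limits of curvature forms *)

Section Preliminaries.
Variable R : realType.
Local Notation C := (cplx R).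

Lemma jacobian_id (n : nat) (y : 'rV[C]_n) : jacobian id y = 1%:M.
Proof.
apply/matrixP => a j; rewrite !mxE.
have E v : rderive (fun z : 'rV[C]_n => id z 0 j) v y = v 0 j.
  by apply: is_rder_rderive; exact: is_rder_coord.
rewrite /del !E !mxE eqxx /= eq_sym.
case: (a == j) => /=; last by rewrite !mulr0 subr0 mulr0.
have -> : 1 - 'i * ('i * 1) = 1 - 'i ^+ 2 :> C by ring.
by rewrite sqrCi; field.
Qed.

Lemma holomorphic_id (n : nat) (U : set 'rV[C]_n) : open U -> holomorphic_on U id.
Proof.
move=> oU i j; split; first by move=> k; rewrite ord1; exact: class_C_coord.
move=> a x _; rewrite ord1.
have E v : rderive (fun z : 'rV[C]_n => id z 0 j) v x = v 0 j.
  by apply: is_rder_rderive; exact: is_rder_coord.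
rewrite /delbar !E !mxE eqxx /=.
case: (j == a) => /=; rewrite ?mulr0n ?mulr1n; last by rewrite !mulr0 addr0 mulr0.
have -> : 1 + 'i * ('i * 1) = 1 + 'i ^+ 2 :> C by ring.
by rewrite sqrCi subrr mulr0.
Qed.

Lemma curv_comp (n m r : nat) (U : set 'rV[C]_n) (W : set 'rV[C]_m)
    (phi : 'rV[C]_n -> 'rV[C]_m) (h : 'rV[C]_m -> 'M[C]_r) x xi :
  open U -> open W -> holomorphic_on U phi -> (forall y, U y -> W (phi y)) ->
  msmooth W h -> U x ->
  curv (h \o phi) x xi = curv h (phi x) (xi *m jacobian phi x).
Proof.
move=> oU oW hol UW hs Ux.
have curv_eq (a a' b b' d d' M : 'M[C]_r) : a = a' -> b = b' -> d = d' ->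
  - a + b *m invmx M *m d = - a' + b' *m invmx M *m d' by move=> -> -> ->.
exact: curv_eq (mwirt_mwirt_comp _ oU oW hol UW hs Ux) (mwirt_comp _ _ oU oW hol UW hs Ux)
  (mwirt_comp _ _ oU oW hol UW hs Ux).
Qed.

Lemma mwirt_ulsub (n p q p' q' : nat) (H : 'rV[C]_n -> 'M[C]_(p + p', q + q')) s xi x :
  mwirt s xi (fun y => ulsubmx (H y)) x = ulsubmx (mwirt s xi H x).
Proof.
apply/matrixP => i j; rewrite mwirtE.
have -> : (fun y => ulsubmx (H y) i j) = (fun y => H y (lshift p' i) (lshift q' j)).
  by apply/funext => y; rewrite !mxE.
have -> : ulsubmx (mwirt s xi H x) i j = mwirt s xi H x (lshift p' i) (lshift q' j).
  by rewrite !mxE.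
by rewrite mwirtE.
Qed.

Lemma mwirt_congr_cst (n p q p' q' : nat) (U : set 'rV[C]_n) (L : 'M[C]_(p', p))
    (A : 'rV[C]_n -> 'M[C]_(p, q)) (M : 'M[C]_(q, q')) s xi x :
  open U -> msmooth U A -> U x ->
  mwirt s xi (fun y => L *m A y *m M) x = L *m mwirt s xi A x *m M.
Proof.
move=> oU As Ux; have Ls := msmooth_cst L oU; have Ms := msmooth_cst M oU.
apply: (etrans (mwirtM s xi (msmoothM oU Ls As) Ms Ux)).
by rewrite mwirt_cst mulmx0 addr0 (mwirtM s xi Ls As Ux) mwirt_cst mul0mx add0r.
Qed.

Lemma hform_0l (n : nat) (M : 'M[C]_n) (v : 'rV[C]_n) : hform M 0 v = 0.
Proof. by rewrite /hform !mul0mx mxE. Qed.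

Lemma chern_form_0l (n r : nat) (h : 'rV[C]_n -> 'M[C]_r) x xi : chern_form h x 0 xi = 0.
Proof.
rewrite /chern_form big1 // => i _; rewrite big1 // => j _.
by rewrite big1 // => a _; rewrite big1 // => b _; rewrite mxE mulr0 !mul0r.
Qed.

Lemma chern_form_0r (n r : nat) (h : 'rV[C]_n -> 'M[C]_r) x v : chern_form h x v 0 = 0.
Proof.
rewrite /chern_form big1 // => i _; rewrite big1 // => j _.
by rewrite big1 // => a _; rewrite big1 // => b _; rewrite mxE mulr0 !mul0r.
Qed.

Lemma chern_form_scale (n r : nat) (h : 'rV[C]_n -> 'M[C]_r) x v xi (a b : C) :
  chern_form h x (a *: v) (b *: xi) = `|a| ^+ 2 * `|b| ^+ 2 * chern_form h x v xi.
Proof.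
rewrite /chern_form mulr_sumr; apply: eq_bigr => i _; rewrite mulr_sumr.
apply: eq_bigr => j _; rewrite mulr_sumr; apply: eq_bigr => c _; rewrite mulr_sumr.
apply: eq_bigr => d _; rewrite !mxE !rmorphM /= !normCK.
by move: (chern_curv _ _ _ _ _ _) => z; ring.
Qed.

(** In [cplx R] a negative number has imaginary part 0, and a limit says nothing of the imaginary
    parts of nearby values. Their reality is therefore a hypothesis, and the limit only decides the
    sign of the real part. *)
Lemma near_neg (T : Type) (F : set_system T) {FF : Filter F} (f : T -> C) (l : C) :
  f t @[t --> F] --> l -> l < 0 -> (\forall t \near F, f t \is Num.real) ->
  \forall t \near F, f t < 0.
Proof.
move=> fl l0 freal.
have Rel : complex.Re l < 0 by move: l0; rewrite ltcE => /andP[].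
have Ref : \forall t \near F, complex.Re (f t) < 0.
  have Rl := cvg_Re fl.
  exact: (@cvgr_lt R T F FF (fun t => complex.Re (f t)) _ (Rl FF) 0 Rel).
near=> t; have : f t \is Num.real by near: t.
move=> /RRe_real <-; rewrite -[0]/(toC 0) -/(toC _) ltr_toC.
by near: t.
Unshelve. all: by end_near. Qed.

Lemma near_pos (T : Type) (F : set_system T) {FF : Filter F} (f : T -> C) (l : C) :
  f t @[t --> F] --> l -> 0 < l -> (\forall t \near F, f t \is Num.real) ->
  \forall t \near F, 0 < f t.
Proof.
move=> fl l0 freal.
have H : \forall t \near F, - f t < 0.
  apply: (near_neg (cvgN fl)); first by rewrite oppr_lt0.
  by apply: filterS freal => t; rewrite rpredN.
by apply: filterS H => t; rewrite oppr_lt0.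
Qed.

(** At [e = 0] the matrix to be inverted is [h'] itself, so the remainder depends continuously on
    all its data up to [e = 0]. *)
Lemma mxcvg_curv_remainder (T : Type) (F : set_system T) {FF : Filter F} (r m : nat)
    (Phi : T -> 'M[C]_r) (Psi : T -> 'M[C]_(r, m)) (Psi2 : T -> 'M[C]_(m, r))
    (Th h : T -> 'M[C]_m) (H1 H2 H12 : T -> 'M[C]_(r + m)) (h1 h2 : T -> 'M[C]_m) (e : T -> C)
    Phi' Psi' Psi2' Th' h' H1' H2' H12' h1' h2' :
  mxcvg (F := F) Phi Phi' -> mxcvg (F := F) Psi Psi' -> mxcvg (F := F) Psi2 Psi2' ->
  mxcvg (F := F) Th Th' -> mxcvg (F := F) h h' -> mxcvg (F := F) H1 H1' ->
  mxcvg (F := F) H2 H2' -> mxcvg (F := F) H12 H12' -> mxcvg (F := F) h1 h1' ->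
  mxcvg (F := F) h2 h2' -> e t @[t --> F] --> (0 : C) ->
  Phi' \in unitmx -> h' \in unitmx ->
  mxcvg (F := F) (fun t => curv_remainder (Phi t) (Psi t) (Psi2 t) (Th t) (h t)
                    (H1 t) (H2 t) (H12 t) (h1 t) (h2 t) (e t))
    (curv_remainder Phi' Psi' Psi2' Th' h' H1' H2' H12' h1' h2' 0).
Proof.
move=> cPhi cPsi cPsi2 cTh ch cH1 cH2 cH12 ch1 ch2 ce Phiu hu.
pose proof (mxcvg_inv cPhi Phiu) as iPhi; pose proof (mxcvg_inv ch hu) as ih.
pose proof (mxcvgB cTh (mxcvgM (mxcvgM cPsi2 iPhi) cPsi)) as cTh'.
pose proof (mxcvgD ch (mxcvgZ ce cTh')) as cS.
have hu0 : h' + 0 *: (Th' - Psi2' *m invmx Phi' *m Psi') \in unitmx.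
  by rewrite scale0r addr0.
pose proof (mxcvg_inv cS hu0) as cM.
pose proof (mxcvgB (mxcvg_rsub cH1) (mxcvgM (mxcvgM (mxcvg_lsub cH1) iPhi) cPsi)) as cc.
pose proof (mxcvgB (mxcvg_dsub cH2) (mxcvgM (mxcvgM cPsi2 iPhi) (mxcvg_usub cH2))) as cc'.
pose proof (mxcvg_col (@mxcvg_cst R T F FF r m 0) ch1) as cB1.
pose proof (mxcvg_row (@mxcvg_cst R T F FF m r 0) ch2) as cB2.
exact: (mxcvgB (mxcvgD (mxcvgD (mxcvgD (mxcvgD (mxcvgN cH12)
  (mxcvgM (mxcvgM (mxcvg_lsub cH1) iPhi) (mxcvg_usub cH2)))
  (mxcvgZ ce (mxcvgM (mxcvgM cc cM) cc'))) (mxcvgM (mxcvgM cc cM) cB2))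
  (mxcvgM (mxcvgM cB1 cM) cc')) (mxcvgM (mxcvgM (mxcvgM (mxcvgM cB1 cM) cTh') ih) cB2)).
Qed.

End Preliminaries.

(** * The metrics omega + e^-1 phi^* h near a point *)

Section LocalTheorem.
Variables (R : realType) (n m : nat).
Local Notation C := (cplx R).

Lemma mxcvg_curv (T : Type) (F : set_system T) {FF : Filter F} (p q : nat) (U : set 'rV[C]_p)
    (h : 'rV[C]_p -> 'M[C]_q) (y xi : T -> 'rV[C]_p) x0 xi0 :
  open U -> msmooth U h -> U x0 -> h x0 \in unitmx ->
  mxcvg (F := F) y x0 -> mxcvg (F := F) xi xi0 ->
  mxcvg (F := F) (fun t => curv h (y t) (xi t)) (curv h x0 xi0).
Proof.
move=> oU hs Ux hu yx xixi.
pose proof (mxcvg_mwirt_mwirt oU hs Ux yx xixi) as c12.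
pose proof (mxcvg_mwirt_del oU hs Ux yx xixi) as c1.
pose proof (mxcvg_mwirt_delbar oU hs Ux yx xixi) as c2.
pose proof (mxcvg_inv (mxcvg_smooth hs Ux yx) hu) as ci.
exact: (mxcvgD (mxcvgN c12) (mxcvgM (mxcvgM c1 ci) c2)).
Qed.

Lemma hform_real (p : nat) (M : 'M[C]_p) (u : 'rV[C]_p) : M^t* = M -> hform M u u \is Num.real.
Proof. by move=> Mh; apply/CrealP; rewrite hform_adj Mh. Qed.

Lemma toC_inv_gt0 (e : R) : 0 < e -> 0 < (toC e)^-1.
Proof. by move=> e0; rewrite invr_gt0 -[0]/(toC 0) ltr_toC. Qed.

Lemma toC_gt0_neq0 (e : R) : 0 < e -> toC e != 0.
Proof. by move=> e0; rewrite toC_eq0 gt_eqF. Qed.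

Lemma toC_real (e : R) : toC e \is Num.real.
Proof. by apply/CrealP; exact: conj_toC. Qed.

Variables (U : set 'rV[C]_n) (W : set 'rV[C]_m) (phi : 'rV[C]_n -> 'rV[C]_m).
Variables (omega : 'rV[C]_n -> 'M[C]_n) (h : 'rV[C]_m -> 'M[C]_m).
Hypotheses (oU : open U) (oW : open W) (hol : holomorphic_on U phi).
Hypothesis (UW : forall y, U y -> W (phi y)).
Hypotheses (os : msmooth U omega) (oh : forall y, U y -> (omega y)^t* = omega y).
Hypothesis (oc : forall y, U y -> closed_at omega y).
Hypotheses (hs : msmooth W h) (hh : forall z, W z -> (h z)^t* = h z).
Hypothesis (hc : forall z, W z -> closed_at h z).

Local Notation J := (jacobian phi).

Definition gform (e : R) (y : 'rV[C]_n) : 'M[C]_n :=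
  omega y + (toC e)^-1 *: (J y *m h (phi y) *m (J y)^t*).

Let Jh : holomorphic_on U J := holomorphic_jacobian oU hol.
Let Js : msmooth U J := holomorphic_msmooth Jh.
Let phis j : smooth_on U (fun y => phi y 0 j) := (hol 0 j).1.
Let hbs : msmooth U (h \o phi) := msmooth_comp oU oW phis UW hs.

Let pullback y := J y *m h (phi y) *m (J y)^t*.

Lemma pullback_smooth : msmooth U pullback.
Proof. exact: (msmoothM oU (msmoothM oU Js hbs) (msmooth_conjT oU Js)). Qed.

Lemma msmoothZ (p q : nat) (V : set 'rV[C]_n) (a : C) (A : 'rV[C]_n -> 'M[C]_(p, q)) :
  open V -> msmooth V A -> msmooth V (fun y => a *: A y).
Proof.
move=> oV As i j; apply: (smooth_ext oV _ (smoothM oV (smooth_cst a oV) (As i j))) => y Vy.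
by rewrite mxE.
Qed.

Lemma gform_smooth e : msmooth U (gform e).
Proof. exact: (msmoothD oU os (msmoothZ _ oU pullback_smooth)). Qed.

Lemma pullback_herm y : U y -> (pullback y)^t* = pullback y.
Proof. by move=> Uy; rewrite /pullback !adjM adjK (hh (UW Uy)) mulmxA. Qed.

Lemma gform_herm e y : U y -> (gform e y)^t* = gform e y.
Proof.
move=> Uy; apply: (etrans (adjD _ _)); apply: (etrans (congr1 (fun M => M + _) (oh Uy))).
apply: (congr1 (fun M => omega y + M)); apply: (etrans (adjZ _ _)).
rewrite -toCV conj_toC; apply: (congr1 (fun M => _ *: M)); exact: pullback_herm Uy.
Qed.

Lemma gform_closed e y : U y -> closed_at (gform e) y.
Proof.
move=> Uy; apply: (closed_at_herm oU (gform_smooth e) (gform_herm e) Uy) => a b c.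
have pc := closed_at_pullback a b c oU oW hol UW hs hc Uy.
have E d a' : del d (fun z => gform e z a' b) y = del d (fun z => omega z a' b) y
     + (toC e)^-1 * del d (fun z => pullback z a' b) y.
  rewrite !delE.
  have -> : (fun z => gform e z a' b) =
      (fun z => omega z a' b + (toC e)^-1 * pullback z a' b).
    by apply/funext => z; rewrite !mxE.
  have d1 := smooth_rderivable (os a' b) Uy.
  have d2 := smooth_rderivable (pullback_smooth a' b) Uy.
  have d3 := smooth_rderivable (smoothM oU (smooth_cst (toC e)^-1 oU) (pullback_smooth a' b)) Uy.
  apply: (etrans (wirtD _ _ d1 d3)); apply: (congr1 (fun z => _ + z)).
  exact: wirtZ d2.
have alg (z1 z1' z2 z2' k : C) : z1 = z1' -> z2 = z2' -> z1 + k * z2 = z1' + k * z2'.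
  by move=> -> ->.
apply: (etrans (E _ _)); apply: (etrans _ (esym (E _ _))).
exact: alg (oc Uy a b c).1 pc.
Qed.

Lemma gform_hform e y u v : hform (gform e y) u v =
  hform (omega y) u v + (toC e)^-1 * hform (h (phi y)) (u *m J y) (v *m J y).
Proof. by rewrite /gform hformD hformZ hform_congr. Qed.

Hypothesis (hpos : forall z, W z -> forall u : 'rV_m, u != 0 -> 0 < hform (h z) u u).
Hypothesis (hneg : forall z, W z -> forall b c : 'rV_m, b != 0 -> c != 0 ->
  chern_form h z b c < 0).
Hypothesis (opos : forall y, U y -> forall u : 'rV_n, u != 0 -> u *m J y = 0 ->
  0 < hform (omega y) u u).
Hypothesis (griff : forall (r : nat) (V : set 'rV[C]_n) (E : 'rV[C]_n -> 'M[C]_(r, n)),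
  open V -> V `<=` U -> holomorphic_on V E ->
  (forall y, V y -> row_free (E y) /\ (E y :=: kermx (J y))%MS) ->
  forall y, V y -> forall (v : 'rV_r) (xi : 'rV_n), v != 0 -> xi != 0 ->
  chern_form (fun y => E y *m omega y *m (E y)^t*) y v xi < 0).

Lemma h_hform_ge0 z u : W z -> 0 <= hform (h z) u u.
Proof.
move=> Wz; have [->|u0] := eqVneq u 0; first by rewrite hform_0l.
exact: ltW (hpos Wz u0).
Qed.

Lemma h_chern_le0 z b c : W z -> chern_form h z b c <= 0.
Proof.
move=> Wz; have [->|b0] := eqVneq b 0; first by rewrite chern_form_0l.
have [->|c0] := eqVneq c 0; first by rewrite chern_form_0r.
exact: ltW (hneg Wz b0 c0).
Qed.

Lemma h_unit z : W z -> h z \in unitmx.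
Proof. by move=> Wz; apply: posdef_unit; exact: hpos. Qed.

Section WithFrame.
Variables (r : nat) (U1 : set 'rV[C]_n) (E : 'rV[C]_n -> 'M[C]_(r, n)).
Variables (Q : 'rV[C]_n -> 'M[C]_(m, n)) (P1 : 'M[C]_(n, r)).
Hypotheses (oU1 : open U1) (U1U : U1 `<=` U).
Hypotheses (Eh : holomorphic_on U1 E) (Qh : holomorphic_on U1 Q).
Hypothesis frameP : forall y, U1 y ->
  [/\ E y *m J y = 0, Q y *m J y = 1%:M, E y *m P1 = 1%:M, Q y *m P1 = 0 &
      P1 *m E y + J y *m Q y = 1%:M].

(** [Fm] is the adapted frame, [Fi] its inverse and [Hm] the Gram matrix of [omega] alone. [C0] is
    the value of [Fm y *m J y]: the vertical members are sent to 0 and the lifts to the coordinate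
    fields. *)
Let Fm y : 'M[C]_(r + m, n) := col_mx (E y) (Q y).
Let Fi y : 'M[C]_(n, r + m) := row_mx P1 (J y).
Let Hm y : 'M[C]_(r + m) := Fm y *m omega y *m (Fm y)^t*.
Let hb := h \o phi.
Let C0 : 'M[C]_(r + m, m) := col_mx 0 1%:M.

Let Fh : holomorphic_on U1 Fm := holomorphic_col Eh Qh.
Let Fs : msmooth U1 Fm := holomorphic_msmooth Fh.
Let msmooth_U1 (p q : nat) (A : 'rV[C]_n -> 'M[C]_(p, q)) : msmooth U A -> msmooth U1 A.
Proof. by move=> As i j k; exact: class_C_sub U1U (As i j k). Qed.
Let Hs : msmooth U1 Hm := msmoothM oU1 (msmoothM oU1 Fs (msmooth_U1 os)) (msmooth_conjT oU1 Fs).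

Lemma frame_mulV y : U1 y -> Fm y *m Fi y = 1%:M.
Proof.
by move=> /frameP[EJ QJ EP QP _]; rewrite mul_col_row EJ QJ EP QP -scalar_mx_block.
Qed.

Lemma frame_mulK y : U1 y -> Fi y *m Fm y = 1%:M.
Proof. by move=> /frameP[_ _ _ _ eq1]; rewrite mul_row_col. Qed.

Lemma frame_vertical y : U1 y -> row_free (E y) /\ (E y :=: kermx (J y))%MS.
Proof.
move=> /frameP[EJ QJ EP QP eq1]; split.
  by apply/row_freeP; exists P1.
apply/eqmxP; apply/andP; split; first exact/sub_kermxP.
have kJ : kermx (J y) *m J y = 0 by exact: mulmx_ker.
rewrite -[X in (X <= _)%MS]mulmx1 -eq1 mulmxDr !mulmxA kJ mul0mx addr0.
exact: submxMl.
Qed.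

Lemma ulsub_frame y : ulsubmx (Hm y) = E y *m omega y *m (E y)^t*.
Proof.
rewrite /ulsubmx /Hm /Fm tr_col_mx map_row_mx -!mul_usub_mx col_mxKu.
by rewrite mul_mx_row row_mxKl.
Qed.

Lemma ulsub_frame_unit y : U1 y -> ulsubmx (Hm y) \in unitmx.
Proof.
move=> Uy; have [EJ _ EP _ _] := frameP Uy; rewrite ulsub_frame.
apply: posdef_unit => u u0; rewrite hform_congr; apply: (opos (U1U Uy)).
  by apply: contra_neq u0 => uE; rewrite -[u]mulmx1 -EP mulmxA uE mul0mx.
by rewrite -mulmxA EJ mulmx0.
Qed.

Let blk (k : C) (A : 'M[C]_m) : 'M[C]_(r + m) := k^-1 *: block_mx 0 0 0 A.

Lemma C0_congr A : C0 *m A *m C0^t* = block_mx 0 0 0 A.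
Proof.
rewrite /C0 mul_col_mx mul0mx mul1mx tr_col_mx map_row_mx adj1 trmx0 map_mx0.
by rewrite mul_col_row !mul0mx mulmx0 mulmx1.
Qed.

Lemma blkE k A : blk k A = (k^-1 *: C0) *m A *m C0^t*.
Proof. by rewrite -!scalemxAl C0_congr. Qed.

(** Since [Fm y *m J y] is the constant [C0], the pulled-back metric fills the last block only. It
    enters with constant coefficients, so differentiation commutes with [blk]. *)
Lemma gform_frame e y : U1 y ->
  Fm y *m gform e y *m (Fm y)^t* = Hm y + blk (toC e) (hb y).
Proof.
move=> Uy; have [EJ QJ _ _ _] := frameP Uy.
have FJ : Fm y *m J y = C0 by rewrite /Fm mul_col_mx EJ QJ.
rewrite /gform mulmxDr mulmxDl -scalemxAr -scalemxAl.
apply: (congr1 (fun M => Hm y + _ *: M)).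
by rewrite -[in RHS]C0_congr -FJ adjM !mulmxA.
Qed.

Definition remainder e y xi : 'M[C]_(r + m) :=
  curv_remainder (ulsubmx (Hm y)) (ursubmx (Hm y)) (dlsubmx (Hm y)) (drsubmx (Hm y)) (hb y)
    (mwirt (-'i) xi Hm y) (mwirt 'i xi Hm y) (mwirt (-'i) xi (mwirt 'i xi Hm) y)
    (mwirt (-'i) xi hb y) (mwirt 'i xi hb y) (toC e).

Lemma curv_frame e y xi : 0 < e -> U1 y ->
  hb y + toC e *: (drsubmx (Hm y) - dlsubmx (Hm y) *m invmx (ulsubmx (Hm y)) *m ursubmx (Hm y))
    \in unitmx ->
  Hm y + blk (toC e) (hb y) \in unitmx ->
  curv (fun z => Hm z + blk (toC e) (hb z)) y xi = blk (toC e) (curv hb y xi) + remainder e y xi.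
Proof.
move=> e_gt0 Uy Su Gu.
have hb1 : msmooth U1 hb by exact: msmooth_U1.
have blks (A : 'rV[C]_n -> 'M[C]_m) : msmooth U1 A -> msmooth U1 (fun z => blk (toC e) (A z)).
  move=> As; apply: (msmooth_ext oU1 _ (msmoothM oU1 (msmoothM oU1 (msmooth_cst _ oU1) As)
    (msmooth_cst _ oU1))) => z _; exact: esym (blkE _ _).
have D s (A : 'rV[C]_n -> 'M[C]_(r + m)) (B : 'rV[C]_n -> 'M[C]_m) z :
    msmooth U1 A -> msmooth U1 B -> U1 z ->
    mwirt s xi (fun z => A z + blk (toC e) (B z)) z =
    mwirt s xi A z + blk (toC e) (mwirt s xi B z).
  move=> As Bs Uz; apply: (etrans (mwirtD _ _ As (blks _ Bs) Uz)).
  apply: (congr1 (fun M => _ + M)); apply: (etrans _ (esym (blkE _ _))).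
  apply: (etrans _ (mwirt_congr_cst _ _ _ _ oU1 Bs Uz)).
  by apply: (mwirt_ext _ _ oU1 _ Uz) => w _; exact: blkE.
have D12 : mwirt (-'i) xi (mwirt 'i xi (fun z => Hm z + blk (toC e) (hb z))) y =
    mwirt (-'i) xi (mwirt 'i xi Hm) y + blk (toC e) (mwirt (-'i) xi (mwirt 'i xi hb) y).
  have Ez z : U1 z -> mwirt 'i xi (fun z => Hm z + blk (toC e) (hb z)) z =
      mwirt 'i xi Hm z + blk (toC e) (mwirt 'i xi hb z).
    by move=> Uz; exact: D Hs hb1 Uz.
  apply: (etrans (mwirt_ext _ _ oU1 Ez Uy)).
  exact: D (msmooth_mwirt _ _ oU1 Hs) (msmooth_mwirt _ _ oU1 hb1) Uy.
have curv_eq (a a' b b' d d' M : 'M[C]_(r + m)) : a = a' -> b = b' -> d = d' ->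
  - a + b *m invmx M *m d = - a' + b' *m invmx M *m d' by move=> -> -> ->.
apply: (etrans (curv_eq _ _ _ _ _ _ _ D12 (D _ _ _ _ Hs hb1 Uy) (D _ _ _ _ Hs hb1 Uy))).
have hu : hb y \in unitmx by exact: h_unit (UW (U1U Uy)).
have := curv_block_algebra (mwirt (-'i) xi Hm y) (mwirt 'i xi Hm y)
  (mwirt (-'i) xi (mwirt 'i xi Hm) y) (mwirt (-'i) xi hb y) (mwirt 'i xi hb y)
  (mwirt (-'i) xi (mwirt 'i xi hb) y) (ulsub_frame_unit Uy) hu (toC_gt0_neq0 e_gt0) Su.
rewrite submxK; apply; exact: Gu.
Qed.

(** The decomposition on which the whole argument rests. Only the bundle vector is rewritten in the
    frame, where its components are [eta *m Fi y]; the direction [xi] stays in the coordinates of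
    the chart, since the change of frame is [curv_pullback] over the identity. *)
Lemma chern_form_gform e y eta xi : 0 < e -> U1 y ->
  hb y + toC e *: (drsubmx (Hm y) - dlsubmx (Hm y) *m invmx (ulsubmx (Hm y)) *m ursubmx (Hm y))
    \in unitmx ->
  (forall u : 'rV_n, u != 0 -> 0 < hform (gform e y) u u) ->
  chern_form (gform e) y eta xi =
  (toC e)^-1 * chern_form h (phi y) (eta *m J y) (xi *m J y) +
  hform (remainder e y xi) (eta *m Fi y) (eta *m Fi y).
Proof.
move=> e_gt0 Uy Su gpos.
have gu : gform e y \in unitmx by exact: posdef_unit.
have FFi := frame_mulV Uy; have FiF := frame_mulK Uy.
have Gu : Hm y + blk (toC e) (hb y) \in unitmx.
  rewrite -(gform_frame e Uy); apply: posdef_unit => u u0; rewrite hform_congr; apply: gpos.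
  by apply: contra_neq u0 => uF; rewrite -[u]mulmx1 -FFi mulmxA uF mul0mx.
have gs1 : msmooth U1 (gform e) := msmooth_U1 (gform_smooth e).
have E1 : curv (fun z => Hm z + blk (toC e) (hb z)) y xi =
    Fm y *m curv (gform e) y xi *m (Fm y)^t*.
  have H := curv_pullback xi oU1 oU1 (holomorphic_id oU1) (fun z Uz => Uz) Fh gs1 Uy FFi FiF gu.
  rewrite jacobian_id mulmx1 in H; apply: (etrans _ H).
  by apply: (curv_ext _ oU1 _ Uy) => z Uz; exact: esym (gform_frame e Uz).
rewrite (chern_formE _ _ oU (gform_smooth e) (U1U Uy)).
have -> : hform (curv (gform e) y xi) eta eta =
    hform (Fm y *m curv (gform e) y xi *m (Fm y)^t*) (eta *m Fi y) (eta *m Fi y).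
  by rewrite hform_congr -mulmxA FiF mulmx1.
rewrite -E1 (curv_frame xi e_gt0 Uy Su Gu) hformD; apply: (congr1 (fun z => z + _)).
rewrite hformZ -C0_congr hform_congr; apply: (congr1 (fun z => _ * z)).
have -> : eta *m Fi y *m C0 = eta *m J y.
  by rewrite -mulmxA mul_row_col mulmx0 mulmx1 add0r.
rewrite (curv_comp xi oU oW hol UW hs (U1U Uy)).
by rewrite (chern_formE _ _ oW hs (UW (U1U Uy))).
Qed.

(** The components of a vertical [eta] are [row_mx (eta *m P1) 0], so [curv_remainder0] leaves the
    curvature of the upper left block of [Hm], which is the Gram matrix of the vertical frame [E].
    Griffiths negativity applies to it for every nonzero [xi], vertical or not. *)
Lemma remainder0_neg y eta xi : U1 y -> eta != 0 -> xi != 0 -> eta *m J y = 0 ->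
  hform (remainder 0 y xi) (eta *m Fi y) (eta *m Fi y) < 0.
Proof.
move=> Uy eta0 xi0 vert; have [EJ QJ EP QP eq1] := frameP Uy.
have -> : eta *m Fi y = row_mx (eta *m P1) 0 by rewrite mul_mx_row vert.
pose Phi z := E z *m omega z *m (E z)^t*.
have Es := holomorphic_msmooth Eh.
have Phis : msmooth U1 Phi := msmoothM oU1 (msmoothM oU1 Es (msmooth_U1 os)) (msmooth_conjT oU1 Es).
have v0 : eta *m P1 != 0.
  apply: contra_neq eta0 => v0; rewrite -[eta]mulmx1 -eq1 mulmxDr !mulmxA v0 vert.
  by rewrite !mul0mx addr0.
have neg := griff oU1 U1U Eh (@frame_vertical) Uy v0 xi0.
rewrite (chern_formE _ _ oU1 Phis Uy) in neg.
have ulE z : U1 z -> ulsubmx (Hm z) = Phi z by move=> _; exact: ulsub_frame.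
have ulD s : ulsubmx (mwirt s xi Hm y) = mwirt s xi Phi y.
  by apply: (etrans (esym (mwirt_ulsub _ _ _ _))); exact: mwirt_ext oU1 ulE Uy.
have ulD12 : ulsubmx (mwirt (-'i) xi (mwirt 'i xi Hm) y) = mwirt (-'i) xi (mwirt 'i xi Phi) y.
  apply: (etrans (esym (mwirt_ulsub _ _ _ _))); apply: (mwirt_ext _ _ oU1 _ Uy) => z Uz.
  by apply: (etrans (esym (mwirt_ulsub _ _ _ _))); exact: mwirt_ext oU1 ulE Uz.
have -> : hform (remainder 0 y xi) (row_mx (eta *m P1) 0) (row_mx (eta *m P1) 0) =
    hform (curv Phi y xi) (eta *m P1) (eta *m P1).
  rewrite /hform /remainder toC0 tr_row_mx map_col_mx trmx0 map_mx0 curv_remainder0.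
  by rewrite ulD12 !ulD ulE.
exact: neg.
Qed.

Section FrameNear.
Context {T : Type} {F : set_system T} {FF : Filter F}.
Variables (y : T -> 'rV[C]_n) (e : T -> R) (x0 : 'rV[C]_n).
Hypotheses (U1x : U1 x0) (yx : mxcvg (F := F) y x0).
Hypotheses (e0 : e t @[t --> F] --> (0 : R)) (epos : \forall t \near F, 0 < e t).
Hypothesis (gpos : \forall t \near F, forall u : 'rV_n, u != 0 ->
  0 < hform (gform (e t) (y t)) u u).
Variables (eta xi : T -> 'rV[C]_n) (eta0 xi0 : 'rV[C]_n).
Hypotheses (ceta : mxcvg (F := F) eta eta0) (cxi : mxcvg (F := F) xi xi0).

Let cH : mxcvg (F := F) (fun t => Hm (y t)) (Hm x0) := mxcvg_smooth Hs U1x yx.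
Let chb : mxcvg (F := F) (fun t => hb (y t)) (hb x0) := mxcvg_smooth hbs (U1U U1x) yx.
Let cul : mxcvg (F := F) (fun t => ulsubmx (Hm (y t))) (ulsubmx (Hm x0)) :=
  mxcvg_lsub (mxcvg_usub cH).
Let cur : mxcvg (F := F) (fun t => ursubmx (Hm (y t))) (ursubmx (Hm x0)) :=
  mxcvg_rsub (mxcvg_usub cH).
Let cdl : mxcvg (F := F) (fun t => dlsubmx (Hm (y t))) (dlsubmx (Hm x0)) :=
  mxcvg_lsub (mxcvg_dsub cH).
Let cdr : mxcvg (F := F) (fun t => drsubmx (Hm (y t))) (drsubmx (Hm x0)) :=
  mxcvg_rsub (mxcvg_dsub cH).
Let ce : toC (e t) @[t --> F] --> (0 : C) := cvg_toC e0.
Let hbu : hb x0 \in unitmx := h_unit (UW (U1U U1x)).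
Let cJ : mxcvg (F := F) (fun t => J (y t)) (J x0) := mxcvg_smooth Js (U1U U1x) yx.
Let nearU1 : \forall t \near F, U1 (y t) := near_open oU1 U1x yx.

Lemma remainder_cvg :
  mxcvg (F := F) (fun t => remainder (e t) (y t) (xi t)) (remainder 0 x0 xi0).
Proof.
have hb1 : msmooth U1 hb by exact: msmooth_U1.
exact: (mxcvg_curv_remainder cul cur cdl cdr chb
  (mxcvg_mwirt_del oU1 Hs U1x yx cxi) (mxcvg_mwirt_delbar oU1 Hs U1x yx cxi)
  (mxcvg_mwirt_mwirt oU1 Hs U1x yx cxi) (mxcvg_mwirt_del oU1 hb1 U1x yx cxi)
  (mxcvg_mwirt_delbar oU1 hb1 U1x yx cxi) ce (ulsub_frame_unit U1x) hbu).
Qed.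

Lemma remainder_form_cvg :
  hform (remainder (e t) (y t) (xi t)) (eta t *m Fi (y t)) (eta t *m Fi (y t)) @[t --> F] -->
  hform (remainder 0 x0 xi0) (eta0 *m Fi x0) (eta0 *m Fi x0).
Proof.
pose proof (mxcvgM ceta (mxcvg_row (@mxcvg_cst R T F FF _ _ P1) cJ)) as cw.
exact: (cvg_hform remainder_cvg cw cw).
Qed.

Lemma schur_near : \forall t \near F, hb (y t) + toC (e t) *: (drsubmx (Hm (y t)) -
  dlsubmx (Hm (y t)) *m invmx (ulsubmx (Hm (y t))) *m ursubmx (Hm (y t))) \in unitmx.
Proof.
pose proof (mxcvg_inv cul (ulsub_frame_unit U1x)) as ci.
pose proof (mxcvgD chb (mxcvgZ ce (mxcvgB cdr (mxcvgM (mxcvgM cdl ci) cur)))) as cS.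
by apply: (near_unitmx cS); rewrite scale0r addr0.
Qed.

Lemma chern_form_gform_near : \forall t \near F,
  [/\ 0 < e t, U1 (y t), chern_form (gform (e t)) (y t) (eta t) (xi t) \is Num.real,
      chern_form h (phi (y t)) (eta t *m J (y t)) (xi t *m J (y t)) \is Num.real &
      chern_form (gform (e t)) (y t) (eta t) (xi t) =
      (toC (e t))^-1 * chern_form h (phi (y t)) (eta t *m J (y t)) (xi t *m J (y t)) +
      hform (remainder (e t) (y t) (xi t)) (eta t *m Fi (y t)) (eta t *m Fi (y t))].
Proof.
apply: filterS (filterI (filterI epos nearU1) (filterI gpos schur_near)).
move=> t [[et Uy] [gt Su]]; split.
- exact: et.
- exact: Uy.
- exact: chern_form_real oU (gform_smooth _) (gform_herm _) (U1U Uy).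
- exact: chern_form_real oW hs hh (UW (U1U Uy)).
exact: chern_form_gform et Uy Su gt.
Qed.

Lemma chern_neg_near_vertical : eta0 != 0 -> xi0 != 0 -> eta0 *m J x0 = 0 ->
  \forall t \near F, chern_form (gform (e t)) (y t) (eta t) (xi t) < 0.
Proof.
move=> eta00 xi00 vert.
have neg0 := remainder0_neg U1x eta00 xi00 vert.
have real : \forall t \near F, hform (remainder (e t) (y t) (xi t))
    (eta t *m Fi (y t)) (eta t *m Fi (y t)) \is Num.real.
  apply: filterS chern_form_gform_near => t [et _ r1 r2 eqt].
  (* The remainder form is real as the difference of the curvature of the metric and [e^-1] times
     that of [h]. *)
  rewrite -(addKr ((toC (e t))^-1 * chern_form h (phi (y t)) (eta t *m J (y t)) (xi t *m J (y t)))
    (hform _ _ _)) -eqt.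
  apply: realD; last exact: r1.
  by rewrite rpredN; apply: realM; [rewrite realV; exact: toC_real|exact: r2].
pose proof (near_neg remainder_form_cvg neg0 real) as H.
apply: filterS (filterI H chern_form_gform_near) => t [H1 [et Uy _ _ eqt]].
rewrite eqt; apply: (le_lt_trans _ H1); rewrite gerDr.
apply: mulr_ge0_le0; first exact: ltW (toC_inv_gt0 et).
exact: h_chern_le0 (UW (U1U Uy)).
Qed.

(** Multiplied by [e], the curvature is the base curvature plus [e] times a convergent remainder.
    Its limit is the curvature of [h] on two nonzero vectors. *)
Lemma chern_neg_near_horizontal : eta0 *m J x0 != 0 -> xi0 *m J x0 != 0 ->
  \forall t \near F, chern_form (gform (e t)) (y t) (eta t) (xi t) < 0.
Proof.
move=> eta00 xi00; have Wx : W (phi x0) := UW (U1U U1x).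
have cphi : mxcvg (F := F) (fun t => phi (y t)) (phi x0).
  by move=> i j; rewrite ord1; exact: cvg_smooth (phis j) (U1U U1x) yx.
pose proof (mxcvgM ceta cJ) as cb; pose proof (mxcvgM cxi cJ) as cc.
pose proof (mxcvg_curv oW hs Wx (h_unit Wx) cphi cc) as cK.
pose proof (cvg_hform cK cb cb) as cN.
pose proof (cvgD cN (cvgM ce remainder_form_cvg)) as cS.
have lim0 (a b : C) : a < 0 -> a + 0 * b < 0 by rewrite mul0r addr0.
have neg0 := hneg Wx eta00 xi00.
rewrite (chern_formE _ _ oW hs Wx) in neg0.
have eqN t : 0 < e t -> U1 (y t) ->
  chern_form (gform (e t)) (y t) (eta t) (xi t) =
      (toC (e t))^-1 * chern_form h (phi (y t)) (eta t *m J (y t)) (xi t *m J (y t)) +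
      hform (remainder (e t) (y t) (xi t)) (eta t *m Fi (y t)) (eta t *m Fi (y t)) ->
  hform (curv h (phi (y t)) (xi t *m J (y t))) (eta t *m J (y t)) (eta t *m J (y t)) +
  toC (e t) * hform (remainder (e t) (y t) (xi t)) (eta t *m Fi (y t)) (eta t *m Fi (y t)) =
  toC (e t) * chern_form (gform (e t)) (y t) (eta t) (xi t).
  move=> et Uy ->; rewrite -(chern_formE _ _ oW hs (UW (U1U Uy))).
  by rewrite mulrDr mulrA divff ?mul1r // toC_gt0_neq0.
have real : \forall t \near F,
  hform (curv h (phi (y t)) (xi t *m J (y t))) (eta t *m J (y t)) (eta t *m J (y t)) +
  toC (e t) * hform (remainder (e t) (y t) (xi t)) (eta t *m Fi (y t)) (eta t *m Fi (y t))
    \is Num.real.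
  apply: filterS chern_form_gform_near => t [et Uy r1 _ eqt].
  by rewrite (eqN _ et Uy eqt); apply: realM; [exact: toC_real|exact: r1].
pose proof (near_neg cS (lim0 _ _ neg0) real) as H.
apply: filterS (filterI H chern_form_gform_near) => t [H1 [et Uy _ _ eqt]].
move: H1; rewrite (eqN _ et Uy eqt) pmulr_rlt0 //.
by rewrite -[0]/(toC 0) ltr_toC.
Qed.

End FrameNear.
End WithFrame.

Section Near.
Context {T : Type} {F : set_system T} {FF : Filter F}.
Variables (y : T -> 'rV[C]_n) (e : T -> R) (x0 : 'rV[C]_n).
Hypotheses (Ux : U x0) (yx : mxcvg (F := F) y x0).
Hypotheses (e0 : e t @[t --> F] --> (0 : R)) (epos : \forall t \near F, 0 < e t).

Let nearU : \forall t \near F, U (y t) := near_open oU Ux yx.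
Let cJ : mxcvg (F := F) (fun t => J (y t)) (J x0) := mxcvg_smooth Js Ux yx.
Let co : mxcvg (F := F) (fun t => omega (y t)) (omega x0) := mxcvg_smooth os Ux yx.
Let chb : mxcvg (F := F) (fun t => h (phi (y t))) (h (phi x0)) := mxcvg_smooth hbs Ux yx.
Let ce : toC (e t) @[t --> F] --> (0 : C) := cvg_toC e0.

(** Positivity follows the same dichotomy as the curvature. If [eta0] is vertical, [omega] is
    positive near it and the pulled-back term is nonnegative; otherwise [e] times the metric tends
    to the value of [h] on the nonzero image of [eta0]. *)
Lemma gform_pos_near (eta : T -> 'rV[C]_n) (eta0 : 'rV[C]_n) :
  mxcvg (F := F) eta eta0 -> eta0 != 0 ->
  \forall t \near F, 0 < hform (gform (e t) (y t)) (eta t) (eta t).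
Proof.
move=> ceta eta00.
pose proof (mxcvgM ceta cJ) as cetaJ.
pose proof (cvg_hform co ceta ceta) as c1.
pose proof (cvg_hform chb cetaJ cetaJ) as c2.
have real1 : \forall t \near F, hform (omega (y t)) (eta t) (eta t) \is Num.real.
  by apply: filterS nearU => t Uy; apply: hform_real; exact: oh.
have [vert|hor] := eqVneq (eta0 *m J x0) 0.
  pose proof (near_pos c1 (opos Ux eta00 vert) real1) as H.
  apply: filterS (filterI H (filterI nearU epos)) => t [H1 [Uy et]].
  rewrite gform_hform; apply: (lt_le_trans H1); rewrite lerDl.
  by apply: mulr_ge0; [exact: ltW (toC_inv_gt0 et)|exact: h_hform_ge0 (UW Uy)].
pose proof (cvgD (cvgM ce c1) c2) as c3.
rewrite mul0r add0r in c3.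
have H : \forall t \near F, 0 < toC (e t) * hform (omega (y t)) (eta t) (eta t) +
    hform (h (phi (y t))) (eta t *m J (y t)) (eta t *m J (y t)).
  apply: (near_pos c3 (hpos (UW Ux) hor)).
  apply: filterS (filterI real1 nearU) => t [r1 Uy].
  by apply: realD; [exact: realM (toC_real _) r1|apply: hform_real; exact: hh (UW Uy)].
apply: filterS (filterI H epos) => t [H1 et].
rewrite gform_hform -(pmulr_rgt0 _ (_ : 0 < toC (e t))); last by rewrite -[0]/(toC 0) ltr_toC.
by rewrite mulrDr mulrA divff ?toC_gt0_neq0 // mul1r.
Qed.

Lemma chern_neg_near (eta xi : T -> 'rV[C]_n) (eta0 xi0 : 'rV[C]_n) :
  row_full (J x0) ->
  (\forall t \near F, forall u : 'rV_n, u != 0 -> 0 < hform (gform (e t) (y t)) u u) ->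
  mxcvg (F := F) eta eta0 -> mxcvg (F := F) xi xi0 -> eta0 != 0 -> xi0 != 0 ->
  \forall t \near F, chern_form (gform (e t)) (y t) (eta t) (xi t) < 0.
Proof.
move=> full gpos ceta cxi eta00 xi00.
have [r [U1 [E [Q [P1 [oU1 [U1U U1x] Eh Qh frameP]]]]]] := local_frame oU hol Ux full.
have [vert|hor] := eqVneq (eta0 *m J x0) 0.
  exact: (chern_neg_near_vertical oU1 U1U Eh Qh frameP U1x yx e0 epos gpos
    ceta cxi eta00 xi00 vert).
(* The Kaehler symmetry of the curvature exchanges [eta] and [xi]. *)
have [vert'|hor'] := eqVneq (xi0 *m J x0) 0.
  have H := chern_neg_near_vertical oU1 U1U Eh Qh frameP U1x yx e0 epos gpos
    cxi ceta xi00 eta00 vert'.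
  apply: filterS (filterI (H _) nearU) => t [H1 Uy].
  by rewrite (chern_form_sym _ _ oU (gform_smooth _) (gform_closed _) Uy).
exact: (chern_neg_near_horizontal oU1 U1U Eh Qh frameP U1x yx e0 epos gpos ceta cxi hor hor').
Qed.

End Near.
End LocalTheorem.

Lemma near_prod_snd (S S' : Type) (F : set_system S) (G : set_system S') (FF : Filter F)
    (P : set S') : (\forall s \near G, P s) -> \forall t \near filter_prod F G, P t.2.
Proof.
move=> GP; exists (setT, P); first by split; [exact: filterT|exact: GP].
by move=> [a b] [].
Qed.

(** * Uniformity in the directions near a point *)

Section LocalNegativity.
Variables (R : realType) (n m : nat).
Local Notation C := (cplx R).
Variables (U : set 'rV[C]_n) (W : set 'rV[C]_m) (phi : 'rV[C]_n -> 'rV[C]_m).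
Variables (omega : 'rV[C]_n -> 'M[C]_n) (h : 'rV[C]_m -> 'M[C]_m).
Hypotheses (oU : open U) (oW : open W) (hol : holomorphic_on U phi).
Hypothesis (UW : forall y, U y -> W (phi y)).
Hypotheses (os : msmooth U omega) (oh : forall y, U y -> (omega y)^t* = omega y).
Hypothesis (oc : forall y, U y -> closed_at omega y).
Hypotheses (hs : msmooth W h) (hh : forall z, W z -> (h z)^t* = h z).
Hypothesis (hc : forall z, W z -> closed_at h z).
Local Notation J := (jacobian phi).
Hypothesis (hpos : forall z, W z -> forall u : 'rV_m, u != 0 -> 0 < hform (h z) u u).
Hypothesis (hneg : forall z, W z -> forall b c : 'rV_m, b != 0 -> c != 0 ->
  chern_form h z b c < 0).
Hypothesis (opos : forall y, U y -> forall u : 'rV_n, u != 0 -> u *m J y = 0 ->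
  0 < hform (omega y) u u).
Hypothesis (griff : forall (r : nat) (V : set 'rV[C]_n) (E : 'rV[C]_n -> 'M[C]_(r, n)),
  open V -> V `<=` U -> holomorphic_on V E ->
  (forall y, V y -> row_free (E y) /\ (E y :=: kermx (J y))%MS) ->
  forall y, V y -> forall (v : 'rV_r) (xi : 'rV_n), v != 0 -> xi != 0 ->
  chern_form (fun y => E y *m omega y *m (E y)^t*) y v xi < 0).
Variable x0 : 'rV[C]_n.
Hypotheses (Ux : U x0) (full : row_full (J x0)).

Local Notation G := (filter_prod (nbhs x0) (0 : R)^'+).
Local Notation g := (gform phi omega h).

Lemma scale_neq0_pos (a : C) : a != 0 -> 0 < `|a| ^+ 2.
Proof. by move=> a0; rewrite exprn_gt0 // normr_gt0. Qed.

(** Near-covering form of compactness: it is enough to treat vectors close to one [u0] of a sphere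
    piece, jointly with points close to [x0] and small [e]. Homogeneity then reaches all nonzero
    vectors. *)
Lemma gform_pos_locally : \forall p \near G, forall u : 'rV_n, u != 0 ->
  0 < hform (g p.2 p.1) u u.
Proof.
have H : \forall p \near G, forall i, sphere_piece i `<=` [set u | 0 < hform (g p.2 p.1) u u].
  apply: filter_forall => i.
  apply: (compact_near_coveringP _).1; first exact: compact_sphere_piece.
  move=> u0 /sphere_piece_neq0 u00.
  have c1 : mxcvg (F := filter_prod (nbhs u0) G) (fun t => t.2.1) x0.
    apply/cvg_mxP; exact: (cvg_comp _ _ cvg_snd cvg_fst).
  have c2 : (fun t : 'rV[C]_n * ('rV[C]_n * R) => t.2.2) @ filter_prod (nbhs u0) G --> (0 : R).
    apply: (cvg_comp _ _ cvg_snd); apply: (cvg_trans cvg_snd); exact: cvg_within.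
  have c3 : mxcvg (F := filter_prod (nbhs u0) G) (fun t => t.1) u0.
    apply/cvg_mxP; exact: cvg_fst.
  have c4 : \forall t \near filter_prod (nbhs u0) G, 0 < t.2.2.
    have c40 : \forall s \near G, 0 < s.2 by exact: (near_prod_snd _ (nbhs_right_gt 0)).
    exact: (near_prod_snd _ c40).
  exact: (gform_pos_near oU oW hol UW os oh hs hh hpos opos Ux c1 c2 c4 c3 u00).
apply: filterS H => p Hp u /sphere_piece_scale[i [c c0 /Hp /=]].
by rewrite hform_scale pmulr_rgt0 // scale_neq0_pos.
Qed.

Lemma gform_neg_locally : \forall p \near G, forall eta xi : 'rV_n, eta != 0 -> xi != 0 ->
  chern_form (g p.2) p.1 eta xi < 0.
Proof.
have H : \forall p \near G, forall ij : 'I_n * 'I_n,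
    sphere_piece ij.1 `*` sphere_piece ij.2 `<=`
    [set w | chern_form (g p.2) p.1 w.1 w.2 < 0].
  apply: filter_forall => -[i j] /=.
  have /compact_near_coveringP cover : compact (@sphere_piece R n i `*` @sphere_piece R n j).
    by apply: compact_setX; exact: compact_sphere_piece.
  apply: (cover _ G (fun p w => chern_form (g p.2) p.1 w.1 w.2 < 0)).
  move=> [u0 v0] [/= /sphere_piece_neq0 u00 /sphere_piece_neq0 v00].
  set FF := filter_prod (nbhs (u0, v0)) G.
  have c1 : mxcvg (F := FF) (fun t => t.2.1) x0.
    apply/cvg_mxP; exact: (cvg_comp _ _ cvg_snd cvg_fst).
  have c2 : (fun t : ('rV[C]_n * 'rV[C]_n) * ('rV[C]_n * R) => t.2.2) @ FF --> (0 : R).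
    apply: (cvg_comp _ _ cvg_snd); apply: (cvg_trans cvg_snd); exact: cvg_within.
  have c3 : mxcvg (F := FF) (fun t => t.1.1) u0.
    apply/cvg_mxP; exact: (cvg_comp _ _ cvg_fst cvg_fst).
  have c3' : mxcvg (F := FF) (fun t => t.1.2) v0.
    apply/cvg_mxP; exact: (cvg_comp _ _ cvg_fst cvg_snd).
  have c4 : \forall t \near FF, 0 < t.2.2.
    have c40 : \forall s \near G, 0 < s.2 by exact: (near_prod_snd _ (nbhs_right_gt 0)).
    exact: (near_prod_snd _ c40).
  (* The curvature formula inverts the metric, so positivity on all vectors must hold for the same
     points and values of [e]. *)
  have c5 : \forall t \near FF, forall u : 'rV_n, u != 0 -> 0 < hform (g t.2.2 t.2.1) u u.
    exact: (near_prod_snd _ gform_pos_locally).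
  exact: (chern_neg_near oU oW hol UW os oh oc hs hh hc hpos hneg opos griff Ux c1 c2 c4
    full c5 c3 c3' u00 v00).
apply: filterS H => p Hp eta xi /sphere_piece_scale[i [a a0 Ka]] /sphere_piece_scale[j [b b0 Kb]].
have := Hp (i, j) (a *: eta, b *: xi) (conj Ka Kb); rewrite /= chern_form_scale.
by rewrite pmulr_rlt0 // mulr_gt0 // scale_neq0_pos.
Qed.

End LocalNegativity.

(** * Manifolds *)

Section Manifold.
Variable R : realType.
Local Notation C := (cplx R).

Lemma closed_at_ext (n : nat) (U : set 'rV[C]_n) (f g : 'rV[C]_n -> 'M[C]_n) y :
  open U -> (forall z, U z -> f z = g z) -> U y -> closed_at f y -> closed_at g y.
Proof.
move=> oU fg Uy cl a b c; have [cl1 cl2] := cl a b c.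
have E s d a' b' : wirt s d (fun z => g z a' b') y = wirt s d (fun z => f z a' b') y.
  by apply: (open_wirt_ext _ _ oU _ Uy) => z Uz; rewrite fg.
split; [rewrite !delE in cl1 *|rewrite !delbarE in cl2 *].
  by apply: (etrans (E _ _ _ _)); apply: (etrans cl1); exact: esym (E _ _ _ _).
by apply: (etrans (E _ _ _ _)); apply: (etrans cl2); exact: esym (E _ _ _ _).
Qed.

Lemma chern_form_ext (n r : nat) (U : set 'rV[C]_n) (f g : 'rV[C]_n -> 'M[C]_r) y v xi :
  open U -> (forall z, U z -> f z = g z) -> U y -> msmooth U f ->
  chern_form f y v xi = chern_form g y v xi.
Proof.
move=> oU fg Uy fs; have gs := msmooth_ext oU fg fs.
by rewrite (chern_formE _ _ oU fs Uy) (chern_formE _ _ oU gs Uy) (curv_ext _ oU fg Uy).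
Qed.

Lemma msmooth_sub (n p q : nat) (U W : set 'rV[C]_n) (A : 'rV[C]_n -> 'M[C]_(p, q)) :
  U `<=` W -> msmooth W A -> msmooth U A.
Proof. by move=> UW As i j k; exact: class_C_sub UW (As i j k). Qed.

Section OneManifold.
Variables (n : nat) (M : complexManifold R n).
Implicit Types (i j : chart M) (x : M) (A : set M).

Lemma coord_image_open i A : open A -> open (coord i @` (dom i `&` A)).
Proof.
move=> oA; rewrite openE => _ [x [ix Ax] <-].
have Oi : open (coord i @` dom i) by exact: coord_open.
have D : (coord i @` dom i) (coord i x) by exists x.
have pc := param_continuous D.
rewrite /prop_for /continuous_at coordK // in pc.
have nA : \forall y \near coord i x, A (param i y) by apply: pc; exact: open_nbhs_nbhs.
apply: filterS (filterI nA (open_near Oi D)) => y [/= Ay [x' ix' Ex']].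
rewrite -Ex' coordK // in Ay.
by exists x'.
Qed.

Lemma coord_image_dom i j x : dom i x -> dom j x -> (coord i @` (dom i `&` dom j)) (coord i x).
Proof. by move=> ix jx; exists x. Qed.

Lemma transition_domain i j y : (coord i @` (dom i `&` dom j)) y ->
  (coord j @` (dom j `&` dom i)) ((coord j \o param i) y).
Proof. by move=> [x [ix jx] <-] /=; rewrite coordK //; exists x. Qed.

Lemma transition_open i j : open (coord i @` (dom i `&` dom j)).
Proof. by apply: coord_image_open; exact: dom_open. Qed.

Arguments transition_open : clear implicits.

Lemma jacobian_transition_inv i j x : dom i x -> dom j x ->
  jacobian (coord j \o param i) (coord i x) *m jacobian (coord i \o param j) (coord j x) = 1%:M.
Proof.
move=> ix jx; have Ux := coord_image_dom ix jx.
have J := jacobian_comp (transition_open i j) (transition_open j i)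
  (transition_holomorphic i j) (transition_holomorphic j i) (@transition_domain i j) Ux.
have E : (coord j \o param i) (coord i x) = coord j x by rewrite /= coordK.
rewrite E in J; rewrite -J -[RHS](jacobian_id (coord i x)).
apply: (jacobian_ext (transition_open i j) _ Ux) => _ [z [iz jz] <-] /=.
by rewrite !coordK.
Qed.

Variable w : form11 M.
Hypothesis ws : form_smooth w.

Lemma form_chart_eq i j y : (coord i @` (dom i `&` dom j)) y ->
  w i y = jacobian (coord j \o param i) y *m w j ((coord j \o param i) y)
          *m (jacobian (coord j \o param i) y)^t*.
Proof. by move=> [x [ix jx] <-]; rewrite (coef_transition w ix jx) /= coordK. Qed.

Lemma form_pos_transfer i j x : dom i x -> dom j x ->
  (forall u : 'rV_n, u != 0 -> 0 < hform (w j (coord j x)) u u) ->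
  forall u : 'rV_n, u != 0 -> 0 < hform (w i (coord i x)) u u.
Proof.
move=> ix jx H u u0; rewrite (coef_transition w ix jx) hform_congr; apply: H.
apply: contra_neq u0 => uJ.
by rewrite -[u]mulmx1 -(jacobian_transition_inv ix jx) mulmxA uJ mul0mx.
Qed.

(** Negativity will be known at each point in one chart only, whereas the conclusion ranges over all
    charts. The Jacobian of the transition acts on both vectors and, being invertible, keeps them
    nonzero. *)
Lemma chern_neg_transfer i j x : dom i x -> dom j x -> w j (coord j x) \in unitmx ->
  (forall eta xi : 'rV_n, eta != 0 -> xi != 0 -> chern_form (w j) (coord j x) eta xi < 0) ->
  forall eta xi : 'rV_n, eta != 0 -> xi != 0 -> chern_form (w i) (coord i x) eta xi < 0.
Proof.
move=> ix jx wu H eta xi eta0 xi0; have Ux := coord_image_dom ix jx.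
have Ux' := coord_image_dom jx ix.
have oU := transition_open i j; have oW := transition_open j i.
pose tau := coord j \o param i; pose J := jacobian tau.
have ET : tau (coord i x) = coord j x by rewrite /tau /= coordK.
have hol : holomorphic_on (coord i @` (dom i `&` dom j)) tau by exact: transition_holomorphic.
have wis : msmooth (coord i @` (dom i `&` dom j)) (w i).
  by apply: msmooth_sub (ws i) => _ [z [iz _] <-]; exists z.
have wjs : msmooth (coord j @` (dom j `&` dom i)) (w j).
  by apply: msmooth_sub (ws j) => _ [z [iz _] <-]; exists z.
have J1 := jacobian_transition_inv ix jx; have J2 := jacobian_transition_inv jx ix.
have wu' : w j (tau (coord i x)) \in unitmx by rewrite ET.
have E := curv_pullback xi oU oW hol (@transition_domain i j) (holomorphic_jacobian oU hol)
  wjs Ux J1 J2 wu'.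
rewrite ET in E.
rewrite (chern_formE _ _ oU wis Ux).
have -> : curv (w i) (coord i x) xi = J (coord i x) *m
    curv (w j) (coord j x) (xi *m J (coord i x)) *m (J (coord i x))^t*.
  by apply: (etrans _ E); apply: (curv_ext _ oU _ Ux) => y; exact: form_chart_eq.
rewrite hform_congr -(chern_formE _ _ oW wjs Ux').
have J0 (u : 'rV_n) : u != 0 -> u *m J (coord i x) != 0.
  by apply: contra_neq => uJ; rewrite -[u]mulmx1 -J1 mulmxA uJ mul0mx.
by apply: H; exact: J0.
Qed.

End OneManifold.
Arguments transition_open [n M] i j.

(** * The metrics on the total space *)

Section Pullback.
Variables (n m : nat) (X : complexManifold R n) (B : complexManifold R m) (p : X -> B).
Hypotheses (p_hol : holomorphic_map p) (omega : form11 X) (g : form11 B).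

Local Notation Uij i j := (coord i @` (dom i `&` p @^-1` dom j)).

Lemma fibred_open i j : open (Uij i j).
Proof.
apply: coord_image_open; apply: open_comp (@dom_open _ _ _ j) => x _.
exact: p_hol.1.
Qed.

Arguments fibred_open : clear implicits.

Lemma local_rep_coord (i : chart X) (j : chart B) x : dom i x ->
  local_rep p i j (coord i x) = coord j (p x).
Proof. by move=> ix; rewrite /local_rep /= coordK. Qed.

Lemma local_rep_image (i : chart X) (j : chart B) y : (Uij i j) y ->
  (coord j @` dom j) (local_rep p i j y).
Proof. by move=> [x [ix jx] <-]; rewrite local_rep_coord //; exists (p x). Qed.

Definition base_chart (b : B) : chart B := projT1 (cid (dom_cover b)).

Lemma base_chartP b : dom (base_chart b) b.
Proof. exact: projT2 (cid (dom_cover b)). Qed.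

(* By [pull_coefE] below, the choice of the chart of B is irrelevant. *)
Definition pull_coef (i : chart X) (y : 'rV[C]_n) : 'M[C]_n :=
  let b := p (param i y) in
  let J := jacobian (local_rep p i (base_chart b)) y in
  J *m g (base_chart b) (coord (base_chart b) b) *m J^t*.

Lemma jacobian_base_change (i : chart X) (j j' : chart B) x :
  dom i x -> dom j (p x) -> dom j' (p x) ->
  jacobian (local_rep p i j') (coord i x) =
  jacobian (local_rep p i j) (coord i x) *m jacobian (coord j' \o param j) (coord j (p x)).
Proof.
move=> ix jx j'x.
pose U := coord i @` (dom i `&` p @^-1` (dom j `&` dom j')).
have oU : open U.
  apply: coord_image_open; apply: open_comp; last by apply: openI; exact: dom_open.
  by move=> z _; exact: p_hol.1.
have Ux : U (coord i x) by exists x.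
have hol : holomorphic_on U (local_rep p i j).
  by apply: holomorphic_sub (p_hol.2 i j) => _ [z [iz [jz _]] <-]; exists z.
have UW y : U y -> (coord j @` (dom j `&` dom j')) (local_rep p i j y).
  by move=> [z [iz [jz j'z]] <-]; rewrite local_rep_coord //; exists (p z).
have J := jacobian_comp oU (transition_open j j') hol (transition_holomorphic j j') UW Ux.
rewrite local_rep_coord // in J; rewrite -J.
apply: (jacobian_ext oU _ Ux) => _ [z [iz [jz j'z]] <-].
by rewrite local_rep_coord //= local_rep_coord // coordK.
Qed.

Lemma pull_coefE (i : chart X) (j : chart B) x : dom i x -> dom j (p x) ->
  let J := jacobian (local_rep p i j) (coord i x) in
  pull_coef i (coord i x) = J *m g j (coord j (p x)) *m J^t*.
Proof.
move=> ix jx J; have Ep : param i (coord i x) = x := coordK ix.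
rewrite /pull_coef Ep; set j0 := base_chart _.
have j0x : dom j0 (p x) by exact: base_chartP.
by rewrite (coef_transition g j0x jx) /J (jacobian_base_change ix j0x jx) adjM !mulmxA.
Qed.

Lemma jacobian_chart_change (i i' : chart X) (j : chart B) x :
  dom i x -> dom i' x -> dom j (p x) ->
  jacobian (local_rep p i j) (coord i x) =
  jacobian (coord i' \o param i) (coord i x) *m jacobian (local_rep p i' j) (coord i' x).
Proof.
move=> ix i'x jx.
pose U := coord i @` (dom i `&` (dom i' `&` p @^-1` dom j)).
have opj : open (p @^-1` dom j).
  by apply: open_comp (@dom_open _ _ _ j) => z _; exact: p_hol.1.
have oU : open U by apply: coord_image_open; apply: openI => //; exact: dom_open.
have Ux : U (coord i x) by exists x.
have hol : holomorphic_on U (coord i' \o param i).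
  by apply: holomorphic_sub (transition_holomorphic i i') => _ [z [iz [i'z _]] <-]; exists z.
have UW y : U y -> (Uij i' j) ((coord i' \o param i) y).
  by move=> [z [iz [i'z jz]] <-] /=; rewrite coordK //; exists z.
have J := jacobian_comp oU (fibred_open i' j) hol (p_hol.2 i' j) UW Ux.
have E : (coord i' \o param i) (coord i x) = coord i' x by rewrite /= coordK.
rewrite E in J; rewrite -J; apply: (jacobian_ext oU _ Ux) => _ [z [iz [i'z jz]] <-].
have E' : (coord i' \o param i) (coord i z) = coord i' z by rewrite /= coordK.
by rewrite [RHS]/= -[coord i' (param i _)]/((coord i' \o param i) (coord i z)) E' !local_rep_coord.
Qed.

Definition metric_coef (e : R) (i : chart X) (y : 'rV[C]_n) : 'M[C]_n :=
  omega i y + (toC e)^-1 *: pull_coef i y.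

Lemma metric_coef_transition (e : R) (i i' : chart X) (x : X) : dom i x -> dom i' x ->
  let J := jacobian (coord i' \o param i) (coord i x) in
  metric_coef e i (coord i x) = J *m metric_coef e i' (coord i' x) *m J^t*.
Proof.
move=> ix i'x J; have jx := base_chartP (p x).
rewrite /metric_coef (pull_coefE ix jx) (pull_coefE i'x jx) (jacobian_chart_change ix i'x jx).
rewrite (coef_transition omega ix i'x) mulmxDr mulmxDl -scalemxAr -scalemxAl.
by apply: (congr1 (fun M => _ + _ *: M)); rewrite adjM !mulmxA.
Qed.

Definition metric_form (e : R) : form11 X := Form11 (metric_coef_transition e).

(** Where [p] maps into [dom j], the chosen charts of the base give way to the fixed chart [j], and
    the local results for one pair of charts apply. *)
Lemma metric_coefE (e : R) (i : chart X) (j : chart B) y : (Uij i j) y ->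
  metric_form e i y = gform (local_rep p i j) (omega i) (g j) e y.
Proof.
move=> [x [ix jx] <-]; rewrite /= /metric_coef (pull_coefE ix jx) /gform.
by rewrite local_rep_coord.
Qed.

End Pullback.
End Manifold.

(** * From charts to the whole of X *)

Section Total.
Variables (R : realType) (n m : nat).
Local Notation C := (cplx R).
Variables (X : complexManifold R n) (B : complexManifold R m) (p : X -> B).
Hypotheses (p_hol : holomorphic_map p) (p_sub : submersion p).
Variables (omega : form11 X) (g : form11 B).
Hypotheses (omega_real : form_real omega) (omega_smooth : form_smooth omega).
Hypotheses (omega_closed : form_closed omega) (omega_pos : positive_on_fibers p omega).
Hypotheses (g_real : form_real g) (g_smooth : form_smooth g).
Hypotheses (g_closed : form_closed g) (g_pos : form_positive g).
Hypotheses (g_neg : negative_bisectional g).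
Hypothesis (grif : griffiths_negative_relative_tangent p omega).

Local Notation Uij i j := (coord i @` (dom i `&` p @^-1` dom j)).
Local Notation G := (metric_form p_hol omega g).

Section Charts.
Variables (i : chart X) (j : chart B).
Local Notation phi := (local_rep p i j).

Let oU : open (Uij i j). Proof. exact: fibred_open. Qed.
Let oW : open (coord j @` dom j). Proof. exact: coord_open. Qed.
Let hol : holomorphic_on (Uij i j) phi := p_hol.2 i j.
Let UW y : (Uij i j) y -> (coord j @` dom j) (phi y). Proof. exact: local_rep_image. Qed.
Let os : msmooth (Uij i j) (omega i).
Proof. by apply: msmooth_sub (omega_smooth i) => _ [z [iz _] <-]; exists z. Qed.
Let oh y : (Uij i j) y -> (omega i y)^t* = omega i y.
Proof. by move=> [x [ix _] <-]; exact: omega_real. Qed.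
Let oc y : (Uij i j) y -> closed_at (omega i) y.
Proof.
move=> [x [ix _] <-] a b c.
have D : (coord i @` dom i) (coord i x) by exists x.
by have [/eqP + /eqP +] := omega_closed D a b c; rewrite !subr_eq0 => /eqP -> /eqP ->.
Qed.
Let hs : msmooth (coord j @` dom j) (g j). Proof. exact: g_smooth. Qed.
Let hh z : (coord j @` dom j) z -> (g j z)^t* = g j z.
Proof. by move=> [b jb <-]; exact: g_real. Qed.
Let hc z : (coord j @` dom j) z -> closed_at (g j) z.
Proof.
move=> Dz a b c.
by have [/eqP + /eqP +] := g_closed Dz a b c; rewrite !subr_eq0 => /eqP -> /eqP ->.
Qed.
Let hpos z : (coord j @` dom j) z -> forall u : 'rV_m, u != 0 -> 0 < hform (g j z) u u.
Proof. by move=> [b jb <-]; exact: g_pos. Qed.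
Let hneg z : (coord j @` dom j) z -> forall b c : 'rV_m, b != 0 -> c != 0 ->
  chern_form (g j) z b c < 0.
Proof.
move=> Dz b c b0 c0; have [x jx Ex] := Dz.
(* [bisectional] takes the tangent direction before the bundle vector, [chern_form] after it; hence
   the order of [c0] and [b0]. The denominator is positive and does not affect the sign. *)
have := g_neg jx c0 b0; rewrite /bisectional Ex pmulr_llt0 //.
by rewrite invr_gt0 mulr_gt0 // hpos.
Qed.
Let opos y : (Uij i j) y -> forall u : 'rV_n, u != 0 -> u *m jacobian phi y = 0 ->
  0 < hform (omega i y) u u.
Proof. by move=> [x [ix jx] <-] u u0 uJ; exact: (omega_pos erefl ix jx u0 uJ). Qed.
Let gr (r : nat) (V : set 'rV[C]_n) (E : 'rV[C]_n -> 'M[C]_(r, n)) :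
  open V -> V `<=` (Uij i j) -> holomorphic_on V E ->
  (forall y, V y -> row_free (E y) /\ (E y :=: kermx (jacobian phi y))%MS) ->
  forall y, V y -> forall (v : 'rV_r) (xi : 'rV_n), v != 0 -> xi != 0 ->
  chern_form (fun y => E y *m omega i y *m (E y)^t*) y v xi < 0.
Proof.
move=> oV VU Eh EP y Vy v xi v0 xi0.
have fr : vertical_frame p i j V E by split.
exact: (grif fr Vy v0 xi0).
Qed.

Lemma metric_eq e y : (Uij i j) y -> gform phi (omega i) (g j) e y = G e i y.
Proof. by move=> Uy; rewrite (metric_coefE _ _ _ _ Uy). Qed.

Lemma metric_smooth_local e : msmooth (Uij i j) (G e i).
Proof.
exact: (msmooth_ext oU (metric_eq e) (gform_smooth oU oW hol UW os hs e)).
Qed.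

Lemma metric_herm_local e y : (Uij i j) y -> (G e i y)^t* = G e i y.
Proof. by move=> Uy; rewrite -(metric_eq e Uy); exact: (gform_herm UW oh hh e Uy). Qed.

Lemma metric_closed_local e y : (Uij i j) y -> closed_at (G e i) y.
Proof.
move=> Uy; apply: (closed_at_ext oU (metric_eq e) Uy).
exact: (gform_closed oU oW hol UW os oh oc hs hh hc).
Qed.

Lemma metric_negative_near x0 : dom i x0 -> dom j (p x0) ->
  \forall x \near x0 & e \near (0 : R)^'+,
    [/\ dom i x, forall u : 'rV_n, u != 0 -> 0 < hform (G e i (coord i x)) u u &
      forall eta xi : 'rV_n, eta != 0 -> xi != 0 ->
        chern_form (G e i) (coord i x) eta xi < 0].
Proof.
move=> ix0 jx0; have Ux0 : (Uij i j) (coord i x0) by exists x0.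
have full : row_full (jacobian phi (coord i x0)) by exact: p_sub.
have Np := gform_pos_locally oU oW hol UW os oh hs hh hpos opos Ux0.
have Nn := gform_neg_locally oU oW hol UW os oh oc hs hh hc hpos hneg opos gr Ux0 full.
have [[P Q] /= [nP nQ] PQ] := filterI Np Nn.
have nx : \forall x \near x0, [/\ dom i x, dom j (p x) & P (coord i x)].
  have n1 : \forall x \near x0, dom i x by exact: open_nbhs_nbhs (conj (@dom_open _ _ _ i) ix0).
  have n2 : \forall x \near x0, dom j (p x).
    by apply: (p_hol.1 x0); exact: open_nbhs_nbhs (conj (@dom_open _ _ _ j) jx0).
  have cc : coord i x @[x --> x0] --> coord i x0 by exact: Defs.coord_continuous.
  have n3 : \forall x \near x0, P (coord i x) by exact: cc _ nP.
  by apply: filterS (filterI n1 (filterI n2 n3)) => x [? []].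
exists ([set x | [/\ dom i x, dom j (p x) & P (coord i x)]], Q) => //.
move=> [x e] /= [[ix jx Px] Qe]; have [pos neg] := PQ (coord i x, e) (conj Px Qe).
have Ux : (Uij i j) (coord i x) by exists x.
split; first exact: ix.
  move=> u u0.
  exact: (eq_ind _ (fun M : 'M[C]_n => 0 < hform M u u) (pos u u0) _ (metric_eq e Ux)).
move=> eta xi eta0 xi0.
rewrite -(chern_form_ext eta xi oU (metric_eq e) Ux (gform_smooth oU oW hol UW os hs e)).
exact: neg.
Qed.

End Charts.

Lemma metric_smooth e : form_smooth (G e).
Proof.
move=> i a b k; apply: class_C_local => _ [x ix <-].
have jx := base_chartP (p x).
exists (Uij i (base_chart (p x))); split; first exact: fibred_open.
  by exists x.
exact: metric_smooth_local.
Qed.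

Lemma metric_real e : form_real (G e).
Proof.
move=> i x ix; apply: (@metric_herm_local i (base_chart (p x))).
by exists x => //; split => //; exact: base_chartP.
Qed.

Lemma metric_closed e : form_closed (G e).
Proof.
move=> i _ [x ix <-] a b c.
have cl : closed_at (G e i) (coord i x).
  apply: (@metric_closed_local i (base_chart (p x))).
  by exists x => //; split => //; exact: base_chartP.
have [c1 c2] := cl a b c.
by split; apply/eqP; rewrite subr_eq0; apply/eqP; [exact: c1|exact: c2].
Qed.

(** In the near-covering form of compactness, a property holding for all [x] near each point and all
    small [e > 0] holds for all [x] at once. The chart varies with the point, so [P] asks for one
    suitable chart at [x]; the transfer lemmas pass to the others. *)
Lemma metric_negative_eventually : compact [set: X] ->
  \forall e \near (0 : R)^'+, form_positive (G e) /\ negative_bisectional (G e).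
Proof.
move=> /compact_near_coveringP cover.
pose P (e : R) (x : X) := exists i : chart X,
  [/\ dom i x, forall u : 'rV_n, u != 0 -> 0 < hform (G e i (coord i x)) u u &
      forall eta xi : 'rV_n, eta != 0 -> xi != 0 ->
        chern_form (G e i) (coord i x) eta xi < 0].
have H : \forall e \near (0 : R)^'+, [set: X] `<=` P e.
  apply: cover => x _; have [i ix] := dom_cover x.
  apply: filterS (metric_negative_near ix (base_chartP (p x))) => -[z e] /= H.
  by exists i.
apply: filterS H => e He; split.
  by move=> i x ix; have [j [jx pos _]] := He x I; exact: form_pos_transfer ix jx pos.
move=> i x ix xi eta xi0 eta0; have [j [jx pos neg]] := He x I.
have posi := form_pos_transfer ix jx pos.
rewrite /bisectional pmulr_llt0 ?invr_gt0 ?mulr_gt0 ?posi //.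
exact: (chern_neg_transfer (metric_smooth e) ix jx (posdef_unit pos) neg).
Qed.

End Total.

Theorem theorem1p2 (R : realType) (n m : nat)
    (X : complexManifold R n) (B : complexManifold R m) (p : X -> B)
    (X_compact : compact [set: X]) (B_compact : compact [set: B])
    (p_proper : proper_map p) (p_holomorphic : holomorphic_map p)
    (p_submersion : submersion p)
    (omega : form11 X) (omega_kahler : relative_kahler_form p omega)
    (B_negative : exists g : form11 B,
      kahler_metric g /\ negative_bisectional g)
    (TXB_negative : griffiths_negative_relative_tangent p omega) :
  exists g : form11 X, kahler_metric g /\ negative_bisectional g.
Proof.
have [g [[g_real g_smooth g_closed g_pos] g_neg]] := B_negative.
have [omega_real omega_smooth omega_closed omega_pos] := omega_kahler.
have H := metric_negative_eventually p_holomorphic p_submersion omega_real omega_smooth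
  omega_closed omega_pos g_real g_smooth g_closed g_pos g_neg TXB_negative X_compact.
(* The filter of right neighbourhoods of 0 is proper, so an admissible [e] exists. *)
have [e [pos neg]] := @filter_ex _ _ (at_right_proper_filter _) _ H.
exists (metric_form p_holomorphic omega g e); split; last exact: neg.
split; last exact: pos.
- exact: metric_real.
- exact: metric_smooth.
- exact: metric_closed.
Qed.
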